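(* For $i=1,2$, assume that $\psi_i$ satisfies Assumption $\mathcal{H}^1$ and $0\leq\psi_i\leq\Phi$ with $\Phi$ satisfying Assumption $\mathcal{H}^2$ (both assumptions are stated in the context). Let $u_i$ be the unique function such that $u_i\in\mathcal{C}([0,T];H)\cap L^2([0,T];V)$, $\frac{\partial u_i}{\partial t}\in L^2([0,T];H)$ and $$ \begin{cases} -\left( \frac{\partial u_i}{\partial t },v -u_i \right)_H + a(u_i,v-u_i)\geq 0 \quad \text{a.e. in } [0,T],\ \text{ for all } v\in L^2([0,T];V) \text{ with } v\geq \psi_i,\\ u_i\geq \psi_i \ \text{ a.e. in } [0,T]\times \mathbb{R} \times (0,\infty),\\ u_i(T)=\psi_i(T),\\ 0\leq u_i \leq \Phi. \end{cases} $$ Then: 1. If $\psi_1\leq\psi_2$, then $u_1\leq u_2$. 2. If $\psi_1-\psi_2\in L^\infty$, then $u_1-u_2\in L^\infty$ and $\|u_1-u_2\|_\infty\leq\|\psi_1-\psi_2\|_\infty$.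
   Context: Fix $T>0$, $\kappa,\theta,\sigma>0$, $\rho\in(-1,1)$ and set $\mathcal{O}=\mathbb{R}\times(0,\infty)$, with points $(x,y)$. Fix $\gamma>0$, $\mu>0$, put $\beta=\frac{2\kappa\theta}{\sigma^2}$ and let $\mathfrak{m}=\mathfrak{m}_{\gamma,\mu}$ be the measure $\mathfrak{m}_{\gamma,\mu}(dx,dy)=y^{\beta-1}e^{-\gamma|x|-\mu y}\,dx\,dy$ on $\mathcal{O}$. Spaces (derivatives in the sense of distributions): $H=L^2(\mathcal{O},\mathfrak{m})$ with its scalar product $(\cdot,\cdot)_H$; $V=\{u\in L^2(\mathcal{O},\mathfrak{m}):\ \sqrt{1+y}\,u,\ \sqrt{y}\,|\nabla u|\in L^2(\mathcal{O},\mathfrak{m})\}$ with $\|u\|_V^2=\int_{\mathcal{O}}(y|\nabla u|^2+(1+y)u^2)\,d\mathfrak{m}$; $H^2(\mathcal{O},\mathfrak{m})=\{u\in L^2(\mathcal{O},\mathfrak{m}):\ \sqrt{1+y}\,u,\ (1+y)|\nabla u|,\ y|D^2u|\in L^2(\mathcal{O},\mathfrak{m})\}$ with $\|u\|^2_{H^2}=\int_{\mathcal{O}}(y^2|D^2u|^2+(1+y)^2|\nabla u|^2+(1+y)u^2)\,d\mathfrak{m}$. $L^p([0,T];E)$ denotes the usual space of $E$-valued functions of time; $L^\infty$ and $\|\cdot\|_\infty$ refer to essentially bounded functions on $[0,T]\times\mathcal{O}$. Differential operator: $$\mathcal{L}= \frac y 2 \left( \frac{\partial^2}{\partial x^2 }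 +2 \rho \sigma \frac{\partial^2}{\partial y \partial x }+ \sigma^2 \frac{\partial^2}{\partial y^2 } \right) + \left(\frac{\rho\kappa\theta}{\sigma}-\frac y 2\right)\frac{\partial}{\partial x}+\kappa(\theta - y)\frac{\partial}{\partial y}.$$ Bilinear form: for $u,v\in V$, $$a(u,v)=\frac12\int_{\mathcal{O}}y\left(u_xv_x+\rho\sigma u_xv_y+\rho\sigma u_yv_x+\sigma^2u_yv_y\right)d\mathfrak{m}+\int_{\mathcal{O}}y\left(j_{\gamma,\mu}(x)u_x+k_{\gamma,\mu}(x)u_y\right)v\,d\mathfrak{m},$$ with $j_{\gamma,\mu}(x)=\frac12(1-\gamma\,\mathrm{sgn}(x)-\mu\rho\sigma)$ and $k_{\gamma,\mu}(x)=\kappa-\frac{\gamma\rho\sigma}{2}\mathrm{sgn}(x)-\frac{\mu\sigma^2}{2}$. Assumption $\mathcal{H}^1$ (on $\psi$): $\psi\in\mathcal{C}([0,T];H)$, $\sqrt{1+y}\,\psi\in L^2([0,T];V)$, $\psi(T)\in V$, and there exists $\Psi\in L^2([0,T];V)$ such that $\left|\frac{\partial\psi}{\partial t}\right|\leq\Psi$. Assumption $\mathcal{H}^2$ (on $\Phi$): $\Phi\in L^2([0,T];H^2(\mathcal{O},\mathfrak{m}))$, $(1+y)^{3/2}\Phi\in L^2([0,T];H)$, $\frac{\partial\Phi}{\partial t}+\mathcal{L}\Phi\leq0$, and $\sqrt{1+y}\,\Phi\in L^\infty([0,T];L^2(\mathcal{O},\mathfrak{m}_{\gamma,\mu'}))$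 for some $0<\mu'<\mu$. Existence and uniqueness of $u_i$ hold under these assumptions. *)

(* Defs.v *)
From HB Require Import structures.
From mathcomp Require Import all_boot all_order all_algebra.
From mathcomp Require Import all_classical all_reals all_analysis.
From mathcomp Require Import measurable_realfun.
Set Implicit Arguments.
Unset Strict Implicit.
Unset Printing Implicit Defensive.
Import Order.TTheory GRing.Theory Num.Theory.
Import numFieldNormedType.Exports.
Local Open Scope classical_set_scope.
Local Open Scope ring_scope.

(* Points of the half-plane are z = (x, y) : R * R, with x = z.1 and y = z.2;
   space-time points are p = (t, z) : R * (R * R).  Elements of function
   spaces are represented by functions on R * R, resp. families
   u : R -> R * R -> R, up to equality almost everywhere; values outside
   the half-plane, resp. outside [0, T], only have to be measurable. *)

Notation mR R := (measurableTypeR R).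
Notation mR2 R := (mR R * mR R)%type.
Notation mR3 R := (mR R * (mR R * mR R))%type.

Section lebesgue.
Context {R : realType}.

Definition leb1 : set (mR R) -> \bar R := @lebesgue_measure R.
HB.instance Definition _ := SigmaFiniteMeasure.on leb1.

Definition leb2 : set (mR2 R) -> \bar R := (leb1 \x leb1)%E.
HB.instance Definition _ := Measure.on leb2.

(* Needed for leb3: inference does not find a sigma-finite structure on a
   product measure m1 \x m2. *)
Lemma leb2_sigma_finite : sigma_finite setT leb2.
Proof.
have /sigma_finiteP[F [TF ndF Foo]] := sigma_finiteT leb1.
exists (fun n => F n `*` F n).
  rewrite -setXTT TF predeqE => -[x y]; split.
    move=> [/= [n _ Fnx] [k _ Fky]]; exists (maxn n k) => //; split.
    - by move: x Fnx; exact/subsetPset/ndF/leq_maxl.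
    - by move: y Fky; exact/subsetPset/ndF/leq_maxr.
  by move=> [n _ []/= ? ?]; split; exists n.
move=> k; have [? ?] := Foo k; split; first exact: measurableX.
by rewrite /leb2 product_measure1E// lte_mul_pinfty// ge0_fin_numE.
Qed.

HB.instance Definition _ :=
  Measure_isSigmaFinite.Build _ _ _ leb2 leb2_sigma_finite.

Definition leb3 : set (mR3 R) -> \bar R := (leb1 \x leb2)%E.
HB.instance Definition _ := Measure.on leb3.

End lebesgue.

Section domains.
Context {R : realType}.

Definition halfplane : set (R * R) := [set z | 0 < z.2].

Definition timeset (T : R) : set R := `[0, T].

Definition cylinder (T : R) : set (R * (R * R)) := timeset T `*` halfplane.

Definition open_cylinder (T : R) : set (R * (R * R)) := `]0, T[ `*` halfplane.

Lemma halfplaneE : halfplane = setT `*` `]0, +oo[%classic.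
Proof.
apply/seteqP; split => -[x y] /=; rewrite /halfplane /= in_itv/= andbT //.
by case.
Qed.

Lemma measurable_halfplane : measurable (halfplane : set (mR2 R)).
Proof. by rewrite halfplaneE; exact: measurableX. Qed.

Lemma measurable_cylinder T : measurable (cylinder T : set (mR3 R)).
Proof.
by apply: measurableX; [exact: measurable_itv|exact: measurable_halfplane].
Qed.

Definition leb_cyl (T : R) : set (mR3 R) -> \bar R :=
  mrestr leb3 (measurable_cylinder T).
HB.instance Definition _ (T : R) := Measure.on (leb_cyl T).

Definition ae_cyl (T : R) (P : R -> R * R -> Prop) : Prop :=
  {ae leb3, forall p, cylinder T p -> P p.1 p.2}.

End domains.

Section weighted_measure.
Context {R : realType}.
Variables (kappa theta sigma gamma mu : R).

Definition weight (z : R * R) : R :=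
  z.2 `^ (2 * kappa * theta / sigma ^+ 2 - 1)
  * expR (- gamma * `|z.1| - mu * z.2).

Definition wmeas (A : set (mR2 R)) : \bar R :=
  (\int[leb2]_(z in A `&` halfplane) (weight z)%:E)%E.

Lemma weight_ge0 z : 0 <= weight z.
Proof. by rewrite mulr_ge0 ?powR_ge0 ?expR_ge0. Qed.

Lemma measurable_weight : measurable_fun setT (weight : mR2 R -> R).
Proof.
apply: measurable_funM.
  exact: measurableT_comp (measurable_powR _) measurable_snd.
apply: measurableT_comp => //; apply: measurable_funB.
  apply: measurable_funM => //.
  exact: measurableT_comp measurable_fst.
by apply: measurable_funM => //; exact: measurable_snd.
Qed.

Let wmeas0 : wmeas set0 = 0%E.
Proof. by rewrite /wmeas set0I integral_set0. Qed.

Let wmeas_ge0 A : (0 <= wmeas A)%E.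
Proof. by apply: integral_ge0 => z _; rewrite lee_fin weight_ge0. Qed.

Let wmeas_sigma_additive : semi_sigma_additive wmeas.
Proof.
move=> F mF tF mUF.
rewrite /wmeas setI_bigcupl ge0_integral_bigcup//=.
- apply: is_cvg_ereal_nneg_natsum_cond => n _ _.
  by apply: integral_ge0 => z _; rewrite lee_fin weight_ge0.
- by move=> n; apply: measurableI => //; exact: measurable_halfplane.
- apply/measurable_EFinP; apply: measurable_funTS; exact: measurable_weight.
- by move=> z _; rewrite lee_fin weight_ge0.
- apply/trivIsetP => i j _ _ ij.
  by move/trivIsetP : tF => /(_ i j Logic.I Logic.I ij) FF; rewrite setIACA FF set0I.
Qed.

HB.instance Definition _ := isMeasure.Build _ _ _ wmeas
  wmeas0 wmeas_ge0 wmeas_sigma_additive.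

End weighted_measure.

Section distributions.

Fixpoint Ck {R : realType} {E : normedModType R} (n : nat) (f : E -> R) : Prop :=
  match n with
  | 0 => continuous f
  | n'.+1 => continuous f /\
      forall v : E, (forall x, derivable f x v) /\ Ck n' ('D_v f)
  end.

Definition test_function {R : realType} {E : normedModType R}
    (U : set E) (f : E -> R) : Prop :=
  (forall n, Ck n f) /\
  exists K, [/\ compact K, K `<=` U & forall x, ~ K x -> f x = 0].

Context {R : realType}.

Definition loc_integrable2 (U : set (R * R)) (f : R * R -> R) : Prop :=
  forall K : set (R * R), compact K -> K `<=` U ->
    leb2.-integrable K (EFin \o f).

Definition loc_integrable3 (U : set (R * (R * R))) (f : R * (R * R) -> R) :=
  forall K : set (R * (R * R)), compact K -> K `<=` U ->
    leb3.-integrable K (EFin \o f).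

Definition is_wderiv (e : R * R) (f g : R * R -> R) : Prop :=
  [/\ loc_integrable2 halfplane f, loc_integrable2 halfplane g &
    forall phi : R * R -> R, test_function halfplane phi ->
      \int[leb2]_(z in halfplane) (f z * 'D_e phi z) =
      - \int[leb2]_(z in halfplane) (g z * phi z)].

Definition e_x : R * R := (1, 0).
Definition e_y : R * R := (0, 1).

(* The distributional derivative along e as a function on functions: a
   representative of the derivative of f when that derivative is a locally
   integrable function, and 0 otherwise. *)
Definition wderiv (e : R * R) (f : R * R -> R) : R * R -> R :=
  xget (fun=> 0) [set g | is_wderiv e f g].

Definition e_t : R * (R * R) := (1, (0, 0)).

Definition is_wderiv_t (T : R) (u w : R -> R * R -> R) : Prop :=
  [/\ loc_integrable3 (open_cylinder T) (fun p => u p.1 p.2),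
      loc_integrable3 (open_cylinder T) (fun p => w p.1 p.2) &
    forall phi : R * (R * R) -> R, test_function (open_cylinder T) phi ->
      \int[leb3]_(p in open_cylinder T) (u p.1 p.2 * 'D_e_t phi p) =
      - \int[leb3]_(p in open_cylinder T) (w p.1 p.2 * phi p)].

End distributions.

Section spaces.
Context {R : realType}.
Variables (T : R) (m : {measure set (mR2 R) -> \bar R}).

Definition joint_measurable (u : R -> R * R -> R) : Prop :=
  measurable_fun setT (fun p : mR3 R => u p.1 p.2).

Definition inH (f : R * R -> R) : Prop := f \in Lfun m 2%:E.

Definition dotH (f g : R * R -> R) : R :=
  \int[m]_(z in halfplane) (f z * g z).

Definition sqnormV (f fx fy : R * R -> R) : \bar R :=
  (\int[m]_(z in halfplane)
     (z.2 * (fx z ^+ 2 + fy z ^+ 2) + (1 + z.2) * f z ^+ 2)%:E)%E.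

Definition inV (f : R * R -> R) : Prop :=
  measurable_fun setT (f : mR2 R -> R) /\
  exists fx fy : R * R -> R,
    [/\ measurable_fun setT (fx : mR2 R -> R),
        measurable_fun setT (fy : mR2 R -> R),
        is_wderiv e_x f fx, is_wderiv e_y f fy &
        (sqnormV f fx fy < +oo)%E].

Definition CH (u : R -> R * R -> R) : Prop :=
  joint_measurable u /\
  forall t, timeset T t ->
    inH (u t) /\
    'N[m]_2%:E[EFin \o (u s \- u t)%R]%E @[s --> within (timeset T) (nbhs t)]
      --> (0 : \bar R).

Definition L2H (u : R -> R * R -> R) : Prop :=
  joint_measurable u /\
  (\int[leb1]_(t in timeset T) ('N[m]_2%:E[EFin \o u t] ^+ 2) < +oo)%E.

(* Elements of L^p([0,T]; E) are jointly measurable functions.  As V is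
   separable, u is strongly measurable into V exactly when u and its spatial
   derivatives have jointly measurable versions.  In sqnormV f fx fy (and below
   in sqnormH2) the arguments after f stand for the distributional derivatives
   of f. *)
Definition L2V (u : R -> R * R -> R) : Prop :=
  joint_measurable u /\
  exists ux uy : R -> R * R -> R,
    [/\ joint_measurable ux, joint_measurable uy,
        {ae leb1, forall t, timeset T t ->
           is_wderiv e_x (u t) (ux t) /\ is_wderiv e_y (u t) (uy t)} &
        (\int[leb1]_(t in timeset T) sqnormV (u t) (ux t) (uy t) < +oo)%E].

Definition sqnormH2 (f fx fy fxx fxy fyy : R * R -> R) : \bar R :=
  (\int[m]_(z in halfplane)
     (z.2 ^+ 2 * (fxx z ^+ 2 + 2 * fxy z ^+ 2 + fyy z ^+ 2)
      + (1 + z.2) ^+ 2 * (fx z ^+ 2 + fy z ^+ 2)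
      + (1 + z.2) * f z ^+ 2)%:E)%E.

Definition L2H2 (u : R -> R * R -> R) : Prop :=
  joint_measurable u /\
  exists ux uy uxx uxy uyy : R -> R * R -> R,
    [/\ [/\ joint_measurable ux, joint_measurable uy, joint_measurable uxx,
            joint_measurable uxy & joint_measurable uyy],
        {ae leb1, forall t, timeset T t ->
           [/\ is_wderiv e_x (u t) (ux t), is_wderiv e_y (u t) (uy t),
               is_wderiv e_x (ux t) (uxx t), is_wderiv e_y (ux t) (uxy t) &
               is_wderiv e_y (uy t) (uyy t)]} &
        (\int[leb1]_(t in timeset T)
           sqnormH2 (u t) (ux t) (uy t) (uxx t) (uxy t) (uyy t) < +oo)%E].

Definition LooH (u : R -> R * R -> R) : Prop :=
  joint_measurable u /\
  exists C : R, {ae leb1, forall t, timeset T t ->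
    ('N[m]_2%:E[EFin \o u t] <= C%:E)%E}.

Definition Loo (u : R -> R * R -> R) : Prop :=
  (fun p : R * (R * R) => u p.1 p.2) \in Lfun (leb_cyl T) +oo%E.

Definition normoo (u : R -> R * R -> R) : \bar R :=
  'N[leb_cyl T]_+oo%E[EFin \o (fun p : R * (R * R) => u p.1 p.2)]%E.

End spaces.

Section heston.
Context {R : realType}.
Variables (T kappa theta sigma rho gamma mu : R).

Local Notation mgm := (wmeas kappa theta sigma gamma mu).

Definition Lop (f : R * R -> R) (z : R * R) : R :=
  z.2 / 2 * (wderiv e_x (wderiv e_x f) z
             + 2 * rho * sigma * wderiv e_y (wderiv e_x f) z
             + sigma ^+ 2 * wderiv e_y (wderiv e_y f) z)
  + (rho * kappa * theta / sigma - z.2 / 2) * wderiv e_x f z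
  + kappa * (theta - z.2) * wderiv e_y f z.

Definition jcoef (x : R) : R :=
  (1 - gamma * Num.sg x - mu * rho * sigma) / 2.

Definition kcoef (x : R) : R :=
  kappa - gamma * rho * sigma / 2 * Num.sg x - mu * sigma ^+ 2 / 2.

Definition aform (u v : R * R -> R) : R :=
  let ux := wderiv e_x u in let uy := wderiv e_y u in
  let vx := wderiv e_x v in let vy := wderiv e_y v in
  2^-1 * \int[mgm]_(z in halfplane)
    (z.2 * (ux z * vx z + rho * sigma * (ux z * vy z)
            + rho * sigma * (uy z * vx z) + sigma ^+ 2 * (uy z * vy z)))
  + \int[mgm]_(z in halfplane)
    (z.2 * (jcoef z.1 * ux z + kcoef z.1 * uy z) * v z).

Definition assumptionH1 (psi : R -> R * R -> R) : Prop :=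
  [/\ CH T mgm psi,
      L2V T mgm (fun t z => Num.sqrt (1 + z.2) * psi t z),
      inV mgm (psi T) &
      exists Psi dpsi : R -> R * R -> R,
        [/\ L2V T mgm Psi, is_wderiv_t T psi dpsi &
            ae_cyl T (fun t z => `|dpsi t z| <= Psi t z)]].

(* dPhi/dt + L Phi <= 0 in the sense of distributions on ]0,T[ x halfplane. *)
Definition subsolution (Phi : R -> R * R -> R) : Prop :=
  forall phi : R * (R * R) -> R, test_function (open_cylinder T) phi ->
    (forall p, 0 <= phi p) ->
    \int[leb1]_(t in `]0, T[) \int[leb2]_(z in halfplane)
      (- (Phi t z * 'D_e_t phi (t, z)) + Lop (Phi t) z * phi (t, z)) <= 0.

Definition assumptionH2 (Phi : R -> R * R -> R) : Prop :=
  [/\ L2H2 T mgm Phi,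
      L2H T mgm (fun t z => (1 + z.2) `^ (3 / 2) * Phi t z),
      subsolution Phi &
      exists mu' : R, [/\ 0 < mu', mu' < mu &
        LooH T (wmeas kappa theta sigma gamma mu')
          (fun t z => Num.sqrt (1 + z.2) * Phi t z)]].

Definition is_solution (Phi psi u : R -> R * R -> R) : Prop :=
  [/\ CH T mgm u, L2V T mgm u &
      exists du : R -> R * R -> R,
        [/\ is_wderiv_t T u du, L2H T mgm du &
            forall v : R -> R * R -> R, L2V T mgm v ->
              ae_cyl T (fun t z => psi t z <= v t z) ->
              {ae leb1, forall t, timeset T t ->
                 0 <= - dotH mgm (du t) (v t \- u t)
                      + aform (u t) (v t \- u t)}]] /\
  [/\ ae_cyl T (fun t z => psi t z <= u t z),
      {ae leb2, forall z, halfplane z -> u T z = psi T z} &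
      ae_cyl T (fun t z => 0 <= u t z <= Phi t z)].

End heston.

(* Main.v *)
Require Import Defs.
From HB Require Import structures.
From mathcomp Require Import all_boot all_order all_algebra.
From mathcomp Require Import all_classical all_reals all_analysis.
From mathcomp Require Import measurable_realfun ess_sup_inf ring lra.
Set Implicit Arguments.
Unset Strict Implicit.
Unset Printing Implicit Defensive.
Import Order.TTheory GRing.Theory Num.Theory.
Import numFieldNormedType.Exports.
Local Open Scope classical_set_scope.
Local Open Scope ring_scope.

(**
Both parts follow from one comparison: if [psi1 <= psi2 + c] with [c >= 0],
then [u1 <= u2 + c].  Take [c = 0] for the first part, and [c] the essential
bound of [psi1 - psi2], in both directions, for the second.

Let [d = u1 - u2] and [w = (d - c)^+].  Where [w > 0], both [u1 - w >= psi1] and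
[u2 + w >= psi2] hold, so any multiple [W] of [w] with [0 <= W <= w] gives the
admissible test functions [u1 - W] and [u2 + W], and adding the two tested
inequalities yields [(d_t, W)_H >= a(d, W)].  With [W = w] this does not close
by Gronwall's lemma: the first-order part of [a] is only bounded by the integral
of [y |grad w| w], and [y w^2] is not controlled by the norm of [H].  So the test
function is damped: [W = w * exp (- lam |S - t| y)] for a fixed [S] and a large
[lam].  Differentiating [e(t) = int w^2 exp (- lam |S - t| y) dm] for [t < S]
produces the additional nonnegative term
[lam int y w^2 exp (- lam |S - t| y) dm], which absorbs the first-order part.
The gradient of the damping factor is itself a first-order perturbation of size
[lam |S - t|], harmless as long as [lam |S - t| <= 1]; the condition
[|rho| < 1] makes the principal part positive definite ([quad_ge0], [form_ge0]).
Hence [e] is nondecreasing on [S - 1/lam, S] ([rate_nonneg], [energy_mono]).  If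
[w] tends to 0 in [H] at [S], then [e <= 0] there, and [w] vanishes on that
interval ([backward_step]).

At [S = T] the hypothesis on [w] comes from the continuity of [u1], [u2], [psi1],
[psi2] with values in [H] and from the terminal condition ([order_terminal],
[excess_near_terminal]).  Since [lam] does not depend on [S], finitely many
overlapping steps reach the time 0 ([backward_induction]), which proves
[comparison].

Two facts about distributional derivatives carry the computation.  First, [u1]
and [u2], whose time derivative is only a distribution given by a function, are
for almost every point of the half-plane absolutely continuous in time up to a
null set ([time_repr]).  This is the lemma of du Bois-Reymond with a parameter
([slice]): it suffices to test with a countable family of products of smooth
functions, so that the exceptional sets do not accumulate ([determining]).  The
derivative of [e] is then a matter of one-dimensional calculus of absolutely
continuous functions and of Fubini's theorem.  Second, truncation preserves weak
differentiability in space ([wdir_pos]): by the same lemma a weakly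
differentiable function is absolutely continuous on almost every line, where
the chain rule for the positive part is [AC_pos].
*)

(** * Smooth functions and bumps *)

Section smooth.
Context {R : realType}.
Implicit Types (E F : normedModType R).

Lemma Ck_cst E n (c : R) : Ck n (fun _ : E => c).
Proof.
elim: n c => [|n IH] c /=; first exact: cst_continuous.
split; first exact: cst_continuous.
move=> v; split; first by move=> x; exact: derivable_cst.
have -> : 'D_v (fun _ : E => c) = (fun _ => 0).
  by apply/funext => x; rewrite derive_cst.
exact: IH.
Qed.

Lemma Ck_continuous E n (f : E -> R) : Ck n f -> continuous f.
Proof. by case: n => [//|n /= []]. Qed.

Lemma Ck_pred E n (f : E -> R) : Ck n.+1 f -> Ck n f.
Proof.
elim: n f => [|n IH] f; first by case.
move=> [cf Df]; split => // v; have [Dv CD] := Df v; split => //.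
exact: IH.
Qed.

Lemma CkD E n (f g : E -> R) : Ck n f -> Ck n g -> Ck n (fun x => f x + g x).
Proof.
elim: n f g => [|n IH] f g /=.
  by move=> cf cg x; apply: cvgD; [exact: cf|exact: cg].
move=> [cf Df] [cg Dg]; split.
  by move=> x; apply: cvgD; [exact: cf|exact: cg].
move=> v; have [df Cf] := Df v; have [dg Cg] := Dg v; split.
  by move=> x; apply: derivableD.
rewrite (_ : 'D_v _ = (fun x => 'D_v f x + 'D_v g x)); first exact: IH.
by apply/funext => x; rewrite -deriveD.
Qed.

Lemma CkM E n (f g : E -> R) : Ck n f -> Ck n g -> Ck n (fun x => f x * g x).
Proof.
elim: n f g => [|n IH] f g.
  by move=> /= cf cg x; apply: cvgM; [exact: cf|exact: cg].
move=> Cf Cg; have [cf Df] := Cf; have [cg Dg] := Cg; split.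
  by move=> x; apply: cvgM; [exact: cf|exact: cg].
move=> v; have [df Cdf] := Df v; have [dg Cdg] := Dg v; split.
  by move=> x; apply: derivableM.
rewrite (_ : 'D_v _ = (fun x => f x * 'D_v g x + g x * 'D_v f x)); last first.
  by apply/funext => x; rewrite -[LHS]/('D_v (f * g) x) deriveM.
by apply: CkD; apply: IH => //; exact: Ck_pred.
Qed.

(** The directional derivatives of [f \o A] are those of [f] taken along the
    linear part of [A], so composition with an affine map is handled without
    any chain rule for general smooth maps. *)
Lemma Ck_comp E F n (A L : E -> F) (f : F -> R) :
  continuous A -> (forall h v x, A (h *: v + x) = h *: L v + A x) ->
  Ck n f -> Ck n (f \o A).
Proof.
move=> cA AL; elim: n f => [|n IH] f.
  by move=> /= cf x; apply: continuous_comp; [exact: cA|exact: cf].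
move=> [cf Df]; split.
  by move=> x; apply: continuous_comp; [exact: cA|exact: cf].
move=> v; have [df Cdf] := Df (L v).
have e x : (fun h : R => h^-1 *: ((f \o A \o shift x) (h *: v) - (f \o A) x)) =
           (fun h : R => h^-1 *: ((f \o shift (A x)) (h *: L v) - f (A x))).
  by apply/funext => h /=; rewrite AL.
split; first by move=> x; rewrite /derivable e; exact: df.
rewrite (_ : 'D_v _ = ('D_(L v) f) \o A); first exact: IH.
by apply/funext => x; rewrite /derive e.
Qed.

(** In one variable the derivative along [v] is [v] times the derivative along
    1, so smoothness need only be tested along 1. *)
Lemma CkS1 n (f f' : R -> R) : (forall x : R, is_derive x 1 f (f' x)) ->
  Ck n f' -> Ck n.+1 f.
Proof.
move=> Df Cf'; have dif x : differentiable f x.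
  by apply/derivable1_diffP; have [] := Df x.
split; first by move=> x; exact: differentiable_continuous.
move=> v; split; first by move=> x; apply: diff_derivable.
rewrite (_ : 'D_v f = (fun x => v * f' x)).
  by apply: CkM => //; exact: Ck_cst.
apply/funext => x; rewrite deriveE// deriv1E; last by have [] := Df x.
by rewrite derive1E; have [_ ->] := Df x.
Qed.

Lemma Ck_expR n : Ck n (@expR R).
Proof.
elim: n => [|n IH]; first exact: continuous_expR.
by apply: CkS1 IH => x; exact: is_derive_expR.
Qed.

(** [x^-k * exp (- 1/x)], extended by 0 to the left of 0.  The parameter [k]
    makes the family stable under differentiation, up to linear combinations,
    whence smoothness by induction. *)
Definition flat (k : nat) (x : R) : R :=
  if 0 < x then x ^- k * expR (- x^-1) else 0.

Lemma flat_ge0 k x : 0 <= flat k x.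
Proof.
rewrite /flat; case: ifPn => // x0.
by rewrite mulr_ge0 ?expR_ge0// invr_ge0 exprn_ge0// ltW.
Qed.

Lemma flat_le k x : flat k x <= k.+1`!%:R * `|x|.
Proof.
rewrite /flat; case: ifPn => [x0|_]; last by rewrite mulr_ge0.
rewrite gtr0_norm// expRN ler_pdivrMr ?expR_gt0//.
have y0 : 0 < x^-1 by rewrite invr_gt0.
have f0 : 0 < k.+1`!%:R :> R by rewrite ltr0n fact_gt0.
(* [exp y >= y ^ (k+1) / (k+1)!] with [y = 1/x]. *)
have h := @expR_ge1Dxn R x^-1 k (ltW y0).
have {}h : x^-1 ^+ k.+1 / k.+1`!%:R <= expR x^-1.
  by apply: le_trans h; rewrite lerDr ler01.
rewrite -mulrA mulrC -ler_pdivrMr// -exprVn.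
rewrite -(ler_pdivrMl _ _ x0) mulrA.
by rewrite -exprS.
Qed.

Lemma flat_cvg0 k : flat k x @[x --> 0] --> 0.
Proof.
apply: (@squeeze_cvgr _ _ _ _ (fun=> 0) (fun x => k.+1`!%:R * `|x|)).
- by near=> x; rewrite flat_ge0 flat_le.
- exact: cvg_cst.
- rewrite -[X in _ --> X](mulr0 (k.+1`!%:R : R)); apply: cvgMr.
  by rewrite -[X in _ --> X](@normr0 _ R); apply: cvg_norm; exact: cvg_id.
Unshelve. all: by end_near. Qed.

Lemma is_derive_flat k (x : R) :
  is_derive x 1 (flat k) (flat k.+2 x - k%:R * flat k.+1 x).
Proof.
have [x0|x0|->] := ltgtP x 0.
- apply: (@near_eq_is_derive _ _ _ (cst 0)).
  + near=> y; rewrite /flat ifF//; apply/negbTE; rewrite -leNgt ltW//.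
    by near: y; exact: lt_nbhsl.
  + rewrite /flat !ifF ?mulr0 ?subr0; last 2 first.
    - by apply/negbTE; rewrite -leNgt ltW.
    - by apply/negbTE; rewrite -leNgt ltW.
    exact: is_derive_cst.
- apply: (@near_eq_is_derive R R R (fun y : R => y ^- k * expR (- y^-1))).
  + near=> y; rewrite /flat ifT// -oppr_lt0.
    by near: y; apply: Nlt_nbhsl; rewrite oppr_lt0.
  + rewrite /flat x0.
    have xn0 : x != 0 by rewrite gt_eqF.
    pose h (y : R) := y ^+ k * expR (- y).
    rewrite (_ : (fun _ => _) = h \o (fun y => y^-1)); last first.
      by apply/funext => y; rewrite /h /= exprVn.
    have dV : is_derive x 1 (fun y : R => y^-1) (- x ^- 2).
      apply: DeriveDef; first exact: (@derivableV _ _ id).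
      by rewrite (@deriveV _ _ id)// derive_id /GRing.scale/= mulr1.
    have dN : is_derive x^-1 1 (fun y : R => - y) (-1).
      exact: is_deriveNid.
    have dE : is_derive x^-1 1 (fun y => expR (- y)) (expR (- x^-1) * (-1)).
      by apply: (is_derive1_comp (is_derive_expR (- x^-1))).
    have dh : is_derive x^-1 1 h (x^-1 ^+ k * (expR (- x^-1) * (-1)) +
        expR (- x^-1) * (k%:R * x^-1 ^+ k.-1)).
      have hE : h = ((id : R -> R) ^+ k * (fun y => expR (- y)))%R.
        by apply/funext => y; rewrite /h !fctE.
      rewrite hE; have dX := is_deriveX k (is_derive_id (x^-1 : R) (1 : R)).
      apply: (is_derive_eq (is_deriveM dX dE)).
      by rewrite !fctE /GRing.scale/= mulr1.
    apply: (is_derive_eq (is_derive1_comp dh dV)).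
    rewrite -!exprVn mulrDl !exprS; case: k {h dh} => [|k] /=.
      by rewrite !expr0 !mul0r !mulr0 !mul0r !mulr1 !mul1r; ring.
    by rewrite !exprS; ring.
- have e : (fun h : R => h^-1 *: ((flat k \o shift 0) (h *: 1) - flat k 0)) =
           flat k.+1.
    apply/funext => h /=; rewrite addr0 /flat ltxx subr0 /GRing.scale/= mulr1.
    case: ifPn => h0; last by rewrite mulr0.
    by rewrite mulrA -!exprVn -exprS.
  have c : h^-1 *: ((flat k \o shift 0) (h *: 1) - flat k 0) @[h --> 0^'] --> (0:R).
    by rewrite e; apply: cvg_within_filter; exact: flat_cvg0.
  apply: DeriveDef; first by apply/cvg_ex; exists 0.
  by rewrite /derive (cvg_lim _ c)// /flat ltxx mulr0 subr0.
Unshelve. all: by end_near. Qed.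

Lemma Ck_flat n k : Ck n (flat k).
Proof.
elim: n k => [|n IH] k.
  move=> x; apply/differentiable_continuous/derivable1_diffP.
  by have [] := is_derive_flat k x.
apply: CkS1 (is_derive_flat k) _.
apply: CkD => //; rewrite (_ : (fun _ => _) = (fun x => - k%:R * flat k.+1 x)).
  by apply: CkM => //; exact: Ck_cst.
by apply/funext => x; rewrite mulNr.
Qed.

(** As [n] grows these functions increase to the indicator function of ]p, q[,
    which recovers integrals over intervals from integrals against smooth
    functions. *)
Definition bump (p q : R) (n : nat) (x : R) : R :=
  flat 0 (n.+1%:R * (x - p)) * flat 0 (n.+1%:R * (q - x)).

Lemma Ck_affine n (a b : R) (f : R -> R) : Ck n f ->
  Ck n (fun x => f (a * x + b)).
Proof.
move=> Cf; apply: (@Ck_comp _ _ n (fun x => a * x + b) (fun x => a * x)) => //.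
  by move=> x; apply: cvgD; [apply: cvgMr; exact: cvg_id|exact: cvg_cst].
by move=> h v x; rewrite /GRing.scale/=; ring.
Qed.

Lemma Ck_bump p q m n : Ck n (bump p q m).
Proof.
apply: CkM.
  rewrite (_ : (fun _ => _) = (fun x => flat 0 (m.+1%:R * x + - (m.+1%:R * p)))).
    by apply: Ck_affine; exact: Ck_flat.
  by apply/funext => x; rewrite mulrBr.
rewrite (_ : (fun _ => _) = (fun x => flat 0 (- m.+1%:R * x + m.+1%:R * q))).
  by apply: Ck_affine; exact: Ck_flat.
by apply/funext => x; rewrite mulrBr mulNr addrC.
Qed.

Lemma flat0_le1 x : flat 0 x <= 1.
Proof.
rewrite /flat; case: ifPn => // x0.
by rewrite expr0 invr1 mul1r expR_le1 oppr_le0 invr_ge0 ltW.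
Qed.

Lemma bump_ge0 p q n x : 0 <= bump p q n x.
Proof. by rewrite mulr_ge0 ?flat_ge0. Qed.

Lemma bump_le1 p q n x : bump p q n x <= 1.
Proof. by rewrite mulr_ile1 ?flat_ge0 ?flat0_le1. Qed.

Lemma bump_gt0 p q n x : p < x -> x < q -> 0 < bump p q n x.
Proof.
have flat_gt0 y : 0 < y -> 0 < flat 0 y.
  by move=> y0; rewrite /flat y0 expr0 invr1 mul1r expR_gt0.
by move=> px xq; rewrite mulr_gt0// flat_gt0// mulr_gt0// subr_gt0.
Qed.

Lemma bump_out p q n x : ~~ (p < x < q) -> bump p q n x = 0.
Proof.
rewrite /bump negb_and -!leNgt /flat => /orP[px|xq].
  by rewrite ifF ?mul0r// pmulr_rgt0// subr_gt0 ltNge px.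
by rewrite [X in _ * X]ifF ?mulr0// pmulr_rgt0// subr_gt0 ltNge xq.
Qed.

Lemma flat0_cvg x : 0 < x -> flat 0 (n.+1%:R * x) @[n --> \oo] --> (1 : R).
Proof.
move=> x0.
rewrite (_ : (fun _ => _) = (fun n => expR (- ((n.+1%:R : R)^-1 * x^-1)))).
  rewrite -[X in _ --> X](@expR0 R) -(oppr0 R) -(mul0r x^-1).
  apply: continuous_cvg; first exact: continuous_expR.
  by apply: cvgN; apply: cvgMl; exact: cvg_harmonic.
apply/funext => n.
by rewrite /flat mulr_gt0// expr0 invr1 mul1r invfM.
Qed.

Lemma bump_cvg p q x :
  bump p q n x @[n --> \oo] --> ((p < x < q)%R%:R : R).
Proof.
have [/andP[px xq]|xpq] := boolP (p < x < q).
  by rewrite -[X in _ --> X]mulr1; apply: cvgM; apply: flat0_cvg;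
    rewrite subr_gt0.
rewrite (_ : (fun _ => _) = (fun=> 0)); first exact: cvg_cst.
by apply/funext => n; rewrite bump_out.
Qed.

Lemma continuous_bump p q n : continuous (bump p q n).
Proof. exact: (@Ck_bump p q n 0). Qed.

Lemma measurable_bump p q n : measurable_fun setT (bump p q n : mR R -> mR R).
Proof. by apply: continuous_measurable_fun; exact: continuous_bump. Qed.

End smooth.

(** * Integrable functions *)

Section integrability.
Context d (T : measurableType d) (R : realType) (mu : {measure set T -> \bar R}).
Implicit Types (D : set T) (f g h : T -> R).

Lemma L1_le D f g : measurable D -> measurable_fun D f ->
  (forall x, D x -> `|f x| <= g x) ->
  mu.-integrable D (EFin \o g) -> mu.-integrable D (EFin \o f).
Proof.
move=> mD mf fg ig; apply: le_integrable ig => //; first exact/measurable_EFinP.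
move=> x Dx /=; rewrite lee_fin; apply: le_trans (fg _ Dx) _.
by rewrite ler_norm.
Qed.

Lemma L1_meas D f : mu.-integrable D (EFin \o f) -> measurable_fun D f.
Proof. by move=> /measurable_int /measurable_EFinP. Qed.

Lemma L1D D f g : measurable D -> mu.-integrable D (EFin \o f) ->
  mu.-integrable D (EFin \o g) -> mu.-integrable D (EFin \o (fun x => f x + g x)).
Proof. by move=> mD if_ ig; exact: (integrableD mD if_ ig). Qed.

Lemma L1B D f g : measurable D -> mu.-integrable D (EFin \o f) ->
  mu.-integrable D (EFin \o g) -> mu.-integrable D (EFin \o (fun x => f x - g x)).
Proof. by move=> mD if_ ig; exact: (integrableB mD if_ ig). Qed.

Lemma L1Z D f c : measurable D -> mu.-integrable D (EFin \o f) ->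
  mu.-integrable D (EFin \o (fun x => c * f x)).
Proof. by move=> mD if_; exact: (integrableZl mD c if_). Qed.

Lemma L1_norm D f : measurable D -> mu.-integrable D (EFin \o f) ->
  mu.-integrable D (EFin \o (fun x => `|f x|)).
Proof. by move=> mD if_; exact: (integrable_norm if_). Qed.

Lemma L1M_bdd D f h M : measurable D -> measurable_fun D h ->
  (forall x, D x -> `|h x| <= M) -> mu.-integrable D (EFin \o f) ->
  mu.-integrable D (EFin \o (fun x => h x * f x)).
Proof.
move=> mD mh hM if_; apply: (@L1_le _ _ (fun x => M * `|f x|)) => //.
- by apply: measurable_funM => //; exact: L1_meas.
- by move=> x Dx; rewrite normrM ler_wpM2r// hM.
- by apply: L1Z => //; exact: L1_norm.
Qed.

Lemma Rintegral_dct D (fn : nat -> T -> R) f g : measurable D ->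
  (forall n, measurable_fun D (fn n)) -> measurable_fun D f ->
  (forall x, D x -> fn n x @[n --> \oo] --> f x) ->
  mu.-integrable D (EFin \o g) ->
  (forall n x, D x -> `|fn n x| <= g x) ->
  \int[mu]_(x in D) fn n x @[n --> \oo] --> \int[mu]_(x in D) f x.
Proof.
move=> mD mfn mf fnf ig fng.
have mfn' n : measurable_fun D (EFin \o fn n) by exact/measurable_EFinP.
have mf' : measurable_fun D (EFin \o f) by exact/measurable_EFinP.
have c x : D x -> (EFin \o fn n) x @[n --> \oo] --> (EFin \o f) x.
  move=> Dx; apply/fine_cvgP; split; first exact: nearW.
  exact: fnf.
have [h1 _ h] := @dominated_convergence _ _ _ mu D mD
  (fun n => EFin \o fn n) (EFin \o f) (EFin \o g) mfn' mf'
  (aeW _ c)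
  ig (aeW _ (fun x n Dx => fng n x Dx)).
apply: (@fine_cvg _ _ _ _ (fun n => \int[mu]_(x in D) (fn n x)%:E)%E).
by rewrite fineK// integrable_fin_num.
Qed.

Lemma ae_eq_Rintegral D f g : measurable D ->
  measurable_fun D f -> measurable_fun D g ->
  {ae mu, forall x, D x -> f x = g x} ->
  \int[mu]_(x in D) f x = \int[mu]_(x in D) g x.
Proof.
move=> mD mf mg h; congr fine; apply: ae_eq_integral => //.
- exact/measurable_EFinP.
- exact/measurable_EFinP.
- by apply: filterS h => x h Dx; rewrite h.
Qed.

Lemma Rintegral_supp D f : (forall x, ~ D x -> f x = 0) ->
  \int[mu]_x f x = \int[mu]_(x in D) f x.
Proof.
move=> fD; rewrite [RHS]Rintegral_mkcond; apply: eq_Rintegral => x _.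
rewrite patchE; case: ifPn => // /negP Dx; apply: fD => h; apply: Dx.
exact: mem_set.
Qed.

End integrability.

(** * Absolutely continuous functions *)

Section absolute_continuity.
Context {R : realType}.
Implicit Types (a b c d s t x y : R) (f g h F G : R -> R).

Definition prim a g s : R := \int[leb1]_(r in `[a, s]) g r.

Lemma prim_cont a b g : a <= b -> leb1.-integrable `[a, b] (EFin \o g) ->
  {within `[a, b], continuous (prim a g)}.
Proof. by move=> ab ig; exact: (parameterized_integral_continuous ab ig). Qed.

Lemma prim_diff a b g s t : leb1.-integrable `[a, b] (EFin \o g) ->
  a <= s -> s <= t -> t <= b ->
  prim a g t - prim a g s = \int[leb1]_(r in `]s, t]) g r.
Proof.
move=> ig as_ st tb.
apply: (@Rintegral_itvB R g (BLeft a) (BRight t) s); rewrite ?bnd_simp//.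
by apply: integrableS ig => //; apply: subset_itvl; rewrite bnd_simp.
Qed.

Lemma int_sub a b s g : leb1.-integrable `[a, b] (EFin \o g) ->
  a <= s <= b -> leb1.-integrable `[a, s] (EFin \o g).
Proof.
move=> ig /andP[_ sb]; apply: integrableS ig => //.
by apply: subset_itvl; rewrite bnd_simp.
Qed.

(** Absolute continuity is taken in its integral form, with the derivative [g]
    as a parameter: products, truncations and integration by parts then reduce
    to identities between integrals. *)
Definition abscont a b F g := leb1.-integrable `[a, b] (EFin \o g) /\
  forall s, a <= s <= b -> F s = F a + prim a g s.

Lemma AC_diff a b F g s t : abscont a b F g -> a <= s -> s <= t -> t <= b ->
  F t - F s = \int[leb1]_(r in `]s, t]) g r.
Proof.
move=> [ig Fg] as_ st tb.
rewrite -(prim_diff ig as_ st tb) (Fg s) ?(Fg t); first by ring.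
- by rewrite (le_trans as_ st).
- by rewrite as_ (le_trans st tb).
Qed.

Lemma AC_intS a b F g s t : abscont a b F g -> a <= s -> t <= b ->
  leb1.-integrable `]s, t] (EFin \o g).
Proof.
move=> [ig _] as_ tb; apply: integrableS ig => //.
by move=> x /=; rewrite !in_itv/= => /andP[sx xt];
  rewrite (le_trans as_ (ltW sx)) (le_trans xt tb).
Qed.

Lemma AC_cont a b F g : a <= b -> abscont a b F g ->
  {within `[a, b], continuous F}.
Proof.
move=> ab [ig Fg].
apply: (@subspace_eq_continuous _ _ _ (fun s => F a + prim a g s)).
  by move=> s; rewrite inE/= in_itv/= => /Fg.
move=> x; apply: cvgD; first exact: cvg_cst.
have h := prim_cont ab ig. exact: h.
Qed.

Lemma AC_meas a b F g : a <= b -> abscont a b F g -> measurable_fun `[a, b] F.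
Proof.
by move=> ab /(AC_cont ab) cF; exact: subspace_continuous_measurable_fun.
Qed.

Lemma AC_bounded a b F g : a <= b -> abscont a b F g ->
  exists2 M, 0 <= M & forall s, a <= s <= b -> `|F s| <= M.
Proof.
move=> ab [ig Fg]; pose M := \int[leb1]_(r in `[a, b]) `|g r|.
exists (`|F a| + M).
  by rewrite addr_ge0// Rintegral_ge0.
move=> s sab; rewrite Fg//; apply: le_trans (ler_normD _ _) _.
have igs : leb1.-integrable `[a, s] (EFin \o g).
  apply: integrableS ig => //; apply: subset_itvl; rewrite bnd_simp.
  by case/andP: sab.
rewrite lerD2l; apply: le_trans (le_normr_Rintegral _ igs) _ => //.
have [as_ sb] := andP sab.
apply: fine_le; rewrite ?integrable_fin_num//; try exact: integrable_norm.
apply: ge0_subset_integral => //.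
  by apply/measurable_EFinP; apply: measurableT_comp => //; exact: (L1_meas ig).
by apply: subset_itvl; rewrite bnd_simp.
Qed.

Lemma AC_add a b F G f g : abscont a b F f -> abscont a b G g ->
  abscont a b (fun x => F x + G x) (fun x => f x + g x).
Proof.
move=> [if_ Ff] [ig Gg]; split; first exact: L1D.
move=> s sab; rewrite Ff// Gg// /prim RintegralD//; first by ring.
  exact: int_sub if_ sab.
exact: int_sub ig sab.
Qed.

Lemma AC_scale a b k F f : abscont a b F f ->
  abscont a b (fun x => k * F x) (fun x => k * f x).
Proof.
move=> [if_ Ff]; split; first exact: L1Z.
move=> s sab; rewrite Ff// /prim RintegralZl ?mulrDr//.
exact: int_sub if_ sab.
Qed.

Lemma AC_addc a b k F f : abscont a b F f -> abscont a b (fun x => F x + k) f.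
Proof. by move=> [if_ Ff]; split => // s sab; rewrite Ff//; ring. Qed.

(** Continuous induction: the supremum of the points up to which the estimate
    holds belongs to the set and cannot be interior. *)
Lemma local_to_global a b (H A : R -> R) : a <= b ->
  (forall x, a <= x <= b -> exists2 e, 0 < e & forall s t,
     a <= s -> s <= t -> t <= b -> `|s - x| < e -> `|t - x| < e ->
     `|H t - H s| <= A t - A s) ->
  `|H b - H a| <= A b - A a.
Proof.
move=> ab loc.
pose S := [set s | a <= s <= b /\ `|H s - H a| <= A s - A a].
have Sa : S a by split; [rewrite lexx ab|rewrite !subrr normr0].
have hS : has_sup S.
  by split; [exists a|exists b => s [/andP[]]].
pose m := sup S.
have am : a <= m by apply: ub_le_sup Sa; exact: hS.2.
have mb : m <= b by apply: ge_sup; [exists a|move=> s [/andP[]]].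
have [e e0 he] := loc m (introT andP (conj am mb)).
have [s Ss ms] := sup_adherent e0 hS.
have sm : s <= m by apply: ub_le_sup Ss; exact: hS.2.
have [/andP[as_ sb] Hs] := Ss.
pose t := Num.min b (m + e / 2).
have mt : m <= t by rewrite le_min mb lerDl divr_ge0// ltW.
have tb : t <= b by rewrite ge_min lexx.
have St : S t.
  split; first by rewrite (le_trans am mt) tb.
  have h := he s t as_ (le_trans sm mt) tb.
  rewrite (_ : H t - H a = (H t - H s) + (H s - H a)); last by ring.
  rewrite (_ : A t - A a = (A t - A s) + (A s - A a)); last by ring.
  apply: le_trans (ler_normD _ _) _; apply: lerD => //; apply: h.
    by rewrite distrC ger0_norm ?subr_ge0//; move: ms; rewrite -/m; lra.
  rewrite ger0_norm ?subr_ge0//.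
  have : t <= m + e / 2 by rewrite ge_min lexx orbT.
  lra.
have tm : t <= m by apply: ub_le_sup St; exact: hS.2.
suff <- : t = b by have [] := St.
apply/eqP; rewrite eq_le tb /t le_min lexx/= leNgt; apply/negP => h.
move: tm; rewrite /t leNgt => /negP; apply.
by rewrite lt_min (lt_le_trans _ (ltW h)) ?andbT ?ltrDl ?divr_gt0//.
Qed.

Definition pos (r : R) : R := Num.max r 0.

Lemma pos_ge0 r : 0 <= pos r. Proof. by rewrite le_max lexx orbT. Qed.

Lemma pos_lip r s : `|pos r - pos s| <= `|r - s|.
Proof.
rewrite /pos /Num.max; case: ltP => r0; case: ltP => s0.
- by rewrite subrr normr0.
- by rewrite sub0r normrN distrC !ger0_norm//; lra.
- by rewrite subr0 !ger0_norm//; lra.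
- by [].
Qed.

(** [pos ^ 2] is [C^1] with a 2-Lipschitz derivative: it is through this Taylor
    estimate that the chain rule for truncations is obtained. *)
Lemma pos_taylor r s :
  `|pos s ^+ 2 - pos r ^+ 2 - 2 * pos r * (s - r)| <= (s - r) ^+ 2.
Proof.
have h : 0 <= (s - r) ^+ 2 by exact: sqr_ge0.
rewrite /pos /Num.max ler_norml; case: ltP => r0; case: ltP => s0; apply/andP.
- by split; lra.
- have s0' : 0 <= - s by rewrite oppr_ge0 ltW.
  have := mulr_ge0 s0' s0.
  by have := sqr_ge0 r; have := sqr_ge0 s; split; lra.
- have r0' : 0 <= - r by rewrite oppr_ge0 ltW.
  have := mulr_ge0 r0' r0.
  by have := sqr_ge0 r; have := sqr_ge0 s; split; lra.
- by split; lra.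
Qed.

Lemma pos_sub_le c r : 0 <= c -> pos (r - c) <= `|r|.
Proof.
move=> c0; rewrite /pos ge_max normr_ge0 andbT.
by apply: le_trans (ler_norm r); rewrite lerBlDr lerDl.
Qed.

Lemma sqr_pos_sub_le c r : 0 <= c -> pos (r - c) ^+ 2 <= r ^+ 2.
Proof.
move=> c0; rewrite -[leRHS](real_normK (num_real r)) ler_sqr ?nnegrE ?pos_ge0//.
exact: pos_sub_le.
Qed.

Lemma measurable_pos : measurable_fun setT (pos : mR R -> mR R).
Proof. exact: measurable_maxr. Qed.

Lemma prim_aa a g : prim a g a = 0 :> R.
Proof. by rewrite /prim set_itv1 Rintegral_set1. Qed.

Lemma AC_cts a b F g x e : a <= b -> abscont a b F g -> a <= x <= b -> 0 < e ->
  exists2 r, 0 < r & forall s, a <= s <= b -> `|s - x| < r -> `|F s - F x| <= e.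
Proof.
move=> ab Fg xab e0.
have /subspace_continuousP/(_ x) := AC_cont ab Fg.
rewrite /= in_itv/= xab => /(_ isT) /cvgrPdist_le /(_ e e0).
rewrite near_withinE => /nbhs_ballP[r /= r0 h]; exists r => // s sab sx.
rewrite distrC; apply: h; first by rewrite /ball/= distrC.
by rewrite in_itv.
Qed.

(** By [pos_taylor] the increment of [pos (F) ^ 2] differs from its linear part
    by at most [|F t - F s| ^ 2], which near a point is at most [e] times the
    integral of [|g|]; [local_to_global] sums these errors. *)
Lemma AC_sqpos a b F g : a <= b -> abscont a b F g ->
  abscont a b (fun x => pos (F x) ^+ 2) (fun x => 2 * pos (F x) * g x).
Proof.
move=> ab Fg; have [ig _] := Fg; have [M M0 FM] := AC_bounded ab Fg.
pose k := fun x => 2 * pos (F x) * g x.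
have mpF : measurable_fun `[a, b] (fun x => 2 * pos (F x) : mR R).
  apply: measurable_funM => //.
  apply: (@measurableT_comp _ _ _ _ _ _ (pos : mR R -> mR R)).
    exact: measurable_pos.
  exact: (AC_meas ab Fg).
have ik : leb1.-integrable `[a, b] (EFin \o k).
  apply: (@L1M_bdd _ (mR R) R leb1 _ g (fun x => 2 * pos (F x)) (2 * M)) => //.
  move=> x; rewrite /= in_itv/= => /FM h.
  rewrite normrM (ger0_norm (_ : 0 <= 2))// ler_wpM2l// ger0_norm ?pos_ge0//.
  by rewrite /pos ge_max (le_trans (ler_norm _) h) M0.
have iag : leb1.-integrable `[a, b] (EFin \o (fun x => `|g x|)).
  exact: L1_norm.
split => // s sab; have [as_ sb] := andP sab.
(* The defect of the claimed identity; its increments are at most [e * B]. *)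
pose H x := pos (F x) ^+ 2 - prim a k x.
suff : H s = H a by rewrite /H prim_aa subr0 => <-; ring.
apply/eqP; rewrite -subr_eq0 -normr_le0.
pose B := prim a (fun x => `|g x|) s.
have B0 : 0 <= B by rewrite /B /prim Rintegral_ge0.
suff HB e : 0 < e -> `|H s - H a| <= e * B.
  apply/ler_addgt0Pr => e e0; rewrite add0r.
  have B1 : 0 < B + 1 by rewrite ltr_wpDl.
  apply: le_trans (HB (e / (B + 1)) _) _; first by rewrite divr_gt0.
  by rewrite mulrAC ler_pdivrMr// ler_wpM2l ?lerDl// ltW.
move=> e0; pose A x := e * prim a (fun x => `|g x|) x.
suff : `|H s - H a| <= A s - A a by rewrite /A prim_aa mulr0 subr0.
apply: local_to_global => // x /andP[ax xs].
have e6 : 0 < e / 6 by rewrite divr_gt0.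
have xab : a <= x <= b by rewrite ax (le_trans xs).
have [r r0 hr] := AC_cts ab Fg xab e6.
exists r => // s' t as' st ts s'x tx.
have tb : t <= b by exact: le_trans ts sb.
have ig' : leb1.-integrable `]s', t] (EFin \o g) by exact: AC_intS Fg as' tb.
have iag' : leb1.-integrable `]s', t] (EFin \o (fun x => `|g x|)).
  exact: L1_norm.
have sub : `]s', t] `<=` `[a, b].
  move=> y /=; rewrite !in_itv/= => /andP[sy yt].
  by rewrite (le_trans as' (ltW sy)) (le_trans yt tb).
have ik' : leb1.-integrable `]s', t] (EFin \o k).
  by apply: integrableS ik.
have near_x y : s' <= y -> y <= t -> `|F y - F x| <= e / 6.
  move=> sy yt; apply: hr; first by rewrite (le_trans as')// (le_trans yt).
  move: s'x tx; rewrite !ltr_distl => /andP[? ?] /andP[? ?].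
  by apply/andP; split; lra.
have diff : F t - F s' = \int[leb1]_(y in `]s', t]) g y by exact: AC_diff Fg _ _ _.
pose I := \int[leb1]_(y in `]s', t]) `|g y|.
have I0 : 0 <= I by rewrite Rintegral_ge0.
have dFI : `|F t - F s'| <= I.
  by rewrite diff; exact: le_normr_Rintegral.
have dFe : `|F t - F s'| <= e / 3.
  have h1 := near_x t st (lexx _); have h2 := near_x s' (lexx _) st.
  rewrite (_ : F t - F s' = (F t - F x) - (F s' - F x)); last by ring.
  apply: le_trans (ler_normB _ _) _; lra.
have -> : A t - A s' = e * I.
  by rewrite /A -mulrBr (prim_diff iag as' st tb).
have -> : H t - H s' =
    (pos (F t) ^+ 2 - pos (F s') ^+ 2 - 2 * pos (F s') * (F t - F s')) +
    \int[leb1]_(y in `]s', t]) (2 * (pos (F s') - pos (F y)) * g y).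
  rewrite /H diff -RintegralZl//.
  have -> : \int[leb1]_(y in `]s', t]) (2 * (pos (F s') - pos (F y)) * g y) =
     \int[leb1]_(y in `]s', t]) (2 * pos (F s') * g y) - \int[leb1]_(y in `]s', t]) k y.
    rewrite -RintegralB//; last exact: L1Z.
    by apply: eq_Rintegral => y _; rewrite /k; ring.
  by rewrite -(prim_diff ik as' st tb); ring.
apply: le_trans (ler_normD _ _) _.
have h1 : `|pos (F t) ^+ 2 - pos (F s') ^+ 2 - 2 * pos (F s') * (F t - F s')|
    <= e / 3 * I.
  apply: le_trans (pos_taylor _ _) _; rewrite -real_normK ?num_real// expr2.
  by rewrite ler_pM.
suff h2 : `|\int[leb1]_(y in `]s', t]) (2 * (pos (F s') - pos (F y)) * g y)|
    <= 2 / 3 * e * I.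
  by apply: le_trans (lerD h1 h2) _; lra.
have ii : leb1.-integrable `]s', t]
    (EFin \o (fun y => 2 * (pos (F s') - pos (F y)) * g y)).
  rewrite (_ : (fun y => _) = (fun y => 2 * pos (F s') * g y - k y)).
    by apply: L1B => //; exact: L1Z.
  by apply/funext => y; rewrite /k; ring.
apply: le_trans (le_normr_Rintegral _ ii) _ => //.
rewrite /I -RintegralZl//; apply: le_Rintegral => //.
- exact: L1_norm.
- exact: L1Z.
move=> y; rewrite /= in_itv/= => /andP[sy yt].
rewrite normrM ler_wpM2r// normrM (ger0_norm (_ : 0 <= 2))//.
have := pos_lip (F s') (F y).
have h3 := near_x y (ltW sy) yt; have h4 := near_x s' (lexx _) st.
have : `|F s' - F y| <= e / 3.
  rewrite (_ : F s' - F y = (F s' - F x) - (F y - F x)); last by ring.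
  apply: le_trans (ler_normB _ _) _; lra.
lra.
Qed.

Lemma AC_ext a b F G f g : a <= b -> abscont a b F f ->
  (forall x, a <= x <= b -> F x = G x) -> (forall x, a <= x <= b -> f x = g x) ->
  abscont a b G g.
Proof.
move=> ab [if_ Ff] FG fg; split.
  apply: eq_integrable if_ => // x; rewrite inE/= in_itv/= => xab.
  by rewrite /= fg.
move=> s sab; rewrite -!FG ?lexx// Ff//; congr (_ + _).
apply: eq_Rintegral => x; rewrite inE/= in_itv/= => /andP[ax xs].
by rewrite fg// ax (le_trans xs)//; case/andP: sab.
Qed.

(** [r ^ 2 = pos (r) ^ 2 + pos (- r) ^ 2]. *)
Lemma AC_sqr a b F f : a <= b -> abscont a b F f ->
  abscont a b (fun x => F x ^+ 2) (fun x => 2 * F x * f x).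
Proof.
move=> ab Ff.
have Nf := AC_scale (-1) Ff.
apply: (AC_ext ab (AC_add (AC_sqpos ab Ff) (AC_sqpos ab Nf))) => x _;
  rewrite /pos /Num.max mulN1r; case: ltP => h1; case: ltP => h2; try ring.
- lra.
- have -> : F x = 0 by lra.
  ring.
- lra.
- have -> : F x = 0 by lra.
  ring.
Qed.

(** Polarization of [AC_sqr]. *)
Lemma AC_mul a b F G f g : a <= b -> abscont a b F f -> abscont a b G g ->
  abscont a b (fun x => F x * G x) (fun x => f x * G x + F x * g x).
Proof.
move=> ab Ff Gg.
have h1 := AC_sqr ab (AC_add Ff Gg).
have h2 := AC_scale (-1) (AC_add (AC_sqr ab Ff) (AC_sqr ab Gg)).
apply: (AC_ext ab (AC_scale (2^-1) (AC_add h1 h2))) => x _; by field.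
Qed.

(** The positive part is the limit of the functions
    [(pos (r) ^ 2 - pos (r - e) ^ 2) / (2 e)], to which [AC_sqpos] applies, and
    their derivatives are bounded by 1 and converge everywhere, with limit 0
    at 0. *)
Lemma AC_pos a b F f : a <= b -> abscont a b F f ->
  abscont a b (fun x => pos (F x)) (fun x => if 0 < F x then f x else 0).
Proof.
move=> ab Ff; have [if_ _] := Ff; have mF := AC_meas ab Ff.
pose e n : R := n.+1%:R^-1.
have e0 n : 0 < e n by rewrite invr_gt0.
(* [p n] has derivative [dp n], a piecewise affine function with values in
   [0, 1] that converges to the indicator function of ]0, +oo[. *)
pose dp n (r : R) := (pos r - pos (r - e n)) * n.+1%:R.
pose p n (r : R) := (pos r ^+ 2 - pos (r - e n) ^+ 2) * (n.+1%:R / 2).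
have pAC n : abscont a b (fun x => p n (F x)) (fun x => dp n (F x) * f x).
  have h := AC_add (AC_sqpos ab Ff)
    (AC_scale (-1) (AC_sqpos ab (AC_addc (- e n) Ff))).
  apply: (AC_ext ab (AC_scale (n.+1%:R / 2) h)) => x _; rewrite /p /dp; by field.
have en n : e n * n.+1%:R = 1 by rewrite mulVf// pnatr_eq0.
have dp01 n r : 0 <= dp n r <= 1.
  have n0 : (0 : R) < n.+1%:R by [].
  have e0n := e0 n; have enn := en n.
  have : 0 <= pos r - pos (r - e n) <= e n.
    rewrite /pos /Num.max; case: ltP => ?; case: ltP => ?; apply/andP;
      split; lra.
  move=> /andP[d0 d1]; rewrite /dp mulr_ge0//= -[leRHS]enn.
  by rewrite ler_wpM2r.
have e_small (r : R) : 0 < r -> \forall n \near \oo, e n < r.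
  move=> r0; have := @cvg_harmonic R => /cvgrPdist_lt/(_ r r0).
  by apply: filterS => n; rewrite sub0r normrN ger0_norm ?ltW.
have dp_cvg r : dp n r @[n --> \oo] --> (if 0 < r then 1 else 0 : R).
  case: ifPn => [r0|].
    apply: (@cvg_near_cst _ _ _ (fun n => dp n r)).
    near=> n; have : e n < r by near: n; exact: e_small.
    move=> er; rewrite /dp /pos !max_l ?subr_ge0 ?ltW//.
    by rewrite opprB addrC subrK en.
  rewrite -leNgt => r0; rewrite (_ : (fun n => dp n r) = fun=> 0).
    exact: cvg_cst.
  apply/funext => n; rewrite /dp /pos !max_r ?subrr ?mul0r//.
  by have := e0 n; lra.
have p_cvg r : p n r @[n --> \oo] --> pos r.
  have [r0|r0] := ltP 0 r; last first.
    rewrite (_ : (fun n => p n r) = fun=> 0).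
      by rewrite /pos max_r//; exact: cvg_cst.
    apply/funext => n; rewrite /p /pos !max_r ?subrr ?mul0r//.
    by have := e0 n; lra.
  apply: (@cvg_trans _ ((fun n => r - e n / 2) @ \oo)).
    apply: near_eq_cvg; near=> n.
    have er : e n < r by near: n; exact: e_small.
    rewrite /p /pos !max_l ?subr_ge0 ?ltW//.
    have -> : r ^+ 2 - (r - e n) ^+ 2 = e n * (2 * r - e n) by ring.
    by rewrite mulrACA mulrA -mulrA [X in _ = X](_ : _ = (e n * n.+1%:R) * ((2 * r - e n) / 2));
      [by rewrite en; field|by rewrite en; field].
  have c : r - e n / 2 @[n --> \oo] --> r - 0 / 2.
    by apply: cvgB; [exact: cvg_cst|apply: cvgMl; exact: cvg_harmonic].
  by move: c; rewrite mul0r subr0 /pos max_l ?ltW.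
have mdp n : measurable_fun setT (dp n : mR R -> mR R).
  apply: measurable_funM => //; apply: measurable_funB; first exact: measurable_pos.
  apply: (@measurableT_comp _ _ _ _ _ _ (pos : mR R -> mR R)).
    exact: measurable_pos.
  exact: measurable_funB.
have mlim : measurable_fun `[a, b] (fun x => if 0 < F x then f x else 0 : mR R).
  apply: measurable_fun_if => //.
  - by apply: measurable_fun_ltr.
  - apply: measurable_funS (L1_meas if_) => //.
have ilim : leb1.-integrable `[a, b]
    (EFin \o (fun x => if 0 < F x then f x else 0)).
  apply: (@L1_le _ (mR R) R leb1 _ _ (fun x => `|f x|)) => //; last exact: L1_norm.
  by move=> x _; case: ifPn => // _; rewrite normr0.
split => // s sab; have [as_ sb] := andP sab.
have sub : `[a, s] `<=` `[a, b] by apply: subset_itvl; rewrite bnd_simp.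
have c1 : p n (F s) - p n (F a) @[n --> \oo] --> pos (F s) - pos (F a).
  by apply: cvgB; exact: p_cvg.
have c2 : prim a (fun x => dp n (F x) * f x) s @[n --> \oo] -->
    prim a (fun x => if 0 < F x then f x else 0) s.
  apply: (@Rintegral_dct _ (mR R) R leb1 _ _ _ (fun x => `|f x|)) => //.
  - move=> n; apply: measurable_funM; last exact: measurable_funS (L1_meas if_).
    apply: (measurableT_comp (mdp n)); exact: measurable_funS mF.
  - exact: measurable_funS mlim.
  - move=> x _; rewrite (_ : (if 0 < F x then f x else 0) =
      (if 0 < F x then 1 else 0) * f x); last first.
      by case: ifP; rewrite ?mul1r ?mul0r.
    by apply: cvgMl; exact: dp_cvg.
  - by apply: L1_norm => //; exact: integrableS if_.
  - move=> n x _; rewrite normrM; have /andP[d0 d1] := dp01 n (F x).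
    by rewrite ger0_norm// ler_piMl.
have e12 : (fun n => p n (F s) - p n (F a)) =
    (fun n => prim a (fun x => dp n (F x) * f x) s).
  by apply/funext => n; have [_ /(_ s sab) ->] := pAC n; ring.
rewrite e12 in c1; have <- := cvg_unique _ c1 c2; last exact: Rhausdorff.
by ring.
Unshelve. all: by end_near. Qed.

(** The fundamental theorem of calculus, for test functions and for the damping
    factor. *)
Lemma AC_C1 a b F f : a < b -> (forall x, is_derive x (1 : R) F (f x)) ->
  continuous f -> abscont a b F f.
Proof.
move=> ab dF cf.
have cF : continuous F.
  move=> x; apply: differentiable_continuous; apply/derivable1_diffP.
  by have [] := dF x.
have cfi s : {within `[a, s], continuous f}.
  exact: continuous_subspaceT.
have ifs s : leb1.-integrable `[a, s] (EFin \o f).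
  by apply: continuous_compact_integrable => //; exact: segment_compact.
split => // s /andP[].
rewrite le_eqVlt => /predU1P[<- _|as_ sb]; first by rewrite prim_aa addr0.
have := @continuous_FTC2 R f F a s as_ (cfi s).
have h : derivable_oo_LRcontinuous F a s.
  split.
  - by move=> x _; have [] := dF x.
  - by apply: cvg_at_right_filter; exact: cF.
  - by apply: cvg_at_left_filter; exact: cF.
have h' : {in `]a, s[, derive1 F =1 f}.
  by move=> x _; rewrite derive1E; have [_ ->] := dF x.
move=> /(_ h h') e; rewrite /prim /Rintegral.
by rewrite [X in fine X]e /=; ring.
Qed.

(** Applied to products with compactly supported functions, this is integration
    by parts. *)
Lemma AC_int0 a b F f : a <= b -> abscont a b F f -> F a = 0 -> F b = 0 ->
  \int[leb1]_(x in `[a, b]) f x = 0.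
Proof.
move=> ab [_ /(_ b)]; rewrite ab lexx => /(_ isT) h Fa Fb.
by move: h; rewrite Fa Fb add0r => /esym.
Qed.

End absolute_continuity.

(** * Product measures *)

Section product_measures.
Context d1 d2 (T1 : measurableType d1) (T2 : measurableType d2) (R : realType).
Variable m1 : {sigma_finite_measure set T1 -> \bar R}.
Variable m2 : {sigma_finite_measure set T2 -> \bar R}.
Local Notation m12 := (m1 \x m2)%E.
Implicit Types (f : T1 * T2 -> R).

(** Tonelli's theorem for the indicator function of [N]. *)
Lemma prod_null1 (N : set (T1 * T2)) : measurable N ->
  m12 N = 0%E <-> {ae m1, forall x, m2 (xsection N x) = 0%E}.
Proof.
move=> mN.
have mF : measurable_fun setT (m2 \o xsection N) by exact: measurable_fun_xsection.
have -> : m12 N = (\int[m1]_x `|(m2 \o xsection N) x|)%E.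
  by apply: eq_integral => x _; rewrite gee0_abs.
rewrite (ae_eq_integral_abs m1 measurableT mF).
by split; apply: filterS => x //= h; exact: h.
Qed.

Lemma prod_null2 (N : set (T1 * T2)) : measurable N ->
  m12 N = 0%E <-> {ae m2, forall y, m1 (ysection N y) = 0%E}.
Proof.
move=> mN.
have mF : measurable_fun setT (m1 \o ysection N) by exact: measurable_fun_ysection.
have -> : m12 N = (\int[m2]_x `|(m1 \o ysection N) x|)%E.
  transitivity (\int[m12]_z (\1_N z)%:E)%E.
    by rewrite integral_indic// setIT.
  rewrite fubini_tonelli2//.
  - rewrite indic_fubini_tonelli_GE//.
    by apply: eq_integral => x _; rewrite gee0_abs.
  - exact/measurable_EFinP/measurable_indic.
rewrite (ae_eq_integral_abs m2 measurableT mF).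
by split; apply: filterS => x //= h; exact: h.
Qed.

Lemma ae_prod1 (P : T1 * T2 -> Prop) : {ae m12, forall z, P z} ->
  {ae m1, forall x, {ae m2, forall y, P (x, y)}}.
Proof.
move=> [N [mN N0 PN]]; have /(prod_null1 mN) := N0.
apply: filterS => x Nx; exists (xsection N x); split => //.
  exact: measurable_xsection.
by move=> y /= nP; rewrite /xsection/= inE; exact: PN.
Qed.

Lemma ae_prod2 (P : T1 * T2 -> Prop) : {ae m12, forall z, P z} ->
  {ae m2, forall y, {ae m1, forall x, P (x, y)}}.
Proof.
move=> [N [mN N0 PN]]; have /(prod_null2 mN) := N0.
apply: filterS => y Ny; exists (ysection N y); split => //.
  exact: measurable_ysection.
by move=> x /= nP; rewrite /ysection/= inE; exact: PN.
Qed.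

(** The converse of [ae_prod1] requires the exceptional set to be measurable. *)
Lemma prod_ae1 (P : T1 * T2 -> Prop) : measurable [set z | ~ P z] ->
  {ae m1, forall x, {ae m2, forall y, P (x, y)}} -> {ae m12, forall z, P z}.
Proof.
move=> mP h; exists [set z | ~ P z]; split => //.
apply/(prod_null1 mP); apply: filterS h => x [N [mN N0 PN]].
apply/eqP; rewrite -measure_le0 -N0; apply: le_measure; rewrite ?inE//.
  exact: measurable_xsection.
by move=> y; rewrite /xsection/= inE => ?; exact: PN.
Qed.

Lemma prod_ae2 (P : T1 * T2 -> Prop) : measurable [set z | ~ P z] ->
  {ae m2, forall y, {ae m1, forall x, P (x, y)}} -> {ae m12, forall z, P z}.
Proof.
move=> mP h; exists [set z | ~ P z]; split => //.
apply/(prod_null2 mP); apply: filterS h => y [N [mN N0 PN]].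
apply/eqP; rewrite -measure_le0 -N0; apply: le_measure; rewrite ?inE//.
  exact: measurable_ysection.
by move=> x; rewrite /ysection/= inE => ?; exact: PN.
Qed.

Lemma measurable_Rint1 f : measurable_fun setT f ->
  measurable_fun setT (fun x => \int[m2]_y f (x, y)).
Proof.
move=> mf; have mf' : measurable_fun setT (EFin \o f) by exact/measurable_EFinP.
have h : measurable_fun setT (fubini_F m2 (EFin \o f)).
  rewrite (_ : fubini_F _ _ =
      (fubini_F m2 (EFin \o f)^\+ \- fubini_F m2 (EFin \o f)^\-)%E).
    apply: emeasurable_funB; apply: measurable_fun_fubini_tonelli_F => //.
    - exact: measurable_funepos.
    - exact: measurable_funeneg.
  by apply/funext => x; rewrite /fubini_F [LHS]integralE; congr (_ - _)%E; apply: eq_integral => y _; rewrite !(funeposE, funenegE).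
exact: (measurableT_comp (@fine_measurable R setT measurableT) h).
Qed.

Lemma measurable_Rint2 f : measurable_fun setT f ->
  measurable_fun setT (fun y => \int[m1]_x f (x, y)).
Proof.
move=> mf; have mf' : measurable_fun setT (EFin \o f) by exact/measurable_EFinP.
have h : measurable_fun setT (fubini_G m1 (EFin \o f)).
  rewrite (_ : fubini_G _ _ =
      (fubini_G m1 (EFin \o f)^\+ \- fubini_G m1 (EFin \o f)^\-)%E).
    apply: emeasurable_funB; apply: measurable_fun_fubini_tonelli_G => //.
    - exact: measurable_funepos.
    - exact: measurable_funeneg.
  by apply/funext => x; rewrite /fubini_G [LHS]integralE; congr (_ - _)%E; apply: eq_integral => y _; rewrite !(funeposE, funenegE).
exact: (measurableT_comp (@fine_measurable R setT measurableT) h).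
Qed.

Lemma L1_Rint1 f : m12.-integrable setT (EFin \o f) ->
  m1.-integrable setT (EFin \o (fun x => \int[m2]_y f (x, y))).
Proof.
move=> if_; have iF := integrable_fubini_F if_.
apply: le_integrable iF => //.
  by apply/measurable_EFinP/measurable_Rint1; exact: (L1_meas if_).
move=> x _ /=; rewrite /Rintegral /fubini_F /=.
by case: (\int[m2]_y (f (x, y))%:E)%E => //= ; rewrite normr0 leey.
Qed.

Lemma integrable_fubini_G f : m12.-integrable setT (EFin \o f) ->
  m2.-integrable setT (fubini_G m1 (EFin \o f)).
Proof.
move=> if_; have mf : measurable_fun setT (EFin \o f) := measurable_int _ if_.
apply/integrableP; split; first exact: (measurable_fubini_G if_).
have := (integrable21ltyP m1 m2 mf).1 if_; apply: le_lt_trans.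
apply: ge0_le_integral => //.
- by apply: measurableT_comp => //; exact: (measurable_fubini_G if_).
- apply: (measurable_fun_fubini_tonelli_G (abse \o (EFin \o f))) => //=.
  exact: measurableT_comp.
- move=> y _; apply: le_abse_integral => //; exact: measurableT_comp.
Qed.

Lemma L1_Rint2 f : m12.-integrable setT (EFin \o f) ->
  m2.-integrable setT (EFin \o (fun y => \int[m1]_x f (x, y))).
Proof.
move=> if_; have iF := integrable_fubini_G if_.
apply: le_integrable iF => //.
  by apply/measurable_EFinP/measurable_Rint2; exact: (L1_meas if_).
move=> x _ /=; rewrite /Rintegral /fubini_G /=.
by case: (\int[m1]_y (f (y, x))%:E)%E => //= ; rewrite normr0 leey.
Qed.

Lemma Rfubini1 f : m12.-integrable setT (EFin \o f) ->
  \int[m12]_z f z = \int[m1]_x \int[m2]_y f (x, y).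
Proof.
move=> if_; have iF := integrable_fubini_F if_.
rewrite {1}/Rintegral -(integral12_prod_meas1 if_); congr fine.
apply: ae_eq_integral => //; first exact: measurable_int iF.
  by apply: measurable_int (L1_Rint1 if_).
apply: filterS (integrable_ae measurableT iF) => x /(_ Logic.I) h _.
by rewrite /= /Rintegral fineK.
Qed.

Lemma Rfubini2 f : m12.-integrable setT (EFin \o f) ->
  \int[m12]_z f z = \int[m2]_y \int[m1]_x f (x, y).
Proof.
move=> if_; have iF := integrable_fubini_G if_.
rewrite {1}/Rintegral -(integral21_prod_meas1 if_); congr fine.
apply: ae_eq_integral => //; first exact: measurable_int iF.
  by apply: measurable_int (L1_Rint2 if_).
apply: filterS (integrable_ae measurableT iF) => x /(_ Logic.I) h _.
by rewrite /= /Rintegral fineK.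
Qed.

End product_measures.

(** * Countable families of test functions *)

Section determining_families.
Context {R : realType}.

(** Countability is the point: in the presence of a parameter, each function of
    the family is responsible for one null set of parameters, and their union
    remains null. *)
Definition determining d (Y : measurableType d) (nu : {measure set Y -> \bar R})
    (E : set Y) (X : nat -> Y -> R) :=
  [/\ forall n, measurable_fun setT (X n), forall n y, 0 <= X n y <= 1,
      forall n y, ~ E y -> X n y = 0 &
      forall k : Y -> R, nu.-integrable setT (EFin \o k) ->
        (forall n, \int[nu]_y (k y * X n y) = 0) ->
        {ae nu, forall y, E y -> k y = 0}].

(** All bumps with rational endpoints and support in ]c, d[, enumerated. *)
Definition rbump (c d : R) (n : nat) : R -> R :=
  if unpickle n is Some (p, q, m) then
    if (c < ratr p) && (ratr q < d) then bump (ratr p) (ratr q) m else fun=> 0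
  else fun=> 0.

Lemma rbumpP c d n : rbump c d n = (fun=> 0) \/
  exists p q m, [/\ c < p, q < d & rbump c d n = bump p q m].
Proof.
rewrite /rbump; case: unpickle => [[[p q] m]|]; last by left.
by case: ifPn => [/andP[? ?]|_]; [right; exists (ratr p), (ratr q), m|left].
Qed.

Lemma rbump_bump (c d : R) (p q : rat) m : c < ratr p -> ratr q < d ->
  exists n, rbump c d n = bump (ratr p) (ratr q) m.
Proof.
by move=> cp qd; exists (pickle (p, q, m)); rewrite /rbump pickleK cp qd.
Qed.

Lemma measurable_rbump c d n : measurable_fun setT (rbump c d n : mR R -> mR R).
Proof.
have [->|[p [q [m [_ _ ->]]]]] := rbumpP c d n; first exact: measurable_cst.
exact: measurable_bump.
Qed.

Lemma Ck_rbump c d n m : Ck m (rbump c d n).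
Proof.
have [->|[p [q [k [_ _ ->]]]]] := rbumpP c d n; first exact: Ck_cst.
exact: Ck_bump.
Qed.

Lemma rbump01 c d n x : 0 <= rbump c d n x <= 1.
Proof.
have [->|[p [q [m [_ _ ->]]]]] := rbumpP c d n; first by rewrite lexx ler01.
by rewrite bump_ge0 bump_le1.
Qed.

Lemma rbump_supp c d n : c < d -> exists p q, [/\ c < p, p < q, q < d &
  forall x, ~~ (p <= x <= q) -> rbump c d n x = 0].
Proof.
move=> cd; have [->|[p [q [m [cp qd ->]]]]] := rbumpP c d n.
  by exists ((2 * c + d) / 3), ((c + 2 * d) / 3); split => //; lra.
have [pq|qp] := ltP p q.
  exists p, q; split => // x h; apply: bump_out; apply: contra h.
  by move=> /andP[/ltW -> /ltW ->].
exists ((2 * c + d) / 3), ((c + 2 * d) / 3); split; try lra.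
by move=> x _; apply: bump_out; apply/negP => /andP[]; lra.
Qed.

(** Letting the bumps increase to indicator functions, the primitive of [k] takes
    the same value at all rational points of ]c, d[, hence is constant there by
    continuity; its derivative, almost everywhere [k], vanishes. *)
Lemma rbump_determining (c d : R) : c < d ->
  determining leb1 (`]c, d[%classic : set (mR R)) (rbump c d).
Proof.
move=> cd; split.
- exact: measurable_rbump.
- by move=> n y; exact: rbump01.
- move=> n y; have [p [q [cp _ qd h]]] := rbump_supp n cd.
  move=> cyd; apply: h; apply: contra_notN cyd => /andP[py yq].
  by rewrite /= in_itv/= (lt_le_trans cp py) (le_lt_trans yq qd).
move=> k ik hk.
have ikD (D : set (mR R)) : measurable D -> leb1.-integrable D (EFin \o k).
  by move=> mD; exact: integrableS ik.
have K0 (p q : rat) : c < ratr p -> ratr p < ratr q :> R -> ratr q < d ->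
    \int[leb1]_(x in `]ratr p, ratr q]) k x = 0.
  move=> cp pq qd; rewrite -(Rintegral_itv_bndo_bndc (ikD _ _))//.
  set f := fun m x => k x * bump (ratr p) (ratr q) m x.
  have f0 m : \int[leb1]_x f m x = 0.
    by rewrite /f; have [n <-] := rbump_bump m cp qd; exact: hk.
  have : \int[leb1]_x f m x @[m --> \oo] --> \int[leb1]_x (k x * (ratr p < x < ratr q)%R%:R).
    apply: (@Rintegral_dct _ (mR R) R leb1 _ f _ (fun x => `|k x|)) => //.
    - move=> m; apply: measurable_funM; first exact: (L1_meas ik).
      exact: measurable_bump.
    - apply: measurable_funM; first exact: (L1_meas ik).
      rewrite (_ : (fun _ => _) = \1_(`]ratr p, ratr q[)).
        exact: measurable_indic.
      by apply/funext => x; rewrite indicE mem_setE/= in_itv.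
    - by move=> x _; apply: cvgMr; exact: bump_cvg.
    - exact: L1_norm.
    - move=> m x _; rewrite normrM ler_piMr// ger0_norm ?bump_ge0//.
      exact: bump_le1.
  rewrite (_ : (fun m => _) = fun=> 0); last by apply/funext => m; exact: f0.
  move=> /(cvg_unique _ (cvg_cst 0)) h; rewrite Rintegral_mkcond [RHS]h //.
  apply: eq_Rintegral => x _; rewrite patchE mem_setE/= in_itv/=.
  by case: ifP => _; rewrite ?mulr1 ?mulr0.
have ikcd := ikD `[c, d]%classic (measurable_itv _).
have Kq (p q : rat) : c < ratr p < d -> c < ratr q < d ->
    prim c k (ratr p) = prim c k (ratr q).
  wlog pq : p q / ratr p <= ratr q :> R => [hw|].
    have [/ltW pq|qp] := ltP (ratr p : R) (ratr q); first exact: hw.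
    by move=> hp hq; apply/esym/hw.
  move=> /andP[cp pd] /andP[cq qd].
  apply/eqP; rewrite eq_sym -subr_eq0 (prim_diff ikcd (ltW cp) pq (ltW qd)).
  move: pq; rewrite le_eqVlt => /predU1P[->|pq].
    by rewrite set_itv_ge ?bnd_simp// Rintegral_set0.
  by rewrite K0.
have AK : abscont c d (prim c k) k.
  by split => // s _; rewrite prim_aa add0r.
have cdm : c < (c + d) / 2 < d by apply/andP; split; lra.
have [cm md] := andP cdm.
have [q0] := rat_in_itvoo cd; rewrite in_itv/= => cq0d.
have Kc x : c < x < d -> prim c k x = prim c k (ratr q0).
  move=> /andP[cx xd]; apply/eqP; rewrite -subr_eq0 -normr_le0.
  apply/ler_addgt0Pr => e e0; rewrite add0r.
  have cxd : c <= x <= d by rewrite !ltW.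
  have [r r0 hr] := AC_cts (ltW cd) AK cxd e0.
  have xr : x < Num.min d (x + r) by rewrite lt_min xd ltrDl.
  have [q] := rat_in_itvoo xr; rewrite in_itv/= lt_min => /andP[xq /andP[qd qr]].
  rewrite distrC (Kq q0 q)//; last by rewrite (lt_trans cx).
  apply: hr; first by rewrite !ltW// (lt_trans cx).
  by rewrite gtr0_norm ?subr_gt0//; lra.
have := @FTC1 R k (BLeft c) (fun y => ikD _ (measurable_itv _)).
have loc : locally_integrable [set: R] k.
  by have := integrable_locally_restrict measurableT ik; rewrite patch_setT.
move=> /(_ loc) [N [mN N0 sN]]; exists N; split => //.
move=> x /= nx; apply: sN => /= h; apply: nx.
rewrite in_itv/= => /andP[cx xd].
have [_ <-] := h cx.
rewrite derive1E; transitivity ('D_1 (cst (prim c k (ratr q0))) x).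
  apply: near_eq_derive; near=> y; apply: Kc; apply/andP; split.
    by rewrite -ltrN2; near: y; apply: Nlt_nbhsl; rewrite ltrN2.
  by near: y; exact: lt_nbhsl.
by rewrite derive_cst.
Unshelve. all: by end_near. Qed.

End determining_families.

Section determining_product.
Context d1 d2 (Y1 : measurableType d1) (Y2 : measurableType d2) (R : realType).
Variable m1 : {sigma_finite_measure set Y1 -> \bar R}.
Variable m2 : {sigma_finite_measure set Y2 -> \bar R}.

Definition tensor (X1 : nat -> Y1 -> R) (X2 : nat -> Y2 -> R) (n : nat)
    (z : Y1 * Y2) : R :=
  if unpickle n is Some (i, j) then X1 i z.1 * X2 j z.2 else 0.

(** Fubini's theorem, applied once for each member of the first family: almost
    every slice of [k] is orthogonal to all of them. *)
Lemma tensor_determining (E1 : set Y1) (E2 : set Y2) X1 X2 :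
  measurable E1 -> measurable E2 ->
  determining m1 E1 X1 -> determining m2 E2 X2 ->
  determining (m1 \x m2)%E (E1 `*` E2) (tensor X1 X2).
Proof.
move=> mE1 mE2 [mX1 X1b X1s D1] [mX2 X2b X2s D2]; split.
- move=> n; rewrite /tensor; case: unpickle => [[i j]|//].
  apply: measurable_funM.
    exact: measurableT_comp (mX1 i) measurable_fst.
  exact: measurableT_comp (mX2 j) measurable_snd.
- move=> n y; rewrite /tensor; case: unpickle => [[i j]|]; last by rewrite lexx ler01.
  have /andP[? ?] := X1b i y.1; have /andP[? ?] := X2b j y.2.
  by rewrite mulr_ge0//= mulr_ile1.
- move=> n y; rewrite /tensor; case: unpickle => [[i j]|//].
  by move=> /not_andP[/X1s ->|/X2s ->]; rewrite ?mul0r ?mulr0.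
move=> k ik hk; have mk := L1_meas ik.
have ikX i : (m1 \x m2)%E.-integrable setT (EFin \o (fun z => X1 i z.1 * k z)).
  apply: (@L1M_bdd _ _ _ _ _ k (fun z => X1 i z.1) 1) => //.
    exact: measurableT_comp (mX1 i) measurable_fst.
  by move=> z _; have /andP[? ?] := X1b i z.1; rewrite ger0_norm.
pose h i y := \int[m1]_x (X1 i x * k (x, y)).
have h0 : {ae m2, forall y, forall i, E2 y -> h i y = 0}.
  apply: ae_foralln => i; apply: (D2 (h i)); first exact: L1_Rint2 (ikX i).
  move=> j; have := hk (pickle (i, j)).
  have ikXX : (m1 \x m2)%E.-integrable setT
      (EFin \o (fun z => X2 j z.2 * (X1 i z.1 * k z))).
    apply: (@L1M_bdd _ _ _ _ _ (fun z => X1 i z.1 * k z) (fun z => X2 j z.2) 1) => //.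
      exact: measurableT_comp (mX2 j) measurable_snd.
    by move=> z _; have /andP[? ?] := X2b j z.2; rewrite ger0_norm.
  rewrite /tensor pickleK.
  under eq_Rintegral do rewrite mulrCA mulrA mulrC.
  move=> hz; rewrite -[RHS]hz.
  rewrite (_ : (fun z => _) = (fun z => X2 j z.2 * (X1 i z.1 * k z))); last first.
    by apply/funext => z; ring.
  rewrite (Rfubini2 ikXX) /=.
  apply: ae_eq_Rintegral => //.
  - by apply: measurable_funM => //; exact: L1_meas (L1_Rint2 (ikX i)).
  - exact: L1_meas (L1_Rint2 ikXX).
  - have := ae_integrable2 (ikX i); apply: filterS => y iy _.
    by rewrite /h mulrC RintegralZl.
have ky := ae_integrable2 ik.
have mE : measurable (E1 `*` E2) by exact: measurableX.
apply: prod_ae2.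
  rewrite (_ : mkset _ = (E1 `*` E2) `&` (k @^-1` [set~ 0])); last first.
    by apply/seteqP; split => z /= => [/not_implyP|[? ?]]; last by apply/not_implyP.
  apply: measurableI => //; rewrite -[X in measurable X]setTI.
  by apply: mk => //; exact: measurableC.
have := h0; have := ky; apply: filterS2 => y iky hy.
have [E2y|nE2y] := pselect (E2 y); last by apply: aeW => x -[].
have := D1 (fun x => k (x, y)) iky _.
have h1 n : \int[m1]_x (k (x, y) * X1 n x) = 0.
  by rewrite -[RHS](hy n E2y) /h; apply: eq_Rintegral => x _; rewrite mulrC.
by move=> /(_ h1); apply: filterS => x kx [/= E1x _]; exact: kx.
Qed.

End determining_product.

(** * The lemma of du Bois-Reymond with a parameter *)

Section du_bois_reymond.
Context {R : realType}.
Implicit Types (a b : R) (f g : R -> R).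

Definition bump0 a b : R -> R := bump ((2 * a + b) / 3) ((a + 2 * b) / 3) 0.
Definition zeta_coef a b n : R := (\int[leb1]_x rbump a b n x) / (\int[leb1]_x bump0 a b x).

(** The functions [rbump a b n] corrected by a multiple of the fixed bump [bump0],
    so as to have integral 0 and hence a primitive [Zeta] with compact support
    in ]a, b[. *)
Definition zeta a b n (x : R) : R := rbump a b n x - zeta_coef a b n * bump0 a b x.

Definition Zeta a b n (x : R) : R := \int[leb1]_(r in `]-oo, x]) zeta a b n r.

Lemma L1_supp (p q : R) (h : R -> R) : measurable_fun setT (h : mR R -> mR R) ->
  (forall x, `|h x| <= 1) -> (forall x, ~~ (p <= x <= q) -> h x = 0) ->
  leb1.-integrable setT (EFin \o h).
Proof.
move=> mh h1 hs; apply: (@L1_le _ (mR R) R leb1 _ _ (\1_`[p, q])) => //.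
  move=> x _; rewrite indicE mem_setE/= in_itv/=.
  by have [h1x|/hs ->] := boolP (p <= x <= q); [exact: h1|rewrite normr0].
exact: (@integrable_indic_itv R p q true false).
Qed.

Lemma L1_bump p q n : leb1.-integrable setT (EFin \o (bump p q n : R -> R)).
Proof.
apply: (@L1_supp p q); first exact: measurable_bump.
- by move=> x; rewrite ger0_norm ?bump_ge0 ?bump_le1.
- by move=> x h; apply: bump_out; apply: contra h => /andP[/ltW -> /ltW ->].
Qed.

Lemma L1_rbump a b n : leb1.-integrable setT (EFin \o (rbump a b n)).
Proof.
have [->|[p [q [m [_ _ ->]]]]] := rbumpP a b n; last exact: L1_bump.
exact: integrable0.
Qed.

Lemma bump_mass p q n : p < q -> 0 < \int[leb1]_x (bump p q n x : R).
Proof.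
move=> pq; rewrite lt_neqAle Rintegral_ge0 ?andbT; last first.
  by move=> x _; exact: bump_ge0.
apply/eqP => h.
have e0 : (\int[leb1]_x `|(bump p q n x)%:E| = 0)%E.
  rewrite -[RHS]/(0%:E) h /Rintegral fineK; last first.
    exact: integrable_fin_num (L1_bump p q n).
  by apply: eq_integral => x _; rewrite gee0_abs ?lee_fin ?bump_ge0.
have mE : measurable_fun setT (EFin \o (bump p q n : mR R -> mR R)).
  by apply/measurable_EFinP; exact: measurable_bump.
have [N [mN N0 sN]] := (ae_eq_integral_abs leb1 measurableT mE).1 e0.
have : (leb1 `]p, q[%classic <= leb1 N)%E.
  apply: le_measure; rewrite ?inE//=.
  move=> x; rewrite /= in_itv/= => /andP[px xq]; apply: sN => /= /(_ Logic.I) [].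
  by apply/eqP; rewrite gt_eqF// bump_gt0.
rewrite [leb1 N]N0 /leb1 lebesgue_measure_itv/= lte_fin pq -EFinB lee_fin.
lra.
Qed.

Lemma bump0_supp a b x : a < b -> ~~ ((2 * a + b) / 3 <= x <= (a + 2 * b) / 3) -> bump0 a b x = 0.
Proof.
by move=> ab h; apply: bump_out; apply: contra h => /andP[/ltW -> /ltW ->].
Qed.

Lemma bump0_mass a b : a < b -> 0 < \int[leb1]_x bump0 a b x.
Proof. by move=> ab; apply: bump_mass; lra. Qed.

Lemma L1_zeta a b n : leb1.-integrable setT (EFin \o zeta a b n).
Proof.
apply: L1B => //; first exact: L1_rbump.
by apply: L1Z => //; exact: L1_bump.
Qed.

Lemma Ck_zeta a b n m : Ck m (zeta a b n).
Proof.
rewrite (_ : zeta a b n = (fun x => rbump a b n x + (- zeta_coef a b n) * bump0 a b x)).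
  apply: CkD; first exact: Ck_rbump.
  by apply: CkM; [exact: Ck_cst|exact: Ck_bump].
by apply/funext => x; rewrite /zeta mulNr.
Qed.

Lemma int_zeta a b n : a < b -> \int[leb1]_x zeta a b n x = 0.
Proof.
move=> ab; rewrite RintegralB//; last 2 first.
- exact: L1_rbump.
- by apply: L1Z => //; exact: L1_bump.
rewrite RintegralZl//; last exact: L1_bump.
by rewrite /zeta_coef divfK ?subrr// gt_eqF// bump0_mass.
Qed.

Lemma zeta_supp a b n : a < b -> exists p q, [/\ a < p, p < q, q < b &
  forall x, ~~ (p <= x <= q) -> zeta a b n x = 0].
Proof.
move=> ab; have [p [q [ap pq qb h]]] := rbump_supp n ab.
exists (Num.min p ((2 * a + b) / 3)), (Num.max q ((a + 2 * b) / 3)); split.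
- by rewrite lt_min ap/=; lra.
- by rewrite lt_max !gt_min pq.
- by rewrite gt_max qb/=; lra.
move=> x hx; rewrite /zeta h ?bump0_supp ?mulr0 ?subrr//; apply: contra hx;
  by move=> /andP[h1 h2]; rewrite ge_min le_max h1 h2 ?orbT.
Qed.

Lemma Zeta_supp a b n : a < b -> exists p q, [/\ a < p, p < q, q < b &
  forall x, ~~ (p <= x <= q) -> Zeta a b n x = 0].
Proof.
move=> ab; have [p [q [ap pq qb h]]] := zeta_supp n ab; exists p, q; split => // x.
rewrite negb_and -!ltNge => /orP[xp|qx].
  rewrite /Zeta (@eq_Rintegral _ _ _ _ _ (fun=> 0)) ?Rintegral_cst ?mul0r//.
  move=> r; rewrite inE/= in_itv/= => rx; apply: h.
  by rewrite negb_and -!ltNge (le_lt_trans rx).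
rewrite -(int_zeta n ab) (@Rintegral_supp _ (mR R) R leb1 `]-oo, x]%classic)// => r.
rewrite /= in_itv/= => /negP; rewrite -ltNge => xr; apply: h.
by rewrite negb_and -!ltNge (lt_trans qx) ?orbT.
Qed.

Lemma is_derive_Zeta a b n (x : R) : is_derive x (1 : R) (Zeta a b n) (zeta a b n x).
Proof.
have ix u : leb1.-integrable `]-oo, u] (EFin \o zeta a b n).
  by apply: integrableS (L1_zeta a b n).
have xu : x < x + 1 by rewrite ltrDl.
have cz : {for x, continuous (zeta a b n)}.
  exact: (@Ck_continuous _ _ 0 _ (Ck_zeta a b n 0)).
have [d e] := @continuous_FTC1 R (zeta a b n) -oo%O x (x + 1) xu (ix _) (ltNyr x) cz.
by apply: DeriveDef => //; rewrite -e derive1E.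
Qed.

Lemma Ck_Zeta a b n m : Ck m (Zeta a b n).
Proof. by apply/Ck_pred/(CkS1 (is_derive_Zeta a b n)); exact: Ck_zeta. Qed.

End du_bois_reymond.

Section slicing.
Context {R : realType}.
Implicit Types (a b : R).

(** If [f = C + prim a g], then [C] is the average of [f - prim a g] against
    [bump0].  An explicit formula is needed to see that the constant depends
    measurably on a parameter. *)
Definition dbr_const a b (f g : R -> R) : R :=
  (\int[leb1]_(s in `[a, b]) (bump0 a b s * (f s - prim a g s))) /
  \int[leb1]_s bump0 a b s.

Lemma zeta_le a b n x : `|zeta a b n x| <= 1 + `|zeta_coef a b n|.
Proof.
rewrite /zeta; apply: le_trans (ler_normB _ _) _; apply: lerD.
  by have /andP[? ?] := rbump01 a b n x; rewrite ger0_norm.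
by rewrite normrM ler_piMr// ger0_norm ?bump_ge0// bump_le1.
Qed.

Lemma Zeta_le a b n x : `|Zeta a b n x| <= \int[leb1]_r `|zeta a b n r|.
Proof.
have iz := L1_zeta a b n.
have izx : leb1.-integrable `]-oo, x] (EFin \o zeta a b n).
  by apply: integrableS iz.
apply: le_trans (le_normr_Rintegral _ izx) _ => //.
apply: fine_le; try by apply: integrable_fin_num => //; exact: integrable_norm.
apply: ge0_subset_integral => //.
apply/measurable_EFinP; apply: measurableT_comp => //; exact: (L1_meas iz).
Qed.

Lemma measurable_zeta a b n : measurable_fun setT (zeta a b n : mR R -> mR R).
Proof. by have := L1_meas (L1_zeta a b n). Qed.

Lemma measurable_Zeta a b n : measurable_fun setT (Zeta a b n : mR R -> mR R).
Proof.
apply: continuous_measurable_fun.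
exact: (@Ck_continuous _ _ 0 _ (Ck_Zeta a b n 0)).
Qed.

(** Integrating by parts, [f - prim a g] is orthogonal to every [zeta a b n]; by
    the choice of the coefficient in [zeta] this says that [f - prim a g - C] is
    orthogonal to every [rbump a b n]. *)
Lemma du_bois_reymond a b (f g : R -> R) : a < b ->
  leb1.-integrable setT (EFin \o f) -> leb1.-integrable setT (EFin \o g) ->
  (forall n, \int[leb1]_s (f s * zeta a b n s + g s * Zeta a b n s) = 0) ->
  {ae leb1, forall s, a < s < b -> f s = dbr_const a b f g + prim a g s}.
Proof.
move=> ab if_ ig H.
pose D : set (mR R) := `[a, b]%classic.
have mD : measurable D by exact: measurable_itv.
have ifD : leb1.-integrable D (EFin \o f) by exact: integrableS if_.
have igD : leb1.-integrable D (EFin \o g) by exact: integrableS ig.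
have AG : abscont a b (prim a g) g.
  by split => // s _; rewrite prim_aa add0r.
have iG : leb1.-integrable D (EFin \o prim a g).
  apply: continuous_compact_integrable; first exact: segment_compact.
  exact: AC_cont (ltW ab) AG.
have AZ n : abscont a b (Zeta a b n) (zeta a b n).
  apply: AC_C1 => //; first exact: is_derive_Zeta.
  exact: (@Ck_continuous _ _ 0 _ (Ck_zeta a b n 0)).
pose u s := f s - prim a g s.
have iu : leb1.-integrable D (EFin \o u) by exact: L1B.
have mul1 (h : R -> R) (v : R -> R) M : measurable_fun setT (h : mR R -> mR R) ->
    (forall x, `|h x| <= M) -> leb1.-integrable D (EFin \o v) ->
    leb1.-integrable D (EFin \o (fun s => h s * v s)).
  move=> mh hM iv; apply: (@L1M_bdd _ (mR R) R leb1 D v h M) => //.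
  exact: measurable_funS mh.
have iuz n : leb1.-integrable D (EFin \o (fun s => zeta a b n s * u s)).
  apply: mul1 iu; [exact: measurable_zeta|exact: zeta_le].
(* Integration by parts of [prim a g] against [Zeta a b n]. *)
have uz n : \int[leb1]_(s in D) (zeta a b n s * u s) = 0.
  have [p [q [ap pq qb hs]]] := zeta_supp n ab.
  have [p' [q' [ap' pq' qb' hS]]] := Zeta_supp n ab.
  have := H n; rewrite (@Rintegral_supp _ (mR R) R leb1 D); last first.
    move=> x Dx; rewrite hs ?hS ?mulr0 ?addr0//; apply: contra_notN Dx.
      by move=> /andP[? ?]; rewrite /D/= in_itv/=; apply/andP; split; lra.
    by move=> /andP[? ?]; rewrite /D/= in_itv/=; apply/andP; split; lra.
  have Za : Zeta a b n a = 0 by apply: hS; apply/negP => /andP[]; lra.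
  have Zb : Zeta a b n b = 0 by apply: hS; apply/negP => /andP[]; lra.
  have := AC_int0 (ltW ab) (AC_mul (ltW ab) (AZ n) AG).
  rewrite Za Zb !mul0r => /(_ erefl erefl) e1 e2.
  have iZ : leb1.-integrable D (EFin \o (fun s => Zeta a b n s * g s)).
    by apply: mul1 igD; [exact: measurable_Zeta|exact: Zeta_le].
  have izf : leb1.-integrable D (EFin \o (fun s => zeta a b n s * f s)).
    by apply: mul1 ifD; [exact: measurable_zeta|exact: zeta_le].
  have izG : leb1.-integrable D (EFin \o (fun s => zeta a b n s * prim a g s)).
    by apply: mul1 iG; [exact: measurable_zeta|exact: zeta_le].
  rewrite -[RHS](subrr (0 : R)) -{1}e2 -e1 -RintegralB//; last 2 first.
  - rewrite (_ : (fun s => _) = (fun s => zeta a b n s * f s + Zeta a b n s * g s)).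
      exact: L1D.
    by apply/funext => s; ring.
  - exact: L1D.
  by apply: eq_Rintegral => s _; rewrite /u; ring.
pose C := dbr_const a b f g.
pose k s := if a <= s <= b then u s - C else 0.
have kE : k = (fun s => u s - C) \_ D.
  by apply/funext => s; rewrite patchE mem_setE/= in_itv.
have ik : leb1.-integrable setT (EFin \o k).
  rewrite kE -restrict_EFin; apply: (integrable_mkcond _ mD).1.
  apply: (@L1B _ (mR R) R leb1 D u (fun=> C) mD iu); apply: measurable_bounded_integrable => //.
    have lD : (@lebesgue_measure R D < +oo)%E.
      by rewrite /D lebesgue_measure_itv/= lte_fin ab -EFinB ltry.
    exact: lD.
  by exists `|C|; split => // x Cx y _ /=; exact: ltW.
have b0pos := bump0_mass ab.
have iub0 : leb1.-integrable D (EFin \o (fun s => bump0 a b s * u s)).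
  apply: mul1 iu; first exact: measurable_bump.
  by move=> x; rewrite ger0_norm ?bump_ge0//; exact: bump_le1.
have [_ _ _ /(_ k ik)] := rbump_determining ab.
have h n : \int[leb1]_y (k y * rbump a b n y) = 0.
  have [p [q [ap pq qb hs]]] := rbump_supp n ab.
  have rs x : ~ D x -> rbump a b n x = 0.
    move=> Dx; apply: hs; apply: contra_notN Dx.
    by move=> /andP[? ?]; rewrite /D/= in_itv/=; apply/andP; split; lra.
  rewrite (@Rintegral_supp _ (mR R) R leb1 D); last first.
    by move=> x /rs ->; rewrite mulr0.
  have iru : leb1.-integrable D (EFin \o (fun s => rbump a b n s * u s)).
    apply: (mul1 _ _ 1 _ _ iu); first exact: measurable_rbump.
    by move=> x; have /andP[? ?] := rbump01 a b n x; rewrite ger0_norm.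
  have ir : leb1.-integrable D (EFin \o rbump a b n).
    by apply: integrableS (L1_rbump a b n).
  transitivity (\int[leb1]_(s in D) (rbump a b n s * u s - C * rbump a b n s)).
    apply: eq_Rintegral => s; rewrite inE /D/= in_itv/= => sab.
    by rewrite /k sab; ring.
  rewrite RintegralB//; last exact: L1Z.
  rewrite RintegralZl//.
  have := uz n; rewrite /zeta.
  rewrite (_ : (fun s => _) = (fun s => rbump a b n s * u s -
      zeta_coef a b n * (bump0 a b s * u s))); last first.
    by apply/funext => s; ring.
  rewrite RintegralB//; last exact: L1Z.
  rewrite RintegralZl// => /eqP; rewrite subr_eq0 => /eqP ->.
  rewrite -(Rintegral_supp leb1 rs) /zeta_coef /C /dbr_const -/D -/u.
  by field; rewrite gt_eqF.
move=> /(_ h); apply: filterS => s ks /andP[as_ sb].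
have := ks; rewrite /= in_itv/= as_ sb => /(_ isT).
by rewrite /k !ltW// /u => /eqP; rewrite subr_eq0 subr_eq => /eqP.
Qed.

Section slice.
Context d (Y : measurableType d) (nu : {sigma_finite_measure set Y -> \bar R}).
Local Notation lnu := (leb1 \x nu)%E.

Lemma measurable_prim a (g : R * Y -> R) :
  measurable_fun setT (g : (mR R * Y)%type -> R) ->
  measurable_fun setT (fun z : mR R * Y => prim a (fun r => g (r, z.2)) z.1).
Proof.
move=> mg.
pose h (w : (mR R * Y) * mR R) : R :=
  if (a <= w.2) && (w.2 <= w.1.1) then g (w.2, w.1.2) else 0.
have mh : measurable_fun setT h.
  apply: measurable_fun_if => //.
  - apply: measurable_and.
      by apply: measurable_fun_ler => //; exact: measurable_snd.
    apply: measurable_fun_ler; first exact: measurable_snd.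
    exact: measurableT_comp measurable_fst measurable_fst.
  - apply: measurable_funTS; apply: (measurableT_comp mg).
    apply/measurable_fun_pairP; split; first exact: measurable_snd.
    exact: measurableT_comp measurable_snd measurable_fst.
rewrite (_ : (fun z => _) = (fun z => \int[leb1]_r h (z, r))).
  exact: measurable_Rint1.
apply/funext => z; rewrite /prim Rintegral_mkcond; apply: eq_Rintegral => r _.
by rewrite patchE mem_setE/= in_itv.
Qed.

(** Du Bois-Reymond with a parameter [y].  Integrating first against the factor
    in [y] shows that almost every slice satisfies the hypotheses of
    [du_bois_reymond] for the countably many [zeta a b n]. *)
Lemma slice a b (E : set Y) (X : nat -> Y -> R) (f g : R * Y -> R) :
  a < b -> measurable E -> determining nu E X ->
  lnu.-integrable setT (EFin \o f) -> lnu.-integrable setT (EFin \o g) ->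
  (forall n m, \int[lnu]_z
    (f z * (zeta a b n z.1 * X m z.2) + g z * (Zeta a b n z.1 * X m z.2)) = 0) ->
  exists C : Y -> R, {ae lnu, forall z, a < z.1 < b -> E z.2 ->
    f z = C z.2 + prim a (fun r => g (r, z.2)) z.1}.
Proof.
move=> ab mE [mX X01 Xs DX] if_ ig H.
have mf := L1_meas if_; have mg := L1_meas ig.
have m1 (h : R -> R) : measurable_fun setT (h : mR R -> mR R) ->
    measurable_fun setT (fun z : mR R * Y => h z.1).
  by move=> mh; exact: measurableT_comp mh measurable_fst.
have mul1 (h : R -> R) v M : measurable_fun setT (h : mR R -> mR R) ->
    (forall x, `|h x| <= M) -> lnu.-integrable setT (EFin \o v) ->
    lnu.-integrable setT (EFin \o (fun z => h z.1 * v z)).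
  move=> mh hM iv; apply: (@L1M_bdd _ _ R lnu setT v (fun z => h z.1) M) => //.
  exact: m1.
pose w n z := zeta a b n z.1 * f z + Zeta a b n z.1 * g z.
have iw n : lnu.-integrable setT (EFin \o w n).
  apply: L1D => //.
    by apply: mul1 if_; [exact: measurable_zeta|exact: zeta_le].
  by apply: mul1 ig; [exact: measurable_Zeta|exact: Zeta_le].
(* The defect of the hypothesis of [du_bois_reymond] on the slice at [y]. *)
pose k n y := \int[leb1]_s w n (s, y).
have k0 : {ae nu, forall y, forall n, E y -> k n y = 0}.
  apply: ae_foralln => n; apply: DX; first exact: L1_Rint2 (iw n).
  move=> m; rewrite -[RHS](H n m).
  have iXw : lnu.-integrable setT (EFin \o (fun z => X m z.2 * w n z)).
    apply: (@L1M_bdd _ _ R lnu setT (w n) (fun z => X m z.2) 1) => //.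
      exact: measurableT_comp (mX m) measurable_snd.
    by move=> z _; have /andP[? ?] := X01 m z.2; rewrite ger0_norm.
  transitivity (\int[lnu]_z (X m z.2 * w n z)); last first.
    by apply: eq_Rintegral => z _; rewrite /w; ring.
  rewrite (Rfubini2 iXw); apply: ae_eq_Rintegral => //.
  - by apply: measurable_funM => //; exact: L1_meas (L1_Rint2 (iw n)).
  - exact: L1_meas (L1_Rint2 iXw).
  - have := ae_integrable2 (iw n); apply: filterS => y iy _.
    by rewrite /k mulrC /= RintegralZl.
pose F (z : R * Y) := prim a (fun r => g (r, z.2)) z.1.
have mF : measurable_fun setT (F : (mR R * Y)%type -> R) by exact: measurable_prim.
pose C y := dbr_const a b (fun s => f (s, y)) (fun s => g (s, y)).
have mC : measurable_fun setT C.
  apply: measurable_funM => //.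
  pose h (z : mR R * Y) : R := if a <= z.1 <= b then bump0 a b z.1 * (f z - F z) else 0.
  rewrite (_ : (fun y => _) = (fun y => \int[leb1]_s h (s, y))).
    apply: measurable_Rint2; apply: measurable_fun_if => //.
    - apply: measurable_and.
        by apply: measurable_fun_ler => //; exact: measurable_fst.
      by apply: measurable_fun_ler => //; exact: measurable_fst.
    - apply: measurable_funTS; apply: measurable_funM.
        by apply: m1; exact: measurable_bump.
      exact: measurable_funB.
  apply/funext => y; rewrite Rintegral_mkcond; apply: eq_Rintegral => s _.
  by rewrite patchE mem_setE/= in_itv.
exists C; apply: prod_ae2.
  pose B : set (mR R * Y) := `]a, b[%classic `*` E.
  have mB : measurable B by exact: measurableX.
  pose e z := f z - (C z.2 + F z).
  have me : measurable_fun setT (e : (mR R * Y)%type -> R).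
    apply: measurable_funB => //; apply: measurable_funD => //.
    exact: measurableT_comp mC measurable_snd.
  rewrite (_ : mkset _ = B `&` (e @^-1` [set~ 0])).
    apply: measurableI => //; rewrite -[X in measurable X]setTI.
    by apply: me => //; exact: measurableC.
  apply/seteqP; split => z; rewrite /B /e /= in_itv/=.
    move=> /not_implyP[? /not_implyP[? h]]; split => //.
    by move=> /eqP; rewrite subr_eq0 => /eqP.
  by move=> [[? ?] h]; apply/not_implyP; split => //; apply/not_implyP; split => // e';
    apply: h; rewrite e' subrr.
have := k0; have := ae_integrable2 ig.
have := ae_integrable2 if_; apply: filterS3 => y ify igy ky.
have [Ey|nEy] := pselect (E y); last by apply: aeW => s _ /nEy.
have := du_bois_reymond ab ify igy _.
have h n : \int[leb1]_s (f (s, y) * zeta a b n s + g (s, y) * Zeta a b n s) = 0.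
  by rewrite -[RHS](ky n Ey); apply: eq_Rintegral => s _; rewrite /w; ring.
move=> /(_ h) [N [mN N0 sN]]; exists N; split => // s /= hs; apply: sN => /= e.
by apply: hs => sab _; exact: e.
Qed.

End slice.
End slicing.

(** * Topology of the plane *)

Section topology_of_the_plane.

(** Otherwise a sequence of points [z n] in [K] outside [O n] has a cluster point
    in some [O m], which contains none of the later points. *)
Lemma compact_increasing (T : topologicalType) (K : set T) (O : nat -> set T) :
  compact K -> (forall n, open (O n)) -> (forall n, O n `<=` O n.+1) ->
  K `<=` \bigcup_n O n -> exists n, K `<=` O n.
Proof.
move=> cK oO incO KO; apply: contrapT => /forallNP nK.
have /choice[z zP] n : exists z, K z /\ ~ O n z.
  apply: contrapT => /forallNP h; apply: (nK n) => z Kz; apply: contrapT => Oz.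
  exact: (h z).
have incr m n : (m <= n)%N -> O m `<=` O n.
  move=> /subnK <-; elim: (n - m)%N => [//|k IH]; rewrite addSn.
  exact: subset_trans IH (incO _).
have [|x [Kx cx]] := cK (z @ \oo) _.
  by exists 0%N => // n _; exact: (zP n).1.
have [m _ Om] := KO x Kx.
have Ox : nbhs x (O m) by exact: open_nbhs_nbhs.
have [y [[n /= mn <-] Oz]] := cx [set z n | n in [set n | (m <= n)%N]] (O m)
  (filterS (fun n mn => ex_intro2 _ _ n mn erefl) (nbhs_infty_ge m)) Ox.
by have [_] := zP n; apply; exact: incr Oz.
Qed.

Context {R : realType}.

Lemma rat_box (x e : R) : 0 < e -> exists p q : rat,
  ratr p < x < ratr q /\ forall t, ratr p < t < ratr q -> `|x - t| < e.
Proof.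
move=> e0; have xe : x - e < x by rewrite ltrBlDr ltrDl.
have ex : x < x + e by rewrite ltrDl.
have [p] := rat_in_itvoo xe; have [q] := rat_in_itvoo ex.
rewrite !in_itv/= => /andP[xq qe] /andP[ep px]; exists p, q; split.
  by rewrite px.
move=> t /andP[pt tq]; rewrite ltr_norml; apply/andP; split; lra.
Qed.

(** An open set is the union of the rational boxes that it contains. *)
Lemma open_measurable2 (A : set (R * R)) : open A -> measurable (A : set (mR2 R)).
Proof.
move=> oA.
pose bx (w : (rat * rat) * (rat * rat)) : set (mR2 R) :=
  `]ratr w.1.1, ratr w.1.2[%classic `*` `]ratr w.2.1, ratr w.2.2[%classic.
pose F n : set (mR2 R) :=
  if unpickle n is Some w then if `[< bx w `<=` A >] then bx w else set0 else set0.
rewrite (_ : A = \bigcup_n F n).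
  apply: bigcup_measurable => n _; rewrite /F; case: unpickle => // w.
  by case: ifP => // _; exact: measurableX.
apply/seteqP; split => [[x y] Axy|z [n _]]; last first.
  by rewrite /F; case: unpickle => // w; case: ifPn => // /asboolP; apply.
have /nbhs_ballP[e /= e0 eA] : nbhs (x, y) A by exact: open_nbhs_nbhs.
have [p1 [q1 [x1 h1]]] := rat_box x e0.
have [p2 [q2 [y1 h2]]] := rat_box y e0.
set w := ((p1, q1), (p2, q2)); exists (pickle w); first exact: Logic.I.
rewrite /F pickleK ifT.
  by split; rewrite /= in_itv.
apply/asboolP => -[s t] [/=]; rewrite !in_itv/= => /h1 sx /h2 ty.
by apply: eA; split.
Qed.

Lemma continuous_measurable2 (f : R * R -> R) : continuous f ->
  measurable_fun setT (f : mR2 R -> mR R).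
Proof.
move=> /continuousP cf; apply: (measurability _ (RGenOpens.measurableE R)).
move=> _ [_ [a [b ->] <-]]; rewrite setTI; apply: open_measurable2.
exact/cf/interval_open.
Qed.

Lemma is_derive_affine (E F : normedModType R) (A L : E -> F) (f : F -> R) (v x : E) :
  (forall h w y, A (h *: w + y) = h *: L w + A y) ->
  derivable f (A x) (L v) -> is_derive x v (f \o A) ('D_(L v) f (A x)).
Proof.
move=> AL df.
have e : (fun h : R => h^-1 *: ((f \o A \o shift x) (h *: v) - (f \o A) x)) =
         (fun h : R => h^-1 *: ((f \o shift (A x)) (h *: L v) - f (A x))).
  by apply/funext => h /=; rewrite AL.
by split; [rewrite /derivable e; exact: df|rewrite /derive e].
Qed.

Lemma derive_supp (E : normedModType R) (K : set E) (f : E -> R) v :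
  closed K -> (forall x, ~ K x -> f x = 0) -> forall x, ~ K x -> 'D_v f x = 0.
Proof.
move=> cK f0 x Kx; transitivity ('D_v (cst 0 : E -> R) x).
  apply: near_eq_derive; have : nbhs x (~` K).
    by apply: open_nbhs_nbhs; split => //; exact: closed_openC.
  by apply: filterS => y; exact: f0.
by rewrite derive_cst.
Qed.

Lemma test_derivable (E : normedModType R) (U : set E) (f : E -> R) v n :
  test_function U f -> Ck n ('D_v f) /\ (forall x, derivable f x v).
Proof. by move=> [Cf _]; have [_ /(_ v)[? ?]] := Cf n.+1. Qed.

Lemma compact_closedE (E : normedModType R) (K : set E) : compact K -> closed K.
Proof. by apply: compact_closed; exact: norm_hausdorff. Qed.

End topology_of_the_plane.

(** * Weak derivatives on products of intervals *)

Section weak_derivatives.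
Context {R : realType}.

(** An open interval, presented as an increasing union of bounded intervals
    whose closures it contains. *)
Record exhaust := Exhaust {
  lo : nat -> R;
  hi : nat -> R;
  lo_hi : forall n, lo n < hi n;
  lo_decr : forall n, lo n.+1 < lo n;
  hi_incr : forall n, hi n < hi n.+1 }.

Definition oitv (e : exhaust) n : set R := `]lo e n, hi e n[%classic.
Definition citv (e : exhaust) n : set R := `[lo e n, hi e n]%classic.
Definition span (e : exhaust) : set R := \bigcup_n oitv e n.

Lemma oitv_citv e n : oitv e n `<=` citv e n.
Proof.
by move=> x; rewrite /oitv /citv /= !in_itv/= => /andP[/ltW -> /ltW ->].
Qed.

Lemma citv_oitv e n : citv e n `<=` oitv e n.+1.
Proof.
move=> x; rewrite /oitv /citv /= !in_itv/= => /andP[h1 h2].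
by rewrite (lt_le_trans (lo_decr e n) h1) (le_lt_trans h2 (hi_incr e n)).
Qed.

Definition prod_span (e1 e2 : exhaust) : set (R * R) := span e1 `*` span e2.
Definition obox (e1 e2 : exhaust) n : set (R * R) := oitv e1 n `*` oitv e2 n.
Definition cbox (e1 e2 : exhaust) n : set (R * R) := citv e1 n `*` citv e2 n.

Lemma obox_cbox e1 e2 n : obox e1 e2 n `<=` cbox e1 e2 n.
Proof. by move=> z [h1 h2]; split; exact: oitv_citv. Qed.

Lemma cbox_obox e1 e2 n : cbox e1 e2 n `<=` obox e1 e2 n.+1.
Proof. by move=> z [h1 h2]; split; exact: citv_oitv. Qed.

Lemma obox_span e1 e2 n : obox e1 e2 n `<=` prod_span e1 e2.
Proof. by move=> z [h1 h2]; split; exists n. Qed.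

Lemma cbox_span e1 e2 n : cbox e1 e2 n `<=` prod_span e1 e2.
Proof. exact: subset_trans (@cbox_obox _ _ _) (@obox_span _ _ _). Qed.

Lemma oitv_mono e m n : (m <= n)%N -> oitv e m `<=` oitv e n.
Proof.
move=> /subnK <-; elim: (n - m)%N => [//|k IH]; rewrite addSn.
exact: subset_trans IH (subset_trans (@oitv_citv _ _) (@citv_oitv _ _)).
Qed.

Lemma span_obox e1 e2 z : prod_span e1 e2 z -> exists n, obox e1 e2 n z.
Proof.
move=> [[m _ h1] [n _ h2]]; exists (maxn m n); split.
  by apply: oitv_mono h1; exact: leq_maxl.
by apply: oitv_mono h2; exact: leq_maxr.
Qed.

Lemma compact_cbox e1 e2 n : compact (cbox e1 e2 n).
Proof. by apply: compact_setX; exact: segment_compact. Qed.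

Lemma open_obox e1 e2 n : open (obox e1 e2 n).
Proof.
rewrite /obox (_ : _ `*` _ = (fst @^-1` oitv e1 n) `&` (snd @^-1` oitv e2 n))//.
apply: openI.
  by apply: open_comp; [move=> x _; exact: cvg_fst|exact: interval_open].
by apply: open_comp; [move=> x _; exact: cvg_snd|exact: interval_open].
Qed.

Lemma measurable_oitv e n : measurable (oitv e n : set (mR R)).
Proof. exact: measurable_itv. Qed.

Lemma measurable_cbox e1 e2 n : measurable (cbox e1 e2 n : set (mR2 R)).
Proof. by apply: measurableX; exact: measurable_itv. Qed.

Lemma compact_sub_obox e1 e2 K : compact K -> K `<=` prod_span e1 e2 ->
  exists n, K `<=` obox e1 e2 n.
Proof.
move=> cK KU; apply: (compact_increasing (O := obox e1 e2)) => //.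
- by move=> n; exact: open_obox.
- by move=> n; exact: subset_trans (@obox_cbox _ _ _) (@cbox_obox _ _ _).
- by move=> z /KU /span_obox[n]; exists n.
Qed.

(** Boxes exhaust the domain, so a locally integrable function can be cut off
    and integrated against bounded functions over the whole plane. *)
Lemma locL1 e1 e2 n (g h : R * R -> R) (M : R) :
  loc_integrable2 (prod_span e1 e2) g ->
  measurable_fun setT (h : mR2 R -> mR R) -> (forall z, `|h z| <= M) ->
  (forall z, ~ cbox e1 e2 n z -> h z = 0) ->
  leb2.-integrable setT (EFin \o (fun z => h z * g z)).
Proof.
move=> lg mh hM hs; have mB := measurable_cbox e1 e2 n.
have ig := lg _ (@compact_cbox e1 e2 n) (@cbox_span e1 e2 n).
have ihg : leb2.-integrable (cbox e1 e2 n) (EFin \o (fun z => h z * g z)).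
  by apply: L1M_bdd ig => //; exact: measurable_funS mh.
have := (integrable_mkcond _ mB).1 ihg.
rewrite restrict_EFin (_ : (fun z => h z * g z) \_ _ = (fun z => h z * g z))//.
apply/funext => z; rewrite patchE; case: ifPn => // /negP Bz.
by rewrite hs ?mul0r// => h'; apply: Bz; exact: mem_set.
Qed.

(** [is_wderiv] over an arbitrary set: the calculus is developed on products of
    two intervals, so that exchanging the two coordinates transports results
    about [x] to results about [y]. *)
Definition wdir (e : R * R) (U : set (R * R)) (f g : R * R -> R) : Prop :=
  [/\ loc_integrable2 U f, loc_integrable2 U g &
    forall phi : R * R -> R, test_function U phi ->
      \int[leb2]_(z in U) (f z * 'D_e phi z) =
      - \int[leb2]_(z in U) (g z * phi z)].

Lemma test_bounded (U : set (R * R)) phi : test_function U phi ->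
  exists M, forall z, `|phi z| <= M.
Proof.
move=> [Cphi [K [cK KU phi0]]].
have cphi : continuous phi by exact: (Cphi 0).
have : compact (phi @` K).
  apply: continuous_compact => //; exact: continuous_subspaceT.
move=> /compact_bounded [M [_ hM]].
exists (`|M| + 1) => z; have [Kz|/phi0 ->] := pselect (K z).
  apply: (hM (`|M| + 1)); last by exists z.
  by rewrite (le_lt_trans (ler_norm _))// ltrDl.
by rewrite normr0 addr_ge0.
Qed.

Lemma test_derive (U : set (R * R)) phi v : test_function U phi ->
  test_function U ('D_v phi).
Proof.
move=> tphi; split.
  by move=> n; have [] := test_derivable v n tphi.
have [_ [K [cK KU phi0]]] := tphi; exists K; split => //.
exact: (@derive_supp _ _ _ _ v (compact_closedE cK) phi0).
Qed.

Lemma test_L1 e1 e2 phi g : test_function (prod_span e1 e2) phi ->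
  loc_integrable2 (prod_span e1 e2) g ->
  leb2.-integrable setT (EFin \o (fun z => phi z * g z)).
Proof.
move=> tphi lg; have [M hM] := test_bounded tphi.
have [Cphi [K [cK KU phi0]]] := tphi.
have [n Kn] := compact_sub_obox cK KU.
apply: (locL1 (n := n) lg _ hM).
  by apply: continuous_measurable2; exact: (Cphi 0).
by move=> z nz; apply: phi0; apply: contra_not nz => /Kn /obox_cbox.
Qed.

Lemma test_out (U : set (R * R)) phi z : test_function U phi -> ~ U z -> phi z = 0.
Proof. by move=> [_ [K [_ KU phi0]]] Uz; apply: phi0; apply: contra_not Uz => /KU. Qed.

(** The same integration by parts as one integral over the plane, where sums of
    integrable functions are easy to form. *)
Lemma wdirP v e1 e2 f g : wdir v (prod_span e1 e2) f g <->
  [/\ loc_integrable2 (prod_span e1 e2) f, loc_integrable2 (prod_span e1 e2) g &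
   forall phi, test_function (prod_span e1 e2) phi ->
    \int[leb2]_z ('D_v phi z * f z + phi z * g z) = 0].
Proof.
have E phi : test_function (prod_span e1 e2) phi ->
    loc_integrable2 (prod_span e1 e2) f -> loc_integrable2 (prod_span e1 e2) g ->
    \int[leb2]_z ('D_v phi z * f z + phi z * g z) =
    \int[leb2]_(z in prod_span e1 e2) (f z * 'D_v phi z) +
    \int[leb2]_(z in prod_span e1 e2) (g z * phi z).
  move=> tphi lf lg; have tD := test_derive v tphi.
  rewrite RintegralD//; [|exact: test_L1 tD lf|exact: test_L1 tphi lg].
  congr (_ + _); rewrite (@Rintegral_supp _ (mR2 R) R leb2 (prod_span e1 e2)).
  - by apply: eq_Rintegral => z _; rewrite mulrC.
  - by move=> z Uz; rewrite (test_out tD Uz) mul0r.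
  - by apply: eq_Rintegral => z _; rewrite mulrC.
  - by move=> z Uz; rewrite (test_out tphi Uz) mul0r.
split=> -[lf lg h]; split => // phi tphi.
  by rewrite E// h// addNr.
by apply/eqP; rewrite -addr_eq0 -E// h.
Qed.

Lemma Ck_tensor (E F : normedModType R) n (b : E -> R) (c : F -> R) :
  Ck n b -> Ck n c -> Ck n (fun z : E * F => b z.1 * c z.2).
Proof.
move=> Cb Cc; apply: CkM.
  apply: (@Ck_comp _ _ _ n fst fst) => //; first by move=> z; exact: cvg_fst.
apply: (@Ck_comp _ _ _ n snd snd) => //; by move=> z; exact: cvg_snd.
Qed.

Lemma test_tensor (E F : normedModType R) (U1 : set E) (U2 : set F)
    (b : E -> R) (c : F -> R) :
  test_function U1 b -> test_function U2 c ->
  test_function (U1 `*` U2) (fun z => b z.1 * c z.2).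
Proof.
move=> [Cb [K1 [cK1 KU1 b0]]] [Cc [K2 [cK2 KU2 c0]]]; split.
  by move=> n; exact: Ck_tensor.
exists (K1 `*` K2); split; first exact: compact_setX.
  by move=> z [/KU1 ? /KU2 ?].
by move=> z /not_andP[/b0 ->|/c0 ->]; rewrite ?mul0r ?mulr0.
Qed.

Lemma is_derive_tensor (F : normedModType R) (b b' : R -> R) (c : F -> R)
    (z : R * F) : is_derive z.1 (1 : R) b (b' z.1) ->
  is_derive z ((1 : R), (0 : F)) (fun z : R * F => b z.1 * c z.2) (b' z.1 * c z.2).
Proof.
move=> [db <-].
have e : (fun h : R => h^-1 *: (((fun z : R * F => b z.1 * c z.2) \o shift z)
     (h *: ((1 : R), (0 : F))) - b z.1 * c z.2)) =
   (fun h : R => (h^-1 *: ((b \o shift z.1) (h *: 1) - b z.1)) * c z.2).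
  apply/funext => h /=; rewrite scaler0 add0r -mulrBl.
  by rewrite /GRing.scale/= mulrA.
have db' : h^-1 *: ((b \o shift z.1) (h *: 1) - b z.1) @[h --> 0^'] -->
   'D_1 b z.1 by exact: db.
have C : (h^-1 *: ((b \o shift z.1) (h *: 1) - b z.1)) * c z.2 @[h --> 0^'] -->
   'D_1 b z.1 * c z.2 by apply: cvgMl.
apply: DeriveDef; rewrite /derivable /derive e.
  by apply/cvg_ex; eexists; exact: C.
exact/cvg_lim.
Qed.

Lemma test_rbump e n m : test_function (span e) (rbump (lo e n) (hi e n) m).
Proof.
split; first by move=> k; exact: Ck_rbump.
have [p [q [lp pq qh h]]] := rbump_supp m (lo_hi e n).
exists `[p, q]%classic; split; first exact: segment_compact.
  move=> x; rewrite /= in_itv/= => /andP[px xq]; exists n => //.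
  by rewrite /oitv/= in_itv/= (lt_le_trans lp px) (le_lt_trans xq qh).
by move=> x; rewrite /= in_itv/= => /negP; exact: h.
Qed.

Lemma test_Zeta e n m : test_function (span e) (Zeta (lo e n) (hi e n) m).
Proof.
split; first by move=> k; exact: Ck_Zeta.
have [p [q [lp pq qh h]]] := Zeta_supp m (lo_hi e n).
exists `[p, q]%classic; split; first exact: segment_compact.
  move=> x; rewrite /= in_itv/= => /andP[px xq]; exists n => //.
  by rewrite /oitv/= in_itv/= (lt_le_trans lp px) (le_lt_trans xq qh).
by move=> x; rewrite /= in_itv/= => /negP; exact: h.
Qed.

End weak_derivatives.

Lemma Rintegral0 d (T : measurableType d) (R : realType)
    (mu : {measure set T -> \bar R}) (D : set T) (f : T -> R) :
  (forall x, D x -> f x = 0) -> \int[mu]_(x in D) f x = 0.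
Proof.
move=> f0; transitivity (\int[mu]_(x in D) (0 : R)).
  by apply: eq_Rintegral => x /set_mem /f0.
by rewrite /Rintegral integral0_eq.
Qed.

Lemma ae_imp d (T : measurableType d) (R : realType)
    (mu : {measure set T -> \bar R}) (P Q : T -> Prop) :
  (forall x, P x -> Q x) -> {ae mu, forall x, P x} -> {ae mu, forall x, Q x}.
Proof. by move=> h; apply: filterS. Qed.

Lemma ae_imp2 d (T : measurableType d) (R : realType)
    (mu : {measure set T -> \bar R}) (P Q S : T -> Prop) :
  (forall x, P x -> Q x -> S x) -> {ae mu, forall x, P x} ->
  {ae mu, forall x, Q x} -> {ae mu, forall x, S x}.
Proof. by move=> h; apply: filterS2. Qed.

Section weak_calculus.
Context {R : realType}.
Implicit Types (e : @exhaust R) (f g : R * R -> R) (v : R * R).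

Lemma compact_measurable2 (K : set (R * R)) : compact K ->
  measurable (K : set (mR2 R)).
Proof.
move=> cK; rewrite -(setCK K); apply: measurableC; apply: open_measurable2.
by rewrite openC; exact: compact_closedE.
Qed.

Lemma loc_int_lin (U : set (R * R)) f g c : loc_integrable2 U f ->
  loc_integrable2 U g -> loc_integrable2 U (fun z => f z + c * g z).
Proof.
move=> lf lg K cK KU; have mK := compact_measurable2 cK.
by apply: L1D; [|exact: lf|apply: L1Z => //; exact: lg].
Qed.

Lemma loc_int_mul (U : set (R * R)) f (h : R * R -> R) : continuous h ->
  loc_integrable2 U f -> loc_integrable2 U (fun z => h z * f z).
Proof.
move=> ch lf K cK KU; have mK := compact_measurable2 cK.
have : compact (h @` K).
  apply: continuous_compact => //; exact: continuous_subspaceT.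
move=> /compact_bounded [M [_ hM]].
apply: (@L1M_bdd _ (mR2 R) R leb2 K f h (`|M| + 1)) => //.
- by apply: measurable_funTS; exact: continuous_measurable2.
- move=> z Kz; apply: (hM (`|M| + 1)); last by exists z.
  by rewrite (le_lt_trans (ler_norm _))// ltrDl.
- exact: lf.
Qed.

(** Two weak derivatives have the same integrals against products of bumps, and
    these determine a function on each box. *)
Lemma wdir_uniq v e1 e2 f g1 g2 :
  wdir v (prod_span e1 e2) f g1 -> wdir v (prod_span e1 e2) f g2 ->
  {ae leb2, forall z, prod_span e1 e2 z -> g1 z = g2 z}.
Proof.
move=> /wdirP[lf lg1 h1] /wdirP[_ lg2 h2].
pose k z := g1 z + (-1) * g2 z.
have lk : loc_integrable2 (prod_span e1 e2) k by exact: loc_int_lin.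
have kn n : {ae leb2, forall z, obox e1 e2 n z -> k z = 0}.
  have mB := measurable_cbox e1 e2 n.
  have ik := (integrable_mkcond _ mB).1
    (lk _ (@compact_cbox _ e1 e2 n) (@cbox_span _ e1 e2 n)).
  rewrite restrict_EFin in ik.
  have := tensor_determining (measurable_oitv e1 n) (measurable_oitv e2 n)
    (rbump_determining (lo_hi e1 n)) (rbump_determining (lo_hi e2 n)).
  move=> [_ _ Xs /(_ _ ik) D].
  have h m : \int[leb2]_z ((k \_ (cbox e1 e2 n)) z *
      tensor (rbump (lo e1 n) (hi e1 n)) (rbump (lo e2 n) (hi e2 n)) m z) = 0.
    transitivity (\int[leb2]_z (k z *
      tensor (rbump (lo e1 n) (hi e1 n)) (rbump (lo e2 n) (hi e2 n)) m z)).
      apply: eq_Rintegral => z _; rewrite patchE; case: ifPn => // /negP nB.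
      rewrite [X in _ = _ * X]Xs ?mulr0 ?mul0r// => /obox_cbox Bz; apply: nB.
      exact: mem_set.
    rewrite /tensor; case: unpickle => [[i j]|]; last first.
      by apply: Rintegral0 => z _; rewrite mulr0.
    pose phi (z : R * R) : R :=
      rbump (lo e1 n) (hi e1 n) i z.1 * rbump (lo e2 n) (hi e2 n) j z.2.
    have tphi : test_function (prod_span e1 e2) phi.
      by apply: test_tensor; exact: test_rbump.
    have tD := test_derive v tphi.
    have iA := L1D measurableT (test_L1 tD lf) (test_L1 tphi lg1).
    have iB := L1D measurableT (test_L1 tD lf) (test_L1 tphi lg2).
    rewrite -[RHS](subrr (0 : R)) -{1}(h1 _ tphi) -(h2 _ tphi) -RintegralB//.
    by apply: eq_Rintegral => z _; rewrite /k /phi; ring.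
  have {}D := D h.
  move: D; apply: filterS => z hz Bz; have := hz Bz.
  by rewrite patchE ifT//; apply: mem_set; exact: obox_cbox.
have := ae_foralln kn; apply: filterS => z hz /span_obox[n /hz].
by rewrite /k mulN1r => /eqP; rewrite subr_eq0 => /eqP.
Qed.

Lemma wdir_lin v e1 e2 f1 g1 f2 g2 c :
  wdir v (prod_span e1 e2) f1 g1 -> wdir v (prod_span e1 e2) f2 g2 ->
  wdir v (prod_span e1 e2) (fun z => f1 z + c * f2 z) (fun z => g1 z + c * g2 z).
Proof.
move=> /wdirP[lf1 lg1 h1] /wdirP[lf2 lg2 h2]; apply/wdirP; split.
- exact: loc_int_lin.
- exact: loc_int_lin.
move=> phi tphi; have tD := test_derive v tphi.
have iA := L1D measurableT (test_L1 tD lf1) (test_L1 tphi lg1).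
have iB := L1D measurableT (test_L1 tD lf2) (test_L1 tphi lg2).
transitivity (\int[leb2]_z (('D_v phi z * f1 z + phi z * g1 z) +
    c * ('D_v phi z * f2 z + phi z * g2 z))).
  by apply: eq_Rintegral => z _; ring.
rewrite RintegralD//; last exact: L1Z.
by rewrite RintegralZl// h1// h2// mulr0 addr0.
Qed.

(** The product [h * phi] is again a test function. *)
Lemma wdir_mul v e1 e2 f g (h : R * R -> R) : (forall n, Ck n h) ->
  wdir v (prod_span e1 e2) f g ->
  wdir v (prod_span e1 e2) (fun z => h z * f z)
    (fun z => h z * g z + 1 * ('D_v h z * f z)).
Proof.
move=> Ch /wdirP[lf lg H].
have ch : continuous h := Ch 0.
have cDh : continuous ('D_v h) by have [_ /(_ v)[_ []]] := Ch 2.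
apply/wdirP; split.
- exact: loc_int_mul.
- by apply: loc_int_lin; exact: loc_int_mul.
move=> phi tphi.
have tphih : test_function (prod_span e1 e2) (fun z => h z * phi z).
  have [Cphi [K [cK KU phi0]]] := tphi; split.
    by move=> n; exact: CkM.
  by exists K; split => // z /phi0 ->; rewrite mulr0.
have := H _ tphih => <-; apply: eq_Rintegral => z _.
have -> : 'D_v (fun z => h z * phi z) z = h z * 'D_v phi z + phi z * 'D_v h z.
  rewrite -[LHS]/('D_v (h * phi) z) deriveM//.
    by have [_ /(_ v)[? _]] := Ch 1%N.
  by have [_ ?] := test_derivable v 0 tphi.
by ring.
Qed.

End weak_calculus.

Section weak_positive_part.
Context {R : realType}.
Implicit Types (e : @exhaust R) (f g : R * R -> R).

Let ex : R * R := (1, 0).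

Lemma loc_int_le (U : set (R * R)) f g : measurable_fun setT (f : mR2 R -> mR R) ->
  (forall z, `|f z| <= `|g z|) -> loc_integrable2 U g -> loc_integrable2 U f.
Proof.
move=> mf fg lg K cK KU.
apply: (@L1_le _ (mR2 R) R leb2 K f (fun z => `|g z|)) => //.
- exact: compact_measurable2.
- exact: measurable_funTS.
- by apply: L1_norm; [exact: compact_measurable2|exact: lg].
Qed.

Lemma loc_int_cst (U : set (R * R)) (c : R) : loc_integrable2 U (fun=> c).
Proof.
move=> K cK KU; apply: measurable_bounded_integrable.
- exact: compact_measurable2.
- have [M [_ hM]] := compact_bounded cK.
  pose N := `|M| + 1; pose I : set (mR R) := `[- N, N]%classic.
  have KI : K `<=` (I `*` I).
    move=> [x y] Kxy; have hN : `|(x, y)| <= N.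
      by apply: (hM N) => //; rewrite (le_lt_trans (ler_norm _))// ltrDl.
    by move: hN; rewrite prod_normE ge_max => /andP[/= hx hy]; split;
      rewrite /I /= in_itv/= -ler_norml.
  have mI : measurable I by exact: measurable_itv.
  have lI : (@lebesgue_measure R I < +oo)%E.
    by rewrite /I lebesgue_measure_itv/=; case: ifP => _; rewrite -?EFinB ltry.
  apply: (@le_lt_trans _ _ (leb2 (I `*` I))).
    apply: le_measure; rewrite ?inE//; first exact: compact_measurable2.
    exact: measurableX.
  rewrite /leb2 product_measure1E//.
  apply: lte_mul_pinfty; [exact: measure_ge0| |exact: lI].
  by rewrite ge0_fin_numE; [exact: lI|exact: measure_ge0].
- exact: measurable_cst.
- by exists `|c|; split => // x cx y _ /=; exact: ltW.
Qed.

(** On the support of a test function, [slice] makes [f] absolutely continuous on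
    almost every horizontal line with derivative [g]; there [AC_pos] gives the
    truncation, and integrating by parts line by line proves the claim. *)
Lemma wdir_pos e1 e2 f g (c : R) :
  measurable_fun setT (f : mR2 R -> mR R) -> measurable_fun setT (g : mR2 R -> mR R) ->
  wdir ex (prod_span e1 e2) f g ->
  wdir ex (prod_span e1 e2) (fun z => pos (f z - c))
    (fun z => if 0 < f z - c then g z else 0).
Proof.
move=> mf mg /wdirP[lf lg H].
have mfc : measurable_fun setT (fun z : mR2 R => f z - c) by exact: measurable_funB.
have mp : measurable_fun setT (fun z : mR2 R => pos (f z - c) : mR R).
  exact: measurableT_comp measurable_pos mfc.
have mg' : measurable_fun setT (fun z : mR2 R => (if 0 < f z - c then g z else 0) : mR R).
  apply: measurable_fun_ifT => //; exact: measurable_fun_ltr.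
have lfc : loc_integrable2 (prod_span e1 e2) (fun z => f z + (-1) * c).
  by apply: loc_int_lin => //; exact: loc_int_cst.
have lp : loc_integrable2 (prod_span e1 e2) (fun z => pos (f z - c)).
  apply: loc_int_le lfc => // z; rewrite mulN1r ger0_norm ?pos_ge0//.
  by rewrite /pos ge_max ler_norm normr_ge0.
have lg' : loc_integrable2 (prod_span e1 e2) (fun z => if 0 < f z - c then g z else 0).
  by apply: loc_int_le lg => // z; case: ifP => // _; rewrite normr0.
apply/wdirP; split => // phi tphi.
have tD := test_derive ex tphi.
have [Cphi [K [cK KU phi0]]] := tphi.
have [n Kn] := compact_sub_obox cK KU.
have phiout z : ~ obox e1 e2 n z -> phi z = 0.
  by move=> nz; apply: phi0; apply: contra_not nz; exact: Kn.
have Dphiout z : ~ obox e1 e2 n z -> 'D_ex phi z = 0.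
  move=> nz; apply: (@derive_supp _ _ _ _ ex (compact_closedE cK) phi0).
  by apply: contra_not nz; exact: Kn.
pose a := lo e1 n; pose b := hi e1 n.
have ab : a < b by exact: lo_hi.
have mB := measurable_cbox e1 e2 n.
pose f1 := f \_ (cbox e1 e2 n); pose g1 := g \_ (cbox e1 e2 n).
have if1 : leb2.-integrable setT (EFin \o f1).
  rewrite /f1 -restrict_EFin; apply: (integrable_mkcond _ mB).1.
  exact: lf (@compact_cbox _ _ _ _) (@cbox_span _ _ _ _).
have ig1 : leb2.-integrable setT (EFin \o g1).
  rewrite /g1 -restrict_EFin; apply: (integrable_mkcond _ mB).1.
  exact: lg (@compact_cbox _ _ _ _) (@cbox_span _ _ _ _).
(* Products of a [Zeta] in the first variable and a bump in the second one are
   test functions; on their support [f1] and [g1] are [f] and [g]. *)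
have HS i j : \int[leb2]_z (f1 z * (zeta a b i z.1 * rbump (lo e2 n) (hi e2 n) j z.2) +
    g1 z * (Zeta a b i z.1 * rbump (lo e2 n) (hi e2 n) j z.2)) = 0.
  pose psi (z : R * R) : R := Zeta a b i z.1 * rbump (lo e2 n) (hi e2 n) j z.2.
  have tpsi : test_function (prod_span e1 e2) psi.
    by apply: test_tensor; [exact: test_Zeta|exact: test_rbump].
  rewrite -[RHS](H _ tpsi); apply: eq_Rintegral => z _.
  have -> : 'D_ex psi z = zeta a b i z.1 * rbump (lo e2 n) (hi e2 n) j z.2.
    by have [_ ->] := is_derive_tensor (rbump (lo e2 n) (hi e2 n) j)
      (is_derive_Zeta a b i z.1).
  rewrite /f1 /g1 /psi !patchE; case: ifPn => [_|/negP nB]; first by ring.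
  have [p [q [ap pq qb hs]]] := zeta_supp i ab.
  have [p' [q' [ap' pq' qb' hS]]] := Zeta_supp i ab.
  have [p'' [q'' [ap'' pq'' qb'' hX]]] := rbump_supp j (lo_hi e2 n).
  have : ~ citv e1 n z.1 \/ ~ citv e2 n z.2.
    by apply/not_andP => B; apply: nB; exact: mem_set.
  move=> [nB1|nB2].
    rewrite hs ?hS; first by ring.
    - apply: contra_notN nB1 => /andP[h1 h2]; rewrite /citv/= in_itv/= -/a -/b.
      by apply/andP; split; lra.
    - apply: contra_notN nB1 => /andP[h1 h2]; rewrite /citv/= in_itv/= -/a -/b.
      by apply/andP; split; lra.
  rewrite hX; first by ring.
  apply: contra_notN nB2 => /andP[h1 h2]; rewrite /citv/= in_itv/=.
  by apply/andP; split; lra.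
have [C aeC] := slice ab (measurable_oitv e2 n) (rbump_determining (lo_hi e2 n))
  if1 ig1 HS.
pose h z := 'D_ex phi z * pos (f z - c) + phi z * (if 0 < f z - c then g z else 0).
have ih : leb2.-integrable setT (EFin \o h).
  by apply: L1D => //; [exact: test_L1 tD lp|exact: test_L1 tphi lg'].
rewrite -/h (Rfubini2 ih).
transitivity (\int[leb1]_(y in setT) (0 : R)); last exact: Rintegral0.
apply: ae_eq_Rintegral => //; first exact: L1_meas (L1_Rint2 ih).
have := ae_prod2 aeC; have := ae_integrable2 ig1.
have := ae_integrable2 ih.
apply: filterS3 => y ihy ig1y aey _.
have [Ey|nEy] := pselect (oitv e2 n y); last first.
  apply: Rintegral0 => x _.
  by rewrite /h phiout ?Dphiout ?mul0r ?addr0// => -[].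
pose F x := C y + prim a (fun r => g1 (r, y)) x.
have AF : abscont a b F (fun r => g1 (r, y)).
  split; first by apply: integrableS ig1y.
  by move=> s _; rewrite /F prim_aa addr0.
have AP := AC_pos (ltW ab) (AC_addc (- c) AF).
(* Integration by parts on the line at height [y]. *)
have Aphi : abscont a b (fun x => phi (x, y)) (fun x => 'D_ex phi (x, y)).
  apply: AC_C1 => //.
    move=> x.
    have := @is_derive_affine R R (R * R)%type (fun x => (x, y)) (fun v => (v, 0))
      phi 1 x _ _.
    apply; last by have [_ /(_ (x, y))] := test_derivable ex 0 tphi.
    by move=> k w t /=; congr pair; rewrite /= scaler0 add0r.
  have [cD _] := test_derivable ex 0 tphi.
  move=> x; apply: (@continuous_comp _ _ _ (fun x => (x, y)) ('D_ex phi)).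
    apply: (@cvg_pair _ _ _ _ (nbhs x) (nbhs y) _ _ _ id (fun=> y)).
      exact: cvg_id.
    exact: cvg_cst.
  exact: (@Ck_continuous _ _ 0 _ cD).
have phib x : ~ oitv e1 n x -> phi (x, y) = 0 by move=> nx; apply: phiout => -[].
have := AC_int0 (ltW ab) (AC_mul (ltW ab) Aphi AP).
rewrite !phib ?mul0r; last 2 first.
- by rewrite /oitv /= in_itv/= -/b ltxx andbF.
- by rewrite /oitv /= in_itv/= -/a ltxx.
move=> /(_ erefl erefl) e0; rewrite -[RHS]e0.
rewrite (@Rintegral_supp _ (mR R) R leb1 `[a, b]%classic); last first.
  move=> x nx; rewrite /h phiout ?Dphiout ?mul0r ?addr0//.
    by move=> [/oitv_citv].
  by move=> [/oitv_citv].
apply: ae_eq_Rintegral => //.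
- exact: measurable_funTS (L1_meas ihy).
- have [i0 _] := AC_mul (ltW ab) Aphi AP; exact: L1_meas i0.
have ab0 : {ae leb1, forall x, x != a /\ x != b}.
  have h0 (p : R) : {ae leb1, forall x : mR R, x != p}.
    exists [set p]; split => //; first exact: lebesgue_measure_set1.
    by move=> x /= /negP; rewrite negbK => /eqP.
  by have := h0 a; have := h0 b; apply: filterS2 => x.
apply: (@ae_imp2 _ (mR R) R leb1 _ _ _ _ ab0 aey) => x [xa xb] ex' xab.
have xab' : a < x < b.
  move: xab; rewrite /= in_itv/= => /andP[h1 h2].
  by rewrite !lt_neqAle h1 h2 eq_sym xa xb.
have Bx : (x, y) \in cbox e1 e2 n.
  by apply: mem_set; apply: obox_cbox; split => //; rewrite /oitv/= in_itv.
have := ex' xab' Ey; rewrite /= /f1 patchE Bx -/(F x) => fF.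
by rewrite /h fF /g1 patchE Bx.
Qed.

End weak_positive_part.

(** * Weak derivatives on the half-plane *)

Section swap.
Context {R : realType}.
Implicit Types (e : @exhaust R) (f g : R * R -> R).

Definition flip (z : R * R) : R * R := (z.2, z.1).

Lemma measurable_swap : measurable_fun setT (flip : mR2 R -> mR2 R).
Proof. by apply/measurable_fun_pairP; split; [exact: measurable_snd|exact: measurable_fst]. Qed.

Lemma L1_swap f : leb2.-integrable setT (EFin \o f) ->
  leb2.-integrable setT (EFin \o (f \o flip)).
Proof.
move=> if_; have mf : measurable_fun setT (EFin \o f : mR2 R -> _) := measurable_int _ if_.
have mfs : measurable_fun setT (EFin \o (f \o flip) : mR2 R -> _).
  exact: (measurableT_comp mf measurable_swap).
apply/(integrable12ltyP leb1 leb1 mfs).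
exact: ((integrable21ltyP leb1 leb1 mf).1 if_).
Qed.

Lemma Rintegral_swap f : leb2.-integrable setT (EFin \o f) ->
  \int[leb2]_z f (flip z) = \int[leb2]_z f z.
Proof.
by move=> if_; rewrite (Rfubini1 (L1_swap if_)) (Rfubini2 if_).
Qed.

Lemma continuous_swap : continuous flip.
Proof.
move=> z; apply: (@cvg_pair _ _ _ (nbhs z) (nbhs z.2) (nbhs z.1) _ _ _ snd fst).
  exact: cvg_snd.
exact: cvg_fst.
Qed.

Lemma test_swap e1 e2 phi : test_function (prod_span e1 e2) phi ->
  test_function (prod_span e2 e1) (phi \o flip).
Proof.
move=> [Cphi [K [cK KU phi0]]]; split.
  move=> n; apply: (@Ck_comp _ _ _ n flip flip) => //.
  exact: continuous_swap.
exists (flip @` K); split.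
- apply: continuous_compact => //; apply: continuous_subspaceT.
  exact: continuous_swap.
- by move=> _ [[x y] /KU[h1 h2] <-]; split.
- move=> [x y] nK; apply: phi0 => Kz; apply: nK.
  by exists (y, x).
Qed.

Lemma loc_int_swap e1 e2 f : loc_integrable2 (prod_span e1 e2) f ->
  loc_integrable2 (prod_span e2 e1) (f \o flip).
Proof.
move=> lf K cK KU.
have cK' : compact (flip @` K).
  apply: continuous_compact => //; apply: continuous_subspaceT.
  exact: continuous_swap.
have KU' : flip @` K `<=` prod_span e1 e2.
  by move=> _ [[x y] /KU[h1 h2] <-]; split.
have := (integrable_mkcond _ (compact_measurable2 cK')).1 (lf _ cK' KU').
rewrite restrict_EFin => /L1_swap h.
apply: (integrable_mkcond _ (compact_measurable2 cK)).2.
rewrite restrict_EFin (_ : (f \o flip) \_ K = (f \_ (flip @` K)) \o flip)//.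
apply/funext => -[x y]; rewrite /= !patchE.
case: ifPn => [/set_mem Kz|/negP nK].
  by rewrite ifT//; apply: mem_set; exists (x, y).
rewrite ifF//; apply/negP => /set_mem[[x' y'] Kz [ey ex]]; apply: nK.
by apply: mem_set; rewrite -ex -ey.
Qed.

Lemma derive_swap (phi : R * R -> R) (v : R * R) z :
  'D_v (phi \o flip) z = 'D_(flip v) phi (flip z).
Proof.
rewrite /derive; congr (lim _); congr (_ @ _).
Qed.

Lemma wdir_swap v e1 e2 f g : wdir v (prod_span e1 e2) f g ->
  wdir (flip v) (prod_span e2 e1) (f \o flip) (g \o flip).
Proof.
move=> /wdirP[lf lg h]; apply/wdirP; split; [exact: loc_int_swap..|].
move=> phi tphi; have tphis := test_swap tphi.
have tD := test_derive v tphis.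
rewrite -[RHS](h _ tphis).
rewrite -[RHS]Rintegral_swap.
  apply: eq_Rintegral => -[x y] _.
  by rewrite derive_swap.
by apply: L1D => //; [exact: test_L1 tD lf|exact: test_L1 tphis lg].
Qed.

End swap.

Section halfplane.
Context {R : realType}.
Implicit Types (f g : R * R -> R).

(** The line and the half-line as exhausted intervals; their product is the
    half-plane. *)
Definition line_lo n : R := - n.+1%:R.
Definition line_hi n : R := n.+1%:R.
Definition halfline_lo n : R := n.+1%:R^-1.
Definition halfline_hi n : R := n.+2%:R.

Fact line1 n : line_lo n < line_hi n.
Proof. by rewrite /line_lo /line_hi (@lt_trans _ _ 0) ?oppr_lt0 ?ltr0n. Qed.
Fact line2 n : line_lo n.+1 < line_lo n.
Proof. by rewrite /line_lo ltrN2 ltr_nat. Qed.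
Fact line3 n : line_hi n < line_hi n.+1.
Proof. by rewrite /line_hi ltr_nat. Qed.
Definition line := Exhaust line1 line2 line3.

Fact halfline1 n : halfline_lo n < halfline_hi n.
Proof.
rewrite /halfline_lo /halfline_hi (@le_lt_trans _ _ 1)//.
  by rewrite invf_le1 ?ler1n.
by rewrite ltr1n.
Qed.
Fact halfline2 n : halfline_lo n.+1 < halfline_lo n.
Proof. by rewrite /halfline_lo ltf_pV2 ?posrE// ltr_nat. Qed.
Fact halfline3 n : halfline_hi n < halfline_hi n.+1.
Proof. by rewrite /halfline_hi ltr_nat. Qed.
Definition halfline := Exhaust halfline1 halfline2 halfline3.

Lemma span_line : span line = setT.
Proof.
apply/seteqP; split => // x _.
have := archi_boundP (normr_ge0 x); set n := Num.bound _ => xn.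
exists n => //; rewrite /oitv/= in_itv/= /line_lo /line_hi.
rewrite -ltr_norml; apply: lt_trans xn _; by rewrite ltr_nat.
Qed.

Lemma span_halfline : span halfline = [set x | 0 < x].
Proof.
apply/seteqP; split => [x [n _]|x /= x0].
  rewrite /oitv/= in_itv/= => /andP[+ _]; apply: lt_trans.
  by rewrite /halfline_lo invr_gt0.
have xV0 : 0 <= x^-1 by rewrite invr_ge0 ltW.
have := archi_boundP (ltW x0); set n := Num.bound x => xn.
have := archi_boundP xV0; set m := Num.bound x^-1 => xm.
exists (maxn m n) => //; rewrite /oitv/= in_itv/= /halfline_lo /halfline_hi.
apply/andP; split.
  rewrite -[x]invrK ltf_pV2 ?posrE ?invr_gt0//; apply: lt_le_trans xm _.
  by rewrite ler_nat (leq_trans (leq_maxl m n)).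
apply: lt_le_trans xn _; rewrite ler_nat.
by rewrite (leq_trans (leq_maxr m n))// -addn2 leq_addr.
Qed.

Lemma halfplane_span : halfplane = prod_span line halfline.
Proof.
rewrite /prod_span span_line span_halfline.
by apply/seteqP; split => -[x y] // [].
Qed.

Lemma wderivE v f g : is_wderiv v f g = wdir v (prod_span line halfline) f g.
Proof. by rewrite -halfplane_span. Qed.

Lemma wderiv_uniq v f g1 g2 : is_wderiv v f g1 -> is_wderiv v f g2 ->
  {ae leb2, forall z, halfplane z -> g1 z = g2 z}.
Proof. by rewrite !wderivE halfplane_span; exact: wdir_uniq. Qed.

Lemma wderiv_lin v f1 g1 f2 g2 c : is_wderiv v f1 g1 -> is_wderiv v f2 g2 ->
  is_wderiv v (fun z => f1 z + c * f2 z) (fun z => g1 z + c * g2 z).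
Proof. by rewrite !wderivE; exact: wdir_lin. Qed.

Lemma wderiv_mul v f g (h : R * R -> R) : (forall n, Ck n h) ->
  is_wderiv v f g ->
  is_wderiv v (fun z => h z * f z) (fun z => h z * g z + 1 * ('D_v h z * f z)).
Proof. by rewrite !wderivE; exact: wdir_mul. Qed.

Lemma wderiv_pos_x f g c :
  measurable_fun setT (f : mR2 R -> mR R) -> measurable_fun setT (g : mR2 R -> mR R) ->
  is_wderiv e_x f g ->
  is_wderiv e_x (fun z => pos (f z - c)) (fun z => if 0 < f z - c then g z else 0).
Proof. by rewrite !wderivE; exact: wdir_pos. Qed.

Lemma wderiv_pos_y f g c :
  measurable_fun setT (f : mR2 R -> mR R) -> measurable_fun setT (g : mR2 R -> mR R) ->
  is_wderiv e_y f g ->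
  is_wderiv e_y (fun z => pos (f z - c)) (fun z => if 0 < f z - c then g z else 0).
Proof.
move=> mf mg; rewrite !wderivE => /wdir_swap h.
have := wdir_pos c (measurableT_comp mf measurable_swap)
  (measurableT_comp mg measurable_swap) h.
move=> /wdir_swap.
rewrite (_ : _ \o flip = (fun z => pos (f z - c))); last by apply/funext => -[].
by rewrite (_ : _ \o flip = (fun z => if 0 < f z - c then g z else 0)); last by apply/funext => -[].
Qed.

End halfplane.

(** * Absolute continuity in time *)

Section time_derivative.
Context {R : realType}.
Implicit Types (u du : R -> R * R -> R).

Local Notation hbox := (obox (@line R) halfline).
Local Notation hcbox := (cbox (@line R) halfline).

Lemma loc_int_measurable (g : R * R -> R) : loc_integrable2 halfplane g ->
  measurable_fun (halfplane : set (mR2 R)) (g : mR2 R -> mR R).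
Proof.
move=> lg; have -> : halfplane = \bigcup_n hcbox n.
  apply/seteqP; split => z.
    by rewrite halfplane_span => /span_obox[n /obox_cbox]; exists n.
  by move=> [n _ /cbox_span]; rewrite halfplane_span.
apply/measurable_fun_bigcup; first by move=> n; exact: measurable_cbox.
move=> n; have /(_ (@compact_cbox _ _ _ n)) := lg (hcbox n).
rewrite halfplane_span => /(_ (@cbox_span _ _ _ n)) h.
exact: L1_meas h.
Qed.

(** [slice] is applied on each box of an exhaustion of the half-plane; the
    constant at a point is taken from a chosen box that contains it. *)
Lemma time_repr (T a b : R) u du : 0 < a -> a < b -> b < T ->
  joint_measurable u -> joint_measurable du -> is_wderiv_t T u du ->
  (exists C : R * R -> R, {ae (leb1 \x leb2)%E, forall p : R * (R * R),
     a < p.1 < b -> halfplane p.2 ->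
     u p.1 p.2 = C p.2 + prim a (fun r => du r p.2) p.1}) /\
  {ae leb2, forall z, halfplane z ->
     leb1.-integrable `[a, b] (EFin \o (fun r => du r z))}.
Proof.
move=> a0 ab bT mu mdu [lu ldu H].
pose K n : set (mR3 R) := `[a, b]%classic `*` hcbox n.
have mK n : measurable (K n).
  by apply: measurableX; [exact: measurable_itv|exact: measurable_cbox].
have KU n : K n `<=` open_cylinder T.
  move=> [t z] [/=]; rewrite in_itv/= => /andP[at_ tb] /cbox_span.
  by rewrite -halfplane_span => hz; split => //=; rewrite in_itv/=; apply/andP; split; lra.
have cK n : compact (K n : set (R * (R * R))).
  by apply: compact_setX; [exact: segment_compact|exact: compact_cbox].
pose restr v n := (fun p : R * (R * R) => v p.1 p.2 : R) \_ (K n).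
have iu n : leb3.-integrable setT (EFin \o restr u n).
  rewrite /restr -restrict_EFin; apply: (integrable_mkcond _ (mK n)).1.
  exact: lu (cK n) (KU n).
have idu n : leb3.-integrable setT (EFin \o restr du n).
  rewrite /restr -restrict_EFin; apply: (integrable_mkcond _ (mK n)).1.
  exact: ldu (cK n) (KU n).
have mbox n : measurable (hbox n : set (mR2 R)).
  by apply: measurableX; exact: measurable_itv.
pose X n := tensor (rbump (lo (@line R) n) (hi line n))
   (rbump (lo (@halfline R) n) (hi halfline n)).
have dX n : determining leb2 (hbox n) (X n).
  exact: tensor_determining (measurable_oitv line n) (measurable_oitv halfline n)
    (rbump_determining (lo_hi line n)) (rbump_determining (lo_hi halfline n)).
have HS n i m : \int[(leb1 \x leb2)%E]_p (restr u n p * (zeta a b i p.1 * X n m p.2) +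
    restr du n p * (Zeta a b i p.1 * X n m p.2)) = 0.
  have [mX X01 Xs _] := dX n.
  have [p [q [ap pq qb hs]]] := zeta_supp i ab.
  have [p' [q' [ap' pq' qb' hS]]] := Zeta_supp i ab.
  have tX : test_function halfplane (X n m).
    rewrite /X /tensor; case: unpickle => [[k l]|].
      by rewrite halfplane_span; apply: test_tensor; exact: test_rbump.
    by split; [move=> j; exact: Ck_cst|exists set0; split => //; exact: compact0].
  have tZ : test_function (`]0, T[%classic : set R) (Zeta a b i).
    split; first by move=> k; exact: Ck_Zeta.
    exists `[p', q']%classic; split; first exact: segment_compact.
      by move=> x; rewrite /= !in_itv/= => /andP[h1 h2]; apply/andP; split; lra.
    by move=> x; rewrite /= in_itv/= => /negP; exact: hS.
  have := H _ (test_tensor tZ tX).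
  have D p0 : 'D_e_t (fun z : R * (R * R) => Zeta a b i z.1 * X n m z.2) p0 =
      zeta a b i p0.1 * X n m p0.2.
    by have [_ ->] := is_derive_tensor (X n m) (is_derive_Zeta a b i p0.1).
  have out1 (w : R * (R * R)) : ~ K n w -> zeta a b i w.1 * X n m w.2 = 0.
    move=> /not_andP[n1|n2].
      rewrite hs ?mul0r//; apply: contra_notN n1 => /andP[h1 h2].
      by rewrite /= in_itv/=; apply/andP; split; lra.
    by rewrite (Xs m w.2) ?mulr0// => /obox_cbox.
  have out2 (w : R * (R * R)) : ~ K n w -> Zeta a b i w.1 * X n m w.2 = 0.
    move=> /not_andP[n1|n2].
      rewrite hS ?mul0r//; apply: contra_notN n1 => /andP[h1 h2].
      by rewrite /= in_itv/=; apply/andP; split; lra.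
    by rewrite (Xs m w.2) ?mulr0// => /obox_cbox.
  have E (v : R -> R * R -> R) (psi : R * (R * R) -> R) :
      (forall w, ~ K n w -> psi w = 0) ->
      \int[leb3]_(w in open_cylinder T) (v w.1 w.2 * psi w) =
      \int[leb3]_w (psi w * restr v n w).
    move=> po; rewrite [RHS](@Rintegral_supp _ (mR3 R) R leb3 (open_cylinder T)).
      apply: eq_Rintegral => w _; rewrite /restr patchE mulrC.
      by case: ifPn => // /negP nw; rewrite po ?mul0r// => /mem_set.
    by move=> w nw; rewrite po ?mul0r// => /KU.
  under eq_Rintegral do rewrite D.
  rewrite (E u _ out1) (E du _ out2) => /eqP; rewrite -addr_eq0 => /eqP h.
  rewrite -[RHS]h -RintegralD//.
  - by apply: eq_Rintegral => w _; ring.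
  - apply: (@L1M_bdd _ (mR3 R) R leb3 setT (restr u n)
      (fun w => zeta a b i w.1 * X n m w.2) (1 + `|zeta_coef a b i|)) => //.
      apply: measurable_funM.
        exact: measurableT_comp (measurable_zeta a b i) measurable_fst.
      exact: measurableT_comp (mX m) measurable_snd.
    move=> w _; rewrite normrM -[leRHS]mulr1 ler_pM//; first exact: zeta_le.
    by have /andP[? ?] := X01 m w.2; rewrite ger0_norm.
  - apply: (@L1M_bdd _ (mR3 R) R leb3 setT (restr du n)
      (fun w => Zeta a b i w.1 * X n m w.2) (\int[leb1]_r `|zeta a b i r|)) => //.
      apply: measurable_funM.
        exact: measurableT_comp (measurable_Zeta a b i) measurable_fst.
      exact: measurableT_comp (mX m) measurable_snd.
    move=> w _; rewrite normrM -[leRHS]mulr1 ler_pM//; first exact: Zeta_le.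
    by have /andP[? ?] := X01 m w.2; rewrite ger0_norm.
have /choice[C HC] n := slice ab (mbox n) (dX n) (iu n) (idu n) (HS n).
(* [N z] selects one box containing [z], and with it one constant. *)
have /choice[N HN] (z : R * R) : exists n, halfplane z -> hbox n z.
  have [hz|hz] := pselect (halfplane z); last by exists 0%N.
  by move: hz; rewrite halfplane_span => /span_obox[n hn]; exists n.
split.
  exists (fun z => C (N z) z).
  apply: (@ae_imp _ (mR3 R) R (leb1 \x leb2)%E _ _ _ (ae_foralln HC)).
  move=> [t z] h /= tab hz; have Bz := HN z hz.
  have /= := h (N z) tab Bz.
  have Kr r : a <= r <= b -> (r, z) \in K (N z).
    move=> rab; apply: mem_set; split; first by rewrite /= in_itv.
    exact: obox_cbox.
  rewrite /restr patchE Kr; last by case/andP: tab => /ltW -> /ltW ->.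
  move=> ->; congr (_ + _); apply: eq_Rintegral => r; rewrite inE/= in_itv/=.
  move=> /andP[ar rt]; rewrite /= patchE Kr//= ar (le_trans rt)//.
  by case/andP: tab => _ /ltW.
have := ae_foralln (fun n => ae_integrable2 (idu n)).
apply: (@ae_imp _ (mR2 R) R leb2) => z h hz.
have := h (N z); have Bz := HN z hz.
move=> hh; have {}hh : leb1.-integrable `[a, b] (EFin \o (fun r => restr du (N z) (r, z))).
  by apply: integrableS hh.
apply: eq_integrable hh => // r; rewrite inE/= in_itv/= => rab.
rewrite /= /restr patchE mem_set//; split; first by rewrite /= in_itv.
exact: obox_cbox.
Qed.

End time_derivative.

(** * The weighted measure *)

Section weighted_measure_facts.
Context {R : realType}.
Variables (kappa theta sigma gamma mu : R).
Local Notation m := (wmeas kappa theta sigma gamma mu).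
Local Notation wgt := (weight kappa theta sigma gamma mu).

(** The weight need not be bounded, for example near the boundary when
    [2 kappa theta < sigma ^ 2], so the pieces of [leb2] are cut by its sublevel
    sets. *)
Lemma wmeas_sigma_finite : sigma_finite setT m.
Proof.
have [F FT Foo] := @leb2_sigma_finite R.
pose W k := [set z | wgt z <= k%:R].
have mW k : measurable (W k : set (mR2 R)).
  rewrite (_ : W k = wgt @^-1` `]-oo, k%:R]).
    rewrite -[X in measurable X]setTI; apply: measurable_weight => //.
  by apply/seteqP; split => z; rewrite /W /= in_itv.
pose G n : set (mR2 R) :=
  if unpickle n is Some (i, k) then F i `&` W k else set0.
exists G.
  apply/seteqP; split => // z _.
  have : setT z by []. rewrite FT => -[i _ Fz].
  have := archi_boundP (weight_ge0 kappa theta sigma gamma mu z).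
  set k := Num.bound _ => zk.
  exists (pickle (i, k)); first exact: Logic.I.
  by rewrite /G pickleK; split => //; rewrite /W/= ltW.
move=> n; rewrite /G; case: unpickle => [[i k]|]; last by rewrite measure0.
have [mFi Fioo] := Foo i; split; first exact: measurableI.
have mI : measurable ((F i `&` W k) `&` halfplane : set (mR2 R)).
  by apply: measurableI; [exact: measurableI|exact: measurable_halfplane].
rewrite /wmeas /=.
apply: (@le_lt_trans _ _ (\int[leb2]_(z in (F i `&` W k) `&` halfplane) (k%:R)%:E)%E).
  apply: ge0_le_integral => //.
  - by move=> z _; rewrite lee_fin weight_ge0.
  - by apply/measurable_EFinP; apply: measurable_funTS; exact: measurable_weight.
  - by move=> z [[_ Wz] _]; rewrite lee_fin.
rewrite integral_cst//.
have h : (leb2 ((F i `&` W k) `&` halfplane) < +oo)%E.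
  apply: le_lt_trans Fioo; apply: le_measure; rewrite ?inE//.
  by move=> z [[]].
apply: lte_mul_pinfty => //.
Qed.

HB.instance Definition _ := Measure_isSigmaFinite.Build _ _ _ m wmeas_sigma_finite.

Lemma weight_gt0 z : halfplane z -> 0 < wgt z.
Proof. by move=> hz; rewrite mulr_gt0 ?expR_gt0// powR_gt0. Qed.

(** The weight is positive on the half-plane, so the two notions of almost
    everywhere agree there. *)
Lemma wmeas_null (N : set (mR2 R)) : measurable N ->
  m N = 0%E <-> leb2 (N `&` halfplane) = 0%E.
Proof.
move=> mN; have mNH : measurable (N `&` halfplane : set (mR2 R)).
  by apply: measurableI => //; exact: measurable_halfplane.
have mw : measurable_fun (N `&` halfplane) (EFin \o wgt : mR2 R -> _).
  by apply/measurable_EFinP; apply: measurable_funTS; exact: measurable_weight.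
split=> h; last by rewrite /wmeas; exact: null_set_integral.
have : (\int[leb2]_(z in N `&` halfplane) `|(EFin \o wgt) z| = 0)%E.
  by rewrite -[RHS]h; apply: eq_integral => z _; rewrite gee0_abs// lee_fin weight_ge0.
move=> /(ae_eq_integral_abs leb2 mNH mw) [N' [mN' N'0 sN]].
apply/eqP; rewrite -measure_le0 -N'0; apply: le_measure; rewrite ?inE//.
move=> z [Nz hz]; apply: sN => /= /(_ (conj Nz hz)) [] /eqP.
by rewrite gt_eqF// weight_gt0.
Qed.

Lemma ae_wmeas (P : R * R -> Prop) :
  {ae leb2, forall z, halfplane z -> P z} -> {ae m, forall z, halfplane z -> P z}.
Proof.
move=> [N [mN N0 sN]]; exists N; split => //; apply/wmeas_null => //.
apply/eqP; rewrite -measure_le0 -N0; apply: le_measure; rewrite ?inE//.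
by apply: measurableI => //; exact: measurable_halfplane.
Qed.

Lemma wmeas_ae (P : R * R -> Prop) :
  {ae m, forall z, halfplane z -> P z} -> {ae leb2, forall z, halfplane z -> P z}.
Proof.
move=> [N [mN /(wmeas_null mN) N0 sN]]; exists (N `&` halfplane); split => //.
  by apply: measurableI => //; exact: measurable_halfplane.
by move=> z /= /not_implyP[hz nP]; split => //; apply: sN => /= /(_ hz).
Qed.

End weighted_measure_facts.

(** * The damped energy *)

Section energy.
Context {R : realType}.
Implicit Types (u du : R -> R * R -> R) (z : R * R).

Lemma AC_sub (a b t s : R) (F g : R -> R) : abscont a b F g ->
  a <= t -> t <= s -> s <= b -> abscont t s F g.
Proof.
move=> Fg at_ ts sb; have [ig _] := Fg; split.
  apply: integrableS ig => // x /=; rewrite !in_itv/= => /andP[h1 h2].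
  by rewrite (le_trans at_ h1) (le_trans h2 sb).
move=> r /andP[tr rs].
have rb := le_trans rs sb.
rewrite /prim -Rintegral_itv_obnd_cbnd; last exact: AC_intS Fg at_ rb.
rewrite -(AC_diff Fg at_ tr rb); ring.
Qed.

Lemma ae_Rintegral_ge0 d (T : measurableType d) (mu : {measure set T -> \bar R})
    (D : set T) (f : T -> R) : measurable D -> measurable_fun D f ->
  {ae mu, forall x, D x -> 0 <= f x} -> 0 <= \int[mu]_(x in D) f x.
Proof.
move=> mD mf h; rewrite (@ae_eq_Rintegral _ _ _ mu D f (fun x => `|f x|)) //.
- exact: Rintegral_ge0.
- exact: measurableT_comp.
- by apply: filterS h => x h Dx; rewrite ger0_norm// h.
Qed.

Lemma in_timeset (T t : R) : 0 <= t -> t <= T -> timeset T t.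
Proof. by rewrite /timeset /= in_itv /= => -> ->. Qed.

(** The modulus keeps the factor bounded by 1 for all times, so that the damped
    truncation is an admissible test function on the whole of [0, T]; only times
    before [S] matter for the energy. *)
Definition damp (lam S t : R) z : R := expR (- (lam * (`|S - t| * z.2))).

Lemma damp_gt0 lam S t z : 0 < damp lam S t z.
Proof. exact: expR_gt0. Qed.

Lemma damp_le1 lam S t z : 0 <= lam -> halfplane z -> damp lam S t z <= 1.
Proof.
move=> l0 hz; rewrite expR_le1 oppr_le0 mulr_ge0// mulr_ge0//.
exact: ltW.
Qed.

Lemma measurable_damp lam S :
  measurable_fun setT (fun p : mR3 R => damp lam S p.1 p.2 : mR R).
Proof.
apply: measurableT_comp => //; apply: measurableT_comp => //.
apply: measurable_funM => //; apply: measurable_funM.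
  apply: measurableT_comp => //; apply: measurable_funB => //.
exact: measurableT_comp measurable_snd measurable_snd.
Qed.

Lemma measurable_slice1 (f : R * (R * R) -> R) t :
  measurable_fun setT (f : mR3 R -> mR R) ->
  measurable_fun setT (fun z : mR2 R => f (t, z) : mR R).
Proof. by move=> mf; exact: measurableT_comp mf (measurable_pair1 t). Qed.

Lemma measurable_slice2 (f : R * (R * R) -> R) z :
  measurable_fun setT (f : mR3 R -> mR R) ->
  measurable_fun setT (fun t : mR R => f (t, z) : mR R).
Proof. by move=> mf; exact: measurableT_comp mf (measurable_pair2 z). Qed.

Variables (kappa theta sigma gamma mu : R).
Local Notation m := (wmeas kappa theta sigma gamma mu).
Local Notation lm := (leb1 \x m)%E.

(** The time derivative, for [t < S], of [pos (d - c) ^ 2 * damp]. *)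
Definition energy_rate lam S c (d dd : R -> R * R -> R) t z : R :=
  2 * pos (d t z - c) * dd t z * damp lam S t z +
  pos (d t z - c) ^+ 2 * (lam * z.2 * damp lam S t z).

Lemma measurable_wpos c d : joint_measurable d ->
  measurable_fun setT (fun p : mR3 R => pos (d p.1 p.2 - c) : mR R).
Proof.
by move=> md; apply: measurableT_comp measurable_pos _; exact: measurable_funB.
Qed.

Lemma measurable_y : measurable_fun setT (fun p : mR3 R => p.2.2 : mR R).
Proof. exact: measurableT_comp measurable_snd measurable_snd. Qed.

Lemma measurable_rate lam S c d dd : joint_measurable d -> joint_measurable dd ->
  measurable_fun setT (fun p : mR3 R => energy_rate lam S c d dd p.1 p.2 : mR R).
Proof.
move=> md mdd; have mw := measurable_wpos c md; have mD := measurable_damp lam S.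
have my := measurable_y.
apply: measurable_funD.
  by apply: measurable_funM => //; apply: measurable_funM => //; exact: measurable_funM.
apply: measurable_funM; first exact: measurable_funX.
by apply: measurable_funM => //; exact: measurable_funM.
Qed.

(** The right-hand side is integrable in time and space as soon as [d] takes
    values in [V] and [dd] in [H]; this is what permits Fubini's theorem. *)
Lemma rate_le lam S c d dd t z : 0 <= lam -> 0 <= c -> halfplane z ->
  `|energy_rate lam S c d dd t z| <=
  (1 + lam) * ((1 + z.2) * d t z ^+ 2) + dd t z ^+ 2.
Proof.
move=> l0 c0 hz; have y0 : 0 < z.2 by [].
have e0 := damp_gt0 lam S t z; have e1 := damp_le1 S t l0 hz.
rewrite /energy_rate; set w := pos _; set D := damp _ _ _ _ in e0 e1 *.
have w0 : 0 <= w by exact: pos_ge0.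
have w2 : w ^+ 2 <= d t z ^+ 2 := sqr_pos_sub_le (d t z) c0.
have ww0 : 0 <= w ^+ 2 by exact: sqr_ge0.
apply: le_trans (ler_normD _ _) _.
have h1 : `|2 * w * dd t z * D| <= w ^+ 2 + dd t z ^+ 2.
  rewrite normrM (ger0_norm (ltW e0)).
  apply: (@le_trans _ _ `|2 * w * dd t z|); first by rewrite ler_piMr.
  rewrite ler_norml; apply/andP; split.
    by have := sqr_ge0 (w + dd t z); nra.
  by have := sqr_ge0 (w - dd t z); nra.
have h2 : `|w ^+ 2 * (lam * z.2 * D)| <= lam * (z.2 * w ^+ 2).
  have ly : 0 <= lam * z.2 by rewrite mulr_ge0// ltW.
  rewrite ger0_norm; last by rewrite mulr_ge0// mulr_ge0// ltW.
  rewrite (_ : lam * (z.2 * w ^+ 2) = w ^+ 2 * (lam * z.2)); last by ring.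
  by rewrite ler_wpM2l// ler_piMr.
have h3 : lam * (z.2 * w ^+ 2) <= lam * (z.2 * d t z ^+ 2).
  by rewrite ler_wpM2l// ler_wpM2l// ltW.
have h4 : 0 <= z.2 * d t z ^+ 2 by rewrite mulr_ge0 ?sqr_ge0// ltW.
have h5 : 0 <= lam * d t z ^+ 2 by rewrite mulr_ge0 ?sqr_ge0.
lra.
Qed.

Lemma L1_restrict d (T : measurableType d) (nu : {measure set T -> \bar R})
    (D : set T) (f : T -> R) : measurable D ->
  nu.-integrable D (EFin \o f) -> nu.-integrable setT (EFin \o (f \_ D)).
Proof.
by move=> mD h; rewrite -restrict_EFin; apply: (integrable_mkcond _ mD).1.
Qed.

(** For almost every [z] the function [d - c] is absolutely continuous in time, so
    [pos (d - c) ^ 2 * damp] is the integral of its rate; integrating over [z]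
    and exchanging the integrals gives the increment of the energy as the
    integral of a nonnegative function of time.  Values at single times are
    meaningful only outside a null set, described by [G]. *)
Lemma energy_mono (T a b S lam c : R) (u1 u2 du1 du2 : R -> R * R -> R) :
  let d t z := u1 t z - u2 t z in let dd t z := du1 t z - du2 t z in
  let w t z := pos (d t z - c) in
  0 < a -> a < b -> b < T -> b <= S -> 0 <= lam -> 0 <= c ->
  joint_measurable u1 -> joint_measurable u2 ->
  joint_measurable du1 -> joint_measurable du2 ->
  is_wderiv_t T u1 du1 -> is_wderiv_t T u2 du2 ->
  lm.-integrable (cylinder T)
    (EFin \o (fun p => (1 + p.2.2) * d p.1 p.2 ^+ 2)) ->
  lm.-integrable (cylinder T) (EFin \o (fun p => dd p.1 p.2 ^+ 2)) ->
  {ae leb1, forall t, a < t < b ->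
    0 <= \int[m]_(z in halfplane) energy_rate lam S c d dd t z} ->
  exists G : R -> Prop, {ae leb1, forall t, a < t < b -> G t} /\
   forall t s, G t -> G s -> a < t -> t < s -> s < b ->
    \int[m]_(z in halfplane) (w t z ^+ 2 * damp lam S t z) <=
    \int[m]_(z in halfplane) (w s z ^+ 2 * damp lam S s z).
Proof.
move=> d dd w a0 ab bT bS l0 c0 mu1 mu2 mdu1 mdu2 D1 D2 id idd Hrate.
have mh := @measurable_halfplane R.
have md : joint_measurable d by exact: measurable_funB.
have mdd : joint_measurable dd by exact: measurable_funB.
have [[C1 R1] I1] := time_repr a0 ab bT mu1 mdu1 D1.
have [[C2 R2] I2] := time_repr a0 ab bT mu2 mdu2 D2.
have mC := @measurable_cylinder R T.
have iT := L1_restrict mC id.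
pose E t := m.-integrable halfplane (EFin \o (fun z => (1 + z.2) * d t z ^+ 2)).
have aeE : {ae leb1, forall t, a < t < b -> E t}.
  have := ae_integrable1 iT; apply: (@ae_imp _ (mR R) R leb1) => t h /andP[at_ tb].
  apply: (integrable_mkcond _ mh).2; rewrite restrict_EFin.
  apply: eq_integrable h => // z _; rewrite /= !patchE.
  case: ifPn => [/set_mem[]//= _ hz|]; first by rewrite mem_set.
  case: ifPn => // /set_mem hz /negP []; apply: mem_set; split => //=.
  by apply: in_timeset; [exact: ltW (lt_trans a0 at_)|exact: ltW (lt_trans tb bT)].
pose P (p : R * (R * R)) := a < p.1 < b -> halfplane p.2 ->
  d p.1 p.2 = (C1 p.2 - C2 p.2) + (prim a (fun r => du1 r p.2) p.1
      - prim a (fun r => du2 r p.2) p.1).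
have aeP : {ae (leb1 \x leb2)%E, forall p, P p}.
  apply: (@ae_imp2 _ (mR3 R) R (leb1 \x leb2)%E _ _ _ _ R1 R2) => p h1 h2 pab hp.
  by rewrite /d h1// h2//; ring.
have aeP1 := ae_prod1 aeP; have aeP2 := ae_prod2 aeP.
exists (fun t => E t /\ {ae leb2, forall z, P (t, z)}); split.
  by apply: (@ae_imp2 _ (mR R) R leb1 _ _ _ _ aeE aeP1) => t h1 h2 tab; split; [exact: h1|].
move=> t s [Et Pt] [Es Ps] at_ ts sb.
have sab : a < s < b by apply/andP; split => //; exact: lt_trans ts.
have tab : a < t < b by apply/andP; split => //; exact: lt_trans sb.
pose Th (p : R * (R * R)) := energy_rate lam S c d dd p.1 p.2.
have mTh : measurable_fun setT (Th : mR3 R -> mR R) by exact: measurable_rate.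
(* The increment of the energy density at almost every [z]. *)
have key : {ae m, forall z, halfplane z ->
    w s z ^+ 2 * damp lam S s z - w t z ^+ 2 * damp lam S t z =
    \int[leb1]_(r in `[t, s]) Th (r, z)}.
  apply: ae_wmeas.
  have h12 : {ae leb2, forall z, halfplane z ->
      leb1.-integrable `[a, b] (EFin \o (fun r => dd r z))}.
    by apply: (@ae_imp2 _ (mR2 R) R leb2 _ _ _ _ I1 I2) => z i1 i2 hz; apply: L1B => //;
      [exact: i1|exact: i2].
  have hts : {ae leb2, forall z, P (t, z) /\ P (s, z)}.
    by apply: (@ae_imp2 _ (mR2 R) R leb2 _ _ _ _ Pt Ps).
  have hIP : {ae leb2, forall z, [/\ halfplane z ->
      leb1.-integrable `[a, b] (EFin \o (fun r => du1 r z)) &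
      halfplane z -> leb1.-integrable `[a, b] (EFin \o (fun r => du2 r z))]}.
    by apply: (@ae_imp2 _ (mR2 R) R leb2 _ _ _ _ I1 I2).
  have hh : {ae leb2, forall z, [/\ halfplane z ->
      leb1.-integrable `[a, b] (EFin \o (fun r => du1 r z)) &
      halfplane z -> leb1.-integrable `[a, b] (EFin \o (fun r => du2 r z))] /\
      {ae leb1, forall r, P (r, z)}}.
    by apply: (@ae_imp2 _ (mR2 R) R leb2 _ _ _ _ hIP aeP2).
  apply: (@ae_imp2 _ (mR2 R) R leb2 _ _ _ _ hts hh) => z [ptz psz] [[i1 i2] prz] hz.
  pose F r := (C1 z - C2 z) + (prim a (fun r => du1 r z) r
      - prim a (fun r => du2 r z) r).
  have A1 : abscont a b (prim a (fun r => du1 r z)) (fun r => du1 r z).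
    by split; [exact: i1|move=> r _; rewrite prim_aa add0r].
  have A2 : abscont a b (prim a (fun r => du2 r z)) (fun r => du2 r z).
    by split; [exact: i2|move=> r _; rewrite prim_aa add0r].
  have AF0 : abscont a b (fun r => F r - c) (fun r => dd r z).
    have := AC_addc (C1 z - C2 z - c) (AC_add A1 (AC_scale (-1) A2)).
    by move=> /(AC_ext (ltW ab)); apply => r _; rewrite /F /dd; ring.
  have AF := AC_sub AF0 (ltW at_) (ltW ts) (ltW sb).
  (* Before [S] the modulus in [damp] can be removed. *)
  pose th r := expR (- (lam * ((S - r) * z.2))).
  have thE r : t <= r <= s -> th r = damp lam S r z.
    move=> /andP[_ rs]; rewrite /th /damp ger0_norm// subr_ge0.
    exact: le_trans rs (ltW (lt_le_trans sb bS)).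
  have Ath : abscont t s th (fun r => lam * z.2 * th r).
    apply: AC_C1 => //.
      move=> r; pose lin r := lam * z.2 * r + (- (lam * S * z.2)).
      rewrite (_ : th = expR \o lin); last first.
        by apply/funext => x; rewrite /th /lin /=; congr expR; ring.
      have dl : is_derive r 1 lin (lam * z.2).
        have dZ := is_deriveZ (lam * z.2) (is_derive_id (r : R) (1 : R)).
        have := is_deriveD dZ (is_derive_cst (- (lam * S * z.2)) r (1 : R)).
        by rewrite addr0 /GRing.scale/= mulr1.
      apply: (is_derive_eq (is_derive1_comp (is_derive_expR (lin r)) dl)).
      by rewrite mulrC; congr (_ * _); rewrite /th /lin; congr expR; ring.
    move=> r; apply: cvgM; first exact: cvg_cst.
    apply: continuous_comp; last exact: continuous_expR.
    apply: cvgN; apply: cvgM; first exact: cvg_cst.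
    apply: cvgM; last exact: cvg_cst.
    by apply: cvgB; [exact: cvg_cst|exact: cvg_id].
  have [iK K] := AC_mul (ltW ts) (AC_sqpos (ltW ts) AF) Ath.
  have := K s; rewrite (ltW ts) lexx => /(_ isT).
  have Ft : d t z = F t := ptz tab hz.
  have Fs : d s z = F s := psz sab hz.
  rewrite !thE ?lexx ?(ltW ts)// -Ft -Fs -/(w t z) -/(w s z) => ->.
  rewrite addrAC subrr add0r /prim.
  apply: ae_eq_Rintegral => //.
  - exact: L1_meas iK.
  - by apply: measurable_funTS; exact: (measurable_slice2 z mTh).
  apply: (@ae_imp _ (mR R) R leb1 _ _ _ prz) => r prz' .
  rewrite /= in_itv/= => rts; have [tr rs] := andP rts.
  have rab : a < r < b.
    by rewrite (lt_le_trans at_ tr) (le_lt_trans rs sb).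
  have Fr : d r z = F r := prz' rab hz.
  by rewrite -Fr (thE r rts) /Th /energy_rate /=; ring.
have iw r : E r -> m.-integrable halfplane
    (EFin \o (fun z => w r z ^+ 2 * damp lam S r z)).
  move=> Er; apply: L1_le Er => //.
    apply: measurable_funTS; apply: measurable_funM.
      by apply: measurable_funX; exact: (measurable_slice1 r (measurable_wpos c md)).
    exact: (measurable_slice1 r (measurable_damp lam S)).
  move=> z hz; have y0 : 0 < z.2 by [].
  have e0 := damp_gt0 lam S r z; have e1 := damp_le1 S r l0 hz.
  rewrite ger0_norm; last by rewrite mulr_ge0 ?sqr_ge0// ltW.
  have w2 : w r z ^+ 2 <= d r z ^+ 2 := sqr_pos_sub_le (d r z) c0.
  apply: (@le_trans _ _ (w r z ^+ 2)); first by rewrite ler_piMr ?sqr_ge0.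
  by apply: le_trans w2 _; rewrite ler_peMl ?sqr_ge0// lerDl ltW.
rewrite -subr_ge0 -RintegralB//; [|exact: iw..].
pose Dts : set (mR3 R) := `[t, s]%classic `*` halfplane.
have mD : measurable Dts by apply: measurableX => //; exact: measurable_itv.
have DC : Dts `<=` cylinder T.
  move=> [r z] [/=]; rewrite in_itv/= => /andP[tr rs] hz; split => //=.
  apply: in_timeset; first exact: ltW (lt_trans a0 (lt_le_trans at_ tr)).
  exact: ltW (le_lt_trans rs (lt_trans sb bT)).
have iTh : lm.-integrable Dts (EFin \o Th).
  apply: (@L1_le _ _ _ lm Dts Th (fun p => (1 + lam) * ((1 + p.2.2) * d p.1 p.2 ^+ 2)
       + dd p.1 p.2 ^+ 2)) => //.
  - exact: measurable_funTS.
  - by move=> [r z] [_ hz]; exact: rate_le.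
  - apply: L1D => //; last by apply: integrableS idd.
    by apply: L1Z => //; apply: integrableS id.
have iTh' := L1_restrict mD iTh.
have e1 : \int[m]_(z in halfplane) (w s z ^+ 2 * damp lam S s z -
    w t z ^+ 2 * damp lam S t z) = \int[m]_z \int[leb1]_r (Th \_ Dts) (r, z).
  rewrite Rintegral_mkcond; apply: ae_eq_Rintegral => //.
  - apply: L1_meas (L1_restrict mh _).
    by apply: L1B => //; exact: iw.
  - exact: L1_meas (L1_Rint2 iTh').
  apply: (@ae_imp _ (mR2 R) R m _ _ _ key) => z kz _; rewrite patchE; case: ifPn => [/set_mem hz|/negP nz].
    rewrite kz// Rintegral_mkcond; apply: eq_Rintegral => r _; rewrite !patchE.
    case: ifPn => [/set_mem rts|/negP nr].
      by rewrite mem_set.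
    by rewrite ifF//; apply/negP => /set_mem[/= rts _]; apply: nr; exact: mem_set.
  rewrite Rintegral0// => r _; rewrite patchE ifF//; apply/negP => /set_mem[_ /= hz].
  by apply: nz; exact: mem_set.
rewrite e1 -(Rfubini2 iTh') (Rfubini1 iTh').
apply: ae_Rintegral_ge0 => //; first exact: L1_meas (L1_Rint1 iTh').
apply: (@ae_imp _ (mR R) R leb1 _ _ _ Hrate) => r h _.
have [/andP[tr rs]|nr] := boolP (t <= r <= s).
  rewrite (_ : \int[m]_y _ = \int[m]_(z in halfplane) Th (r, z)).
    by apply: h; rewrite (lt_le_trans at_ tr) (le_lt_trans rs sb).
  rewrite [RHS]Rintegral_mkcond; apply: eq_Rintegral => z _; rewrite !patchE.
  case: ifPn => [/set_mem[_ /= hz]|/negP nz]; first by rewrite mem_set.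
  rewrite ifF//; apply/negP => /set_mem hz; apply: nz; apply: mem_set; split => //=.
  by rewrite in_itv/= tr rs.
rewrite Rintegral0// => z _; rewrite patchE ifF//; apply/negP => /set_mem[/=].
by rewrite in_itv/= (negbTE nr).
Qed.

End energy.

(** * Square integrable functions of time with values in V *)

Section spaces_of_time.
Context {R : realType}.
Variables (kappa theta sigma gamma mu : R).
Local Notation m := (wmeas kappa theta sigma gamma mu).
Local Notation lm := (leb1 \x m)%E.
Implicit Types (u ux uy : R -> R * R -> R) (z : R * R).

(** Tonelli's theorem: the norms, which are iterated integrals, express
    integrability on the cylinder. *)
Lemma iter_L1 (T : R) (f : R * (R * R) -> R) :
  measurable_fun setT (f : mR3 R -> mR R) ->
  (forall p, cylinder T p -> 0 <= f p) ->
  (\int[leb1]_(t in timeset T) \int[m]_(z in halfplane) (f (t, z))%:E < +oo)%E <->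
  lm.-integrable (cylinder T) (EFin \o f).
Proof.
move=> mf f0; have mC := @measurable_cylinder R T.
have mfC : measurable_fun setT (EFin \o (f \_ (cylinder T)) : mR3 R -> _).
  apply/measurable_EFinP; apply/(measurable_restrictT _ _).1 => //; exact: measurable_funTS.
have -> : lm.-integrable (cylinder T) (EFin \o f) <->
    lm.-integrable setT (EFin \o (f \_ (cylinder T))).
  by rewrite -restrict_EFin; exact: integrable_mkcond.
have E := integrable12ltyP leb1 m mfC.
rewrite [X in _ <-> X]E [X in (X < _)%E](_ : _ =
  \int[leb1]_x \int[m]_y `|(EFin \o (f \_ (cylinder T))) (x, y)|)%E//.
rewrite integral_mkcond; apply: eq_integral => t _; rewrite patchE.
case: ifPn => [/set_mem ht|/negP ht].
  rewrite integral_mkcond; apply: eq_integral => z _; rewrite patchE /= patchE.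
  case: ifPn => [/set_mem hz|/negP hz].
    by rewrite mem_set// ger0_norm// f0.
  by rewrite ifF ?normr0//; apply/negP => /set_mem[_ /mem_set].
rewrite integral0_eq// => z _ /=; rewrite patchE ifF ?normr0//.
by apply/negP => /set_mem[/mem_set].
Qed.

(** The integrand of [sqnormV]. *)
Definition densV (f fx fy : R * R -> R) z : R :=
  z.2 * (fx z ^+ 2 + fy z ^+ 2) + (1 + z.2) * f z ^+ 2.

Lemma densV_ge0 f fx fy z : halfplane z -> 0 <= densV f fx fy z.
Proof.
move=> hz; have y0 : 0 < z.2 by [].
by rewrite addr_ge0// mulr_ge0 ?addr_ge0 ?sqr_ge0// ltW.
Qed.

(** [L2V] with a chosen representative [(ux, uy)] of the spatial gradient. *)
Definition L2Vgrad (T : R) u ux uy : Prop :=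
  [/\ [/\ joint_measurable u, joint_measurable ux & joint_measurable uy],
      {ae leb1, forall t, timeset T t ->
         is_wderiv e_x (u t) (ux t) /\ is_wderiv e_y (u t) (uy t)} &
      lm.-integrable (cylinder T)
        (EFin \o (fun p => densV (u p.1) (ux p.1) (uy p.1) p.2))].

Lemma measurable_densV u ux uy : joint_measurable u -> joint_measurable ux ->
  joint_measurable uy ->
  measurable_fun setT (fun p : mR3 R => densV (u p.1) (ux p.1) (uy p.1) p.2 : mR R).
Proof.
move=> mu0 mux muy; have my := @measurable_y R.
apply: measurable_funD; apply: measurable_funM => //.
- by apply: measurable_funD; exact: measurable_funX.
- exact: measurable_funD.
- exact: measurable_funX.
Qed.

Lemma L2VgradP (T : R) u : L2V T m u <-> exists ux uy, L2Vgrad T u ux uy.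
Proof.
split=> [[mu0 [ux [uy [mux muy h oo]]]]|[ux [uy [[mu0 mux muy] h oo]]]].
  exists ux, uy; split => //; apply/iter_L1 => //; first exact: measurable_densV.
  by move=> p [_ hz]; exact: densV_ge0.
split => //; exists ux, uy; split => //.
apply/(iter_L1 (f := fun p => densV (u p.1) (ux p.1) (uy p.1) p.2)) => //.
  exact: measurable_densV.
by move=> p [_ hz]; exact: densV_ge0.
Qed.

Lemma densV_lin f fx fy g gx gy k z : halfplane z ->
  densV (fun z => f z + k * g z) (fun z => fx z + k * gx z)
    (fun z => fy z + k * gy z) z <=
  2 * densV f fx fy z + 2 * k ^+ 2 * densV g gx gy z.
Proof.
move=> hz; have y0 : 0 < z.2 by [].
have h (p q : R) : (p + k * q) ^+ 2 <= 2 * p ^+ 2 + 2 * k ^+ 2 * q ^+ 2.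
  by have := sqr_ge0 (p - k * q); lra.
have h1 := h (fx z) (gx z); have h2 := h (fy z) (gy z); have h3 := h (f z) (g z).
rewrite /densV.
have h12 := lerD h1 h2.
have h12' := ler_wpM2l (ltW y0) h12.
have y1 : 0 <= 1 + z.2 by lra.
have h3' := ler_wpM2l y1 h3.
by have := lerD h12' h3'; lra.
Qed.

Lemma L2Vgrad_lin (T k : R) u ux uy v vx vy : L2Vgrad T u ux uy ->
  L2Vgrad T v vx vy ->
  L2Vgrad T (fun t z => u t z + k * v t z) (fun t z => ux t z + k * vx t z)
    (fun t z => uy t z + k * vy t z).
Proof.
move=> [[mu0 mux muy] hu iu] [[mv mvx mvy] hv iv].
have mlin a b : joint_measurable a -> joint_measurable b ->
    joint_measurable (fun t z => a t z + k * b t z).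
  by move=> ma mb; apply: measurable_funD => //; exact: measurable_funM.
split; first by split; exact: mlin.
  apply: (@ae_imp2 _ (mR R) R leb1 _ _ _ _ hu hv) => t h1 h2 ht.
  by have [a1 a2] := h1 ht; have [b1 b2] := h2 ht; split; exact: wderiv_lin.
have mC := @measurable_cylinder R T.
apply: (@L1_le _ _ _ lm _ _ (fun p => 2 * densV (u p.1) (ux p.1) (uy p.1) p.2 +
   2 * k ^+ 2 * densV (v p.1) (vx p.1) (vy p.1) p.2)) => //.
- apply: measurable_funTS.
  exact: measurable_densV (mlin _ _ mu0 mv) (mlin _ _ mux mvx) (mlin _ _ muy mvy).
- by move=> p [_ hz]; rewrite ger0_norm ?densV_ge0// densV_lin.
- by apply: L1D => //; exact: L1Z.
Qed.

Variables (lam S c : R).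

Lemma Ck_damp t n : Ck n (damp lam S t : R * R -> R).
Proof.
pose A (z : R * R) : R := - (lam * (`|S - t| * z.2)).
have cA : continuous A.
  have cs : continuous (@snd R R) by move=> z; exact: cvg_snd.
  have -> : A = (fun z => - (lam * `|S - t|) * z.2).
    by apply/funext => z; rewrite /A; ring.
  by move=> z; apply: cvgM; [exact: cvg_cst|exact: cs].
have AA (h : R) (v x : R * R) : A (h *: v + x) = h *: A v + A x.
  have e1 : (h *: v + x).2 = h * v.2 + x.2 by [].
  have e2 : h *: A v = h * A v by [].
  by rewrite e2 /A e1; ring.
exact: (Ck_comp cA AA (Ck_expR n)).
Qed.

Lemma derive_damp t v z :
  'D_v (damp lam S t : R * R -> R) z = - (lam * (`|S - t| * v.2)) * damp lam S t z.
Proof.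
pose A (z : R * R) : R := - (lam * (`|S - t| * z.2)).
have AA (h : R) (w y : R * R) : A (h *: w + y) = h *: A w + A y.
  have e1 : (h *: w + y).2 = h * w.2 + y.2 by [].
  have e2 : h *: A w = h * A w by [].
  by rewrite e2 /A e1; ring.
have dE : derivable (@expR R) (A z) (A v).
  by apply: diff_derivable; apply/derivable1_diffP; exact: derivable_expR.
have [_ ->] := is_derive_affine AA dE.
rewrite deriveE; last by apply/derivable1_diffP; exact: derivable_expR.
rewrite deriv1E; last exact: derivable_expR.
by rewrite derive1E; have [_ ->] := is_derive_expR (A z).
Qed.

(** The test direction [(d - c)^+ * damp] and its spatial gradient. *)
Definition wdamp (d : R -> R * R -> R) t z : R := damp lam S t z * pos (d t z - c).
Definition wdamp_x (d dx : R -> R * R -> R) t z : R :=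
  damp lam S t z * (if 0 < d t z - c then dx t z else 0).
Definition wdamp_y (d dy : R -> R * R -> R) t z : R :=
  damp lam S t z * (if 0 < d t z - c then dy t z else 0)
  - lam * `|S - t| * damp lam S t z * pos (d t z - c).

(** The derivative of the damping factor in [y] is at most [lam * T] times a
    quantity bounded by 1, so the squared norm grows at most by a constant. *)
Lemma L2Vgrad_wdamp (T : R) d dx dy : 0 <= lam -> 0 <= c -> 0 <= S <= T ->
  L2Vgrad T d dx dy -> L2Vgrad T (wdamp d) (wdamp_x d dx) (wdamp_y d dy).
Proof.
move=> l0 c0 /andP[S0 ST] [[md mdx mdy] hd id].
have mw := measurable_wpos c md; have mD := measurable_damp lam S.
have mif (g : R -> R * R -> R) : joint_measurable g ->
    joint_measurable (fun t z => if 0 < d t z - c then g t z else 0).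
  move=> mg; apply: measurable_fun_ifT => //; apply: measurable_fun_ltr => //.
  exact: measurable_funB.
have mW : joint_measurable (wdamp d) by exact: measurable_funM.
have mWx : joint_measurable (wdamp_x d dx) by apply: measurable_funM => //; exact: mif.
have mWy : joint_measurable (wdamp_y d dy).
  apply: measurable_funB; first by apply: measurable_funM => //; exact: mif.
  apply: measurable_funM => //; apply: measurable_funM => //.
  apply: measurable_funM => //; apply: measurableT_comp => //.
  exact: measurable_funB.
split; first by [].
  apply: (@ae_imp _ (mR R) R leb1 _ _ _ hd) => t h ht.
  have [h1 h2] := h ht; split.
    have := wderiv_mul (Ck_damp t) (wderiv_pos_x c (measurable_slice1 t md)
      (measurable_slice1 t mdx) h1).
    rewrite (_ : (fun z => _ + 1 * _) = wdamp_x d dx t)//.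
    by apply/funext => z; rewrite derive_damp /e_x /wdamp_x /=; ring.
  have := wderiv_mul (Ck_damp t) (wderiv_pos_y c (measurable_slice1 t md)
      (measurable_slice1 t mdy) h2).
  rewrite (_ : (fun z => _ + 1 * _) = wdamp_y d dy t)//.
  by apply/funext => z; rewrite derive_damp /e_y /wdamp_y /=; ring.
have mC := @measurable_cylinder R T.
pose K := 3 + 2 * (lam * T) ^+ 2.
apply: (@L1_le _ _ _ lm _ _ (fun p => K * densV (d p.1) (dx p.1) (dy p.1) p.2)) => //.
- by apply: measurable_funTS; exact: measurable_densV.
- move=> [t z] [/= ht hz]; rewrite ger0_norm ?densV_ge0//.
  have y0 : 0 < z.2 by [].
  have e0 := damp_gt0 lam S t z; have e1 := damp_le1 S t l0 hz.
  rewrite /densV /wdamp /wdamp_x /wdamp_y.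
  set D := damp _ _ _ _ in e0 e1 *; set w := pos _.
  set gx := if _ then dx _ _ else _; set gy := if _ then dy _ _ else _.
  have gx2 : gx ^+ 2 <= dx t z ^+ 2.
    by rewrite /gx; case: ifP => // _; rewrite expr0n sqr_ge0.
  have gy2 : gy ^+ 2 <= dy t z ^+ 2.
    by rewrite /gy; case: ifP => // _; rewrite expr0n sqr_ge0.
  have w0 : 0 <= w by exact: pos_ge0.
  have w2 : w ^+ 2 <= d t z ^+ 2 := sqr_pos_sub_le (d t z) c0.
  have D2 : D ^+ 2 <= 1 by rewrite expr_le1// ltW.
  have D0 : 0 <= D ^+ 2 by exact: sqr_ge0.
  set k := lam * `|S - t|.
  have k0 : 0 <= k by rewrite mulr_ge0.
  have kT : k ^+ 2 <= (lam * T) ^+ 2.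
    have T0 : 0 <= T by exact: le_trans ST.
    rewrite ler_sqr ?nnegrE ?mulr_ge0// ler_wpM2l//.
    move: ht; rewrite /timeset/= in_itv/= => /andP[t0 tT].
    by rewrite ler_norml; apply/andP; split; lra.
  have a1 : (D * gx) ^+ 2 <= dx t z ^+ 2.
    by rewrite exprMn; apply: le_trans gx2; rewrite ler_piMl ?sqr_ge0.
  have a2 : (D * gy - k * D * w) ^+ 2 <=
      2 * dy t z ^+ 2 + 2 * (lam * T) ^+ 2 * d t z ^+ 2.
    have b : (gy - k * w) ^+ 2 <= 2 * gy ^+ 2 + 2 * (k ^+ 2 * w ^+ 2).
      by have := sqr_ge0 (gy + k * w); lra.
    have b' : k ^+ 2 * w ^+ 2 <= (lam * T) ^+ 2 * d t z ^+ 2.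
      by rewrite ler_pM ?sqr_ge0.
    rewrite (_ : D * gy - k * D * w = D * (gy - k * w)); last by ring.
    rewrite exprMn; apply: (@le_trans _ _ ((gy - k * w) ^+ 2)).
      by rewrite ler_piMl ?sqr_ge0.
    lra.
  have a3 : (D * w) ^+ 2 <= d t z ^+ 2.
    by rewrite exprMn; apply: le_trans w2; rewrite ler_piMl ?sqr_ge0.
  have a12 := ler_wpM2l (ltW y0) (lerD a1 a2).
  have y1 : 0 <= 1 + z.2 by lra.
  have a3' := ler_wpM2l y1 a3.
  apply: le_trans (lerD a12 a3') _; rewrite /K.
  have c1 : 0 <= z.2 * dx t z ^+ 2 by rewrite mulr_ge0 ?sqr_ge0// ltW.
  have c2 : 0 <= z.2 * dy t z ^+ 2 by rewrite mulr_ge0 ?sqr_ge0// ltW.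
  have c3 : 0 <= d t z ^+ 2 by exact: sqr_ge0.
  have c4 : 0 <= z.2 * d t z ^+ 2 by rewrite mulr_ge0 ?sqr_ge0// ltW.
  have L0 : 0 <= (lam * T) ^+ 2 by exact: sqr_ge0.
  have d1 := mulr_ge0 L0 c1; have d2 := mulr_ge0 L0 c2.
  have d3 := mulr_ge0 L0 c3; have d4 := mulr_ge0 L0 c4.
  lra.
- exact: L1Z.
Qed.

End spaces_of_time.

(** * The bilinear form *)

Section forms.
Context {R : realType}.

Lemma measurable_sg : measurable_fun setT (Num.sg : mR R -> mR R).
Proof.
rewrite (_ : Num.sg = (fun x : mR R => if 0 < x then 1 else if x < 0 then -1 else 0 : mR R)).
  apply: measurable_fun_ifT => //; first exact: measurable_fun_ltr.
  by apply: measurable_fun_ifT => //; exact: measurable_fun_ltr.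
by apply/funext => x; case: sgrP.
Qed.

(** Coercivity in the gradient: as [|2 rho p q| <= |rho| (p^2 + q^2)], there
    remains [(1 - |rho|) (p^2 + q^2)] to complete squares with. *)
Lemma quad_ge0 (rho p q w lam A B : R) : `|rho| < 1 ->
  A ^+ 2 + B ^+ 2 <= 4 * (1 - `|rho|) * lam ->
  0 <= p ^+ 2 + 2 * rho * p * q + q ^+ 2 + A * p * w + B * q * w + lam * w ^+ 2.
Proof.
move=> r1 AB; set e := 1 - `|rho| in AB *.
have e0 : 0 < e by rewrite subr_gt0.
have h1 : 0 <= `|rho| * (p ^+ 2 + q ^+ 2) + 2 * rho * p * q.
  have [r0|r0] := ger0P rho.
    have -> : rho * (p ^+ 2 + q ^+ 2) + 2 * rho * p * q = rho * (p + q) ^+ 2 by ring.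
    by rewrite mulr_ge0 ?sqr_ge0.
  have -> : - rho * (p ^+ 2 + q ^+ 2) + 2 * rho * p * q = - rho * (p - q) ^+ 2 by ring.
  by rewrite mulr_ge0 ?sqr_ge0// oppr_ge0 ltW.
(* Completing the squares in [p] and [q], multiplied by [4 * e]. *)
have h2 : 0 <= (2 * e * p + A * w) ^+ 2 + (2 * e * q + B * w) ^+ 2 +
    (4 * e * lam - (A ^+ 2 + B ^+ 2)) * w ^+ 2.
  by rewrite !addr_ge0 ?sqr_ge0// mulr_ge0 ?sqr_ge0// subr_ge0.
have -> : p ^+ 2 + 2 * rho * p * q + q ^+ 2 + A * p * w + B * q * w + lam * w ^+ 2 =
  (`|rho| * (p ^+ 2 + q ^+ 2) + 2 * rho * p * q) + (4 * e)^-1 *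
   ((2 * e * p + A * w) ^+ 2 + (2 * e * q + B * w) ^+ 2 +
    (4 * e * lam - (A ^+ 2 + B ^+ 2)) * w ^+ 2).
  have -> : `|rho| = 1 - e by rewrite /e; ring.
  by field; rewrite gt_eqF.
by rewrite addr_ge0// mulr_ge0// invr_ge0 mulr_ge0// ltW.
Qed.

Lemma Lnorm2_sq d (T : measurableType d) (mu : {measure set T -> \bar R}) (f : T -> R) :
  ('N[mu]_2%:E[EFin \o f] ^+ 2 = \int[mu]_x (f x ^+ 2)%:E)%E.
Proof.
have sq (x : \bar R) : (0 <= x -> x ^+ 2 = x `^ 2)%E.
  case: x => [r| |] // r0.
    by rewrite -EFin_expe poweR_EFin powR_mulrn// -lee_fin.
  by rewrite poweRyr// expe2 mulyy.
rewrite sq ?Lnorm_ge0// poweR_Lnorm//; apply: eq_integral => x _.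
by rewrite /= powR_mulrn// real_normK// num_real.
Qed.

Variables (kappa theta sigma rho gamma mu : R).
Local Notation m := (wmeas kappa theta sigma gamma mu).
Local Notation lm := (leb1 \x m)%E.
Local Notation jc := (jcoef sigma rho gamma mu).
Local Notation kc := (kcoef kappa sigma rho gamma mu).
Implicit Types (f fx fy g gx gy : R * R -> R) (z : R * R).

Lemma L2H_L1 (T : R) du : L2H T m du ->
  lm.-integrable (cylinder T) (EFin \o (fun p => du p.1 p.2 ^+ 2)).
Proof.
move=> [mdu oo]; apply/(@iter_L1 R kappa theta sigma gamma mu T (fun p => du p.1 p.2 ^+ 2)).
- exact: measurable_funX.
- by move=> p _; exact: sqr_ge0.
apply: le_lt_trans oo.
have md2 : measurable_fun setT (fun p : mR3 R => (du p.1 p.2 ^+ 2)%:E).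
  by apply/measurable_EFinP; exact: measurable_funX.
have mt : measurable (timeset T : set (mR R)) by exact: measurable_itv.
under [leRHS]eq_integral do rewrite Lnorm2_sq.
apply: ge0_le_integral => //.
- by move=> t _; apply: integral_ge0 => z _; rewrite lee_fin sqr_ge0.
- apply: measurable_funTS.
  rewrite (_ : (fun t => _) = fubini_F m
     (fun p : mR3 R => ((fun p => (du p.1 p.2 ^+ 2)%:E) \_ (setT `*` halfplane)) p)).
    apply: measurable_fun_fubini_tonelli_F.
      apply/(measurable_restrictT _ _).1 => //.
        by apply: measurableX => //; exact: measurable_halfplane.
      exact: measurable_funTS.
    by move=> p; rewrite patchE; case: ifP => // _; rewrite lee_fin sqr_ge0.
  apply/funext => t; rewrite /fubini_F [LHS]integral_mkcond; apply: eq_integral => z _.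
  rewrite !patchE; case: ifPn => [/set_mem hz|/negP hz]; first by rewrite mem_set.
  rewrite ifF//; apply/negP => /set_mem hh; apply: hz; apply: mem_set.
  exact: hh.2.
- apply: measurable_funTS.
  apply: (measurable_fun_fubini_tonelli_F (fun p : mR3 R => (du p.1 p.2 ^+ 2)%:E)) => //.
  by move=> p; rewrite lee_fin sqr_ge0.
- move=> t _; apply: ge0_subset_integral => //.
  + exact: measurable_halfplane.
  + apply/measurable_EFinP; apply: measurable_funX; exact: measurable_slice1 mdu.
  + by move=> z _; rewrite lee_fin sqr_ge0.
Qed.

Lemma ae_L1_slice (T : R) (f : R * (R * R) -> R) :
  lm.-integrable (cylinder T) (EFin \o f) ->
  {ae leb1, forall t, timeset T t ->
    m.-integrable halfplane (EFin \o (fun z => f (t, z)))}.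
Proof.
move=> if_; have mC := @measurable_cylinder R T.
have mh := @measurable_halfplane R.
have := ae_integrable1 (L1_restrict mC if_).
apply: (@ae_imp _ (mR R) R leb1) => t h ht.
apply: (integrable_mkcond _ mh).2; rewrite restrict_EFin.
apply: eq_integrable h => // z _; rewrite /= !patchE.
case: ifPn => [/set_mem[]//= _ hz|]; first by rewrite mem_set.
by case: ifPn => // /set_mem hz /negP []; apply: mem_set.
Qed.

(** The integrands of the second-order and of the first-order part of
    [aform]. *)
Definition principal_form fx fy gx gy z : R :=
  z.2 * (fx z * gx z + rho * sigma * (fx z * gy z) + rho * sigma * (fy z * gx z)
   + sigma ^+ 2 * (fy z * gy z)).
Definition drift_form fx fy g z : R := z.2 * (jc z.1 * fx z + kc z.1 * fy z) * g z.

Lemma measurable_principal_form (D : set (mR2 R)) fx fy gx gy : measurable D ->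
  measurable_fun D (fx : mR2 R -> mR R) -> measurable_fun D (fy : mR2 R -> mR R) ->
  measurable_fun D (gx : mR2 R -> mR R) -> measurable_fun D (gy : mR2 R -> mR R) ->
  measurable_fun D (principal_form fx fy gx gy : mR2 R -> mR R).
Proof.
move=> mD m1 m2 m3 m4; apply: measurable_funM.
  by apply: measurable_funTS; exact: measurable_snd.
by repeat (apply: measurable_funD || apply: measurable_funM || exact: measurable_cst || assumption).
Qed.

Lemma measurable_jc : measurable_fun setT (fun z : mR2 R => jc z.1 : mR R).
Proof.
apply: measurable_funM => //; apply: measurable_funB => //.
apply: measurable_funB => //; apply: measurable_funM => //.
exact: measurableT_comp measurable_sg measurable_fst.
Qed.

Lemma measurable_kc : measurable_fun setT (fun z : mR2 R => kc z.1 : mR R).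
Proof.
apply: measurable_funB => //; apply: measurable_funB => //; apply: measurable_funM => //.
exact: measurableT_comp measurable_sg measurable_fst.
Qed.

Lemma measurable_drift_form (D : set (mR2 R)) fx fy g : measurable D ->
  measurable_fun D (fx : mR2 R -> mR R) -> measurable_fun D (fy : mR2 R -> mR R) ->
  measurable_fun D (g : mR2 R -> mR R) ->
  measurable_fun D (drift_form fx fy g : mR2 R -> mR R).
Proof.
move=> mD m1 m2 m3; have mj := measurable_funTS measurable_jc mD.
have mk := measurable_funTS measurable_kc mD.
apply: measurable_funM => //; apply: measurable_funM.
  by apply: measurable_funTS; exact: measurable_snd.
by apply: measurable_funD; apply: measurable_funM => //;
  [exact: measurable_funTS measurable_jc|exact: measurable_funTS measurable_kc].
Qed.

Lemma sg_le1 (x : R) : `|Num.sg x| <= 1.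
Proof. by case: sgrP; rewrite ?normr0 ?normrN ?normr1. Qed.

Lemma jc_le x : `|jc x| <= (1 + `|gamma| + `|mu * rho * sigma|) / 2.
Proof.
rewrite /jcoef normrM (ger0_norm (_ : 0 <= 2^-1))// ler_wpM2r//.
apply: le_trans (ler_normB _ _) _; rewrite lerD//.
apply: le_trans (ler_normB _ _) _; rewrite normr1 lerD// normrM.
by rewrite ler_piMr// sg_le1.
Qed.

Lemma kc_le x : `|kc x| <=
  `|kappa| + `|gamma * rho * sigma / 2| + `|mu * sigma ^+ 2 / 2|.
Proof.
rewrite /kcoef; apply: le_trans (ler_normB _ _) _; rewrite lerD//.
apply: le_trans (ler_normB _ _) _; rewrite lerD// normrM.
by rewrite ler_piMr// sg_le1.
Qed.

Lemma principal_form_le f fx fy g gx gy z : halfplane z ->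
  `|principal_form fx fy gx gy z| <= (1 + 2 * `|rho * sigma| + sigma ^+ 2) *
    (densV f fx fy z + densV g gx gy z).
Proof.
move=> hz; have y0 : 0 < z.2 by [].
have y1 : 0 <= z.2 := ltW y0.
have s2 : 0 <= sigma ^+ 2 by exact: sqr_ge0.
have r0 : 0 <= `|rho * sigma| by [].
pose Q := fx z ^+ 2 + fy z ^+ 2 + gx z ^+ 2 + gy z ^+ 2.
have pr (p q : R) : `|p * q| <= p ^+ 2 + q ^+ 2.
  have := sqr_ge0 (p - q); have := sqr_ge0 (p + q) => h1 h2.
  have p2 := sqr_ge0 p; have q2 := sqr_ge0 q.
  by rewrite ler_norml; apply/andP; split; lra.
have x1 := sqr_ge0 (fx z); have x2 := sqr_ge0 (fy z).
have x3 := sqr_ge0 (gx z); have x4 := sqr_ge0 (gy z).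
have b1 : `|fx z * gx z| <= Q by apply: le_trans (pr _ _) _; rewrite /Q; lra.
have b2 : `|fx z * gy z| <= Q by apply: le_trans (pr _ _) _; rewrite /Q; lra.
have b3 : `|fy z * gx z| <= Q by apply: le_trans (pr _ _) _; rewrite /Q; lra.
have b4 : `|fy z * gy z| <= Q by apply: le_trans (pr _ _) _; rewrite /Q; lra.
have B : `|fx z * gx z + rho * sigma * (fx z * gy z) + rho * sigma * (fy z * gx z)
   + sigma ^+ 2 * (fy z * gy z)| <= (1 + 2 * `|rho * sigma| + sigma ^+ 2) * Q.
  apply: le_trans (ler_normD _ _) _; apply: le_trans (lerD (ler_normD _ _) (lexx _)) _.
  apply: le_trans (lerD (lerD (ler_normD _ _) (lexx _)) (lexx _)) _.
  rewrite 3![`|_ * (_ * _)|]normrM (ger0_norm s2).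
  have c2 := ler_wpM2l r0 b2; have c3 := ler_wpM2l r0 b3; have c4 := ler_wpM2l s2 b4.
  lra.
rewrite /principal_form normrM (ger0_norm y1).
apply: le_trans (ler_wpM2l y1 B) _.
set C := 1 + _ + _; have C0 : 0 <= C by rewrite !addr_ge0// mulr_ge0.
rewrite (_ : z.2 * (C * Q) = C * (z.2 * Q)); last by ring.
rewrite ler_wpM2l// /Q /densV.
have d1 : 0 <= (1 + z.2) * f z ^+ 2 by rewrite mulr_ge0 ?sqr_ge0// addr_ge0.
have d2 : 0 <= (1 + z.2) * g z ^+ 2 by rewrite mulr_ge0 ?sqr_ge0// addr_ge0.
lra.
Qed.

Lemma drift_form_le f fx fy g gx gy z : halfplane z ->
  `|drift_form fx fy g z| <= ((1 + `|gamma| + `|mu * rho * sigma|) / 2 +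
    (`|kappa| + `|gamma * rho * sigma / 2| + `|mu * sigma ^+ 2 / 2|)) *
    (densV f fx fy z + densV g gx gy z).
Proof.
move=> hz; have y0 : 0 < z.2 by [].
have y1 : 0 <= z.2 := ltW y0.
set J := (1 + _ + _) / 2; set K := `|kappa| + _ + _.
have J0 : 0 <= J by rewrite divr_ge0 ?addr_ge0.
have K0 : 0 <= K by rewrite !addr_ge0.
have pr (p q : R) : `|p| * `|q| <= p ^+ 2 + q ^+ 2.
  rewrite -normrM; have := sqr_ge0 (p - q); have := sqr_ge0 (p + q) => h1 h2.
  have p2 := sqr_ge0 p; have q2 := sqr_ge0 q.
  by rewrite ler_norml; apply/andP; split; lra.
rewrite /drift_form -mulrA normrM (ger0_norm y1) mulrDl.
have x1 := sqr_ge0 (fx z); have x2 := sqr_ge0 (fy z); have x3 := sqr_ge0 (g z).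
have x4 := sqr_ge0 (gx z); have x5 := sqr_ge0 (gy z); have x6 := sqr_ge0 (f z).
pose Q := fx z ^+ 2 + fy z ^+ 2 + g z ^+ 2.
have B1 : `|jc z.1 * fx z * g z| <= J * Q.
  rewrite -mulrA normrM ler_pM ?jc_le// normrM; apply: le_trans (pr _ _) _.
  by rewrite /Q; lra.
have B2 : `|kc z.1 * fy z * g z| <= K * Q.
  rewrite -mulrA normrM ler_pM ?kc_le// normrM; apply: le_trans (pr _ _) _.
  by rewrite /Q; lra.
have B : `|jc z.1 * fx z * g z + kc z.1 * fy z * g z| <= (J + K) * Q.
  by apply: le_trans (ler_normD _ _) _; rewrite (mulrDl J K Q); exact: lerD.
apply: le_trans (ler_wpM2l y1 B) _.
have C0 : 0 <= J + K by rewrite addr_ge0.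
rewrite (_ : z.2 * ((J + K) * Q) = (J + K) * (z.2 * Q)); last by ring.
rewrite ler_wpM2l// /Q /densV.
have d1 : 0 <= (1 + z.2) * f z ^+ 2 by rewrite mulr_ge0 ?sqr_ge0// addr_ge0.
have d2 : 0 <= z.2 * (gx z ^+ 2 + gy z ^+ 2) by rewrite mulr_ge0// addr_ge0.
lra.
Qed.

Lemma wderivP e f g : is_wderiv e f g -> is_wderiv e f (wderiv e f).
Proof. by move=> h; apply: (xgetPex (fun=> 0)); exists g. Qed.

Lemma wderiv_ae e f g : is_wderiv e f g ->
  {ae m, forall z, halfplane z -> wderiv e f z = g z}.
Proof. by move=> h; apply: ae_wmeas; exact: wderiv_uniq (wderivP h) h. Qed.

Lemma is_wderiv_meas e f g : is_wderiv e f g ->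
  measurable_fun (halfplane : set (mR2 R)) (g : mR2 R -> mR R).
Proof. by move=> [_ lg _]; exact: loc_int_measurable. Qed.

(** [aform] is defined through chosen distributional derivatives, which agree
    almost everywhere with any others. *)
Lemma aformE f fx fy g gx gy : measurable_fun setT (g : mR2 R -> mR R) ->
  is_wderiv e_x f fx -> is_wderiv e_y f fy ->
  is_wderiv e_x g gx -> is_wderiv e_y g gy ->
  aform kappa theta sigma rho gamma mu f g =
  2^-1 * \int[m]_(z in halfplane) principal_form fx fy gx gy z +
  \int[m]_(z in halfplane) drift_form fx fy g z.
Proof.
move=> mg Dfx Dfy Dgx Dgy; have mh := @measurable_halfplane R.
have a1 := wderiv_ae Dfx; have a2 := wderiv_ae Dfy.
have a3 := wderiv_ae Dgx; have a4 := wderiv_ae Dgy.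
have aa : {ae m, forall z, (halfplane z -> wderiv e_x f z = fx z) /\
    (halfplane z -> wderiv e_y f z = fy z)}.
  by apply: (@ae_imp2 _ (mR2 R) R m _ _ _ _ a1 a2) => z ? ?; split.
have bb : {ae m, forall z, (halfplane z -> wderiv e_x g z = gx z) /\
    (halfplane z -> wderiv e_y g z = gy z)}.
  by apply: (@ae_imp2 _ (mR2 R) R m _ _ _ _ a3 a4) => z ? ?; split.
have mg' : measurable_fun (halfplane : set (mR2 R)) (g : mR2 R -> mR R).
  exact: measurable_funTS.
rewrite /aform; congr (_ * _ + _); apply: ae_eq_Rintegral => //.
- by apply: (measurable_principal_form mh); [exact: is_wderiv_meas (wderivP Dfx)|
    exact: is_wderiv_meas (wderivP Dfy)|exact: is_wderiv_meas (wderivP Dgx)|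
    exact: is_wderiv_meas (wderivP Dgy)].
- by apply: (measurable_principal_form mh); [exact: is_wderiv_meas Dfx|
    exact: is_wderiv_meas Dfy|exact: is_wderiv_meas Dgx|exact: is_wderiv_meas Dgy].
- apply: (@ae_imp2 _ (mR2 R) R m _ _ _ _ aa bb) => z [h1 h2] [h3 h4] hz.
  by rewrite /principal_form h1// h2// h3// h4.
- by apply: (measurable_drift_form mh) => //; [exact: is_wderiv_meas (wderivP Dfx)|
    exact: is_wderiv_meas (wderivP Dfy)].
- by apply: (measurable_drift_form mh) => //; [exact: is_wderiv_meas Dfx|
    exact: is_wderiv_meas Dfy].
- apply: (@ae_imp _ (mR2 R) R m _ _ _ aa) => z [h1 h2] hz.
  by rewrite /drift_form h1// h2.
Qed.

End forms.

(** * The inequality satisfied by the difference of two solutions *)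

Section tested_inequality.
Context {R : realType}.
Variables (kappa theta sigma rho gamma mu : R).
Local Notation m := (wmeas kappa theta sigma gamma mu).
Local Notation lm := (leb1 \x m)%E.
Local Notation jc := (jcoef sigma rho gamma mu).
Local Notation kc := (kcoef kappa sigma rho gamma mu).
Local Notation pform := (principal_form sigma rho).
Local Notation dform := (drift_form kappa sigma rho gamma mu).
Implicit Types (z : R * R).

(** Bounds for the coefficients of [w dx] and [w dy] in the integrand of
    [form_ge0]: the first terms come from the gradient of the damping factor,
    whose size is [lam * |S - t| <= 1], the others from [jcoef] and [kcoef].
    The division by [sigma] in the second one reflects that the quadratic form
    is written in the variables [dx] and [sigma * dy]. *)
Definition drift_x : R := `|rho * sigma| + (1 + `|gamma| + `|mu * rho * sigma|).
Definition drift_y : R := `|sigma| +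
  2 * (`|kappa| + `|gamma * rho * sigma / 2| + `|mu * sigma ^+ 2 / 2|) / `|sigma|.
(** The threshold at which [quad_ge0] applies with the bounds [drift_x] and
    [drift_y]. *)
Definition damping_rate : R := (drift_x ^+ 2 + drift_y ^+ 2) / (4 * (1 - `|rho|)).

(** Where [w > 0], the integrand is [z.2 * damp] times the quadratic form of
    [quad_ge0] in [dx], [sigma * dy] and [w]; elsewhere it is 0. *)
Lemma form_ge0 (lam S c t : R) (d dx dy : R -> R * R -> R) z :
  0 < sigma -> `|rho| < 1 -> damping_rate <= lam -> 0 <= lam ->
  lam * `|S - t| <= 1 -> halfplane z ->
  0 <= pform (dx t) (dy t) (wdamp_x lam S c d dx t) (wdamp_y lam S c d dy t) z +
       2 * dform (dx t) (dy t) (wdamp lam S c d t) z +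
       lam * z.2 * pos (d t z - c) * wdamp lam S c d t z.
Proof.
move=> s0 r1 lam1 l0 lS hz; have y0 : 0 < z.2 by [].
have e0 := damp_gt0 lam S t z.
rewrite /principal_form /drift_form /wdamp /wdamp_x /wdamp_y.
set D := damp lam S t z in e0 *; set k := lam * `|S - t| in lS *.
have k0 : 0 <= k by rewrite mulr_ge0.
have [h|h] := ltP 0 (d t z - c); last first.
  rewrite /pos max_r//; set X := (X in 0 <= X); suff -> : X = 0 by [].
  by rewrite /X; ring.
set w := pos _; set p := dx t z; set q := dy t z.
(* The coefficients of [p * w] and [sigma * q * w]. *)
set A := - (k * (rho * sigma)) + 2 * jc z.1.
set B := - (k * sigma) + 2 * kc z.1 / sigma.
have hA : `|A| <= drift_x.
  apply: le_trans (ler_normD _ _) _; rewrite normrN; apply: lerD.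
    by rewrite normrM (ger0_norm k0) ler_piMl.
  rewrite normrM (ger0_norm (_ : 0 <= 2))//.
  by have := jc_le sigma rho gamma mu z.1; lra.
have hB : `|B| <= drift_y.
  apply: le_trans (ler_normD _ _) _; rewrite normrN; apply: lerD.
    by rewrite normrM (ger0_norm k0) ler_piMl.
  rewrite normrM normfV ler_wpM2r ?invr_ge0// normrM (ger0_norm (_ : 0 <= 2))//.
  by rewrite ler_wpM2l// kc_le.
have AB : A ^+ 2 + B ^+ 2 <= 4 * (1 - `|rho|) * lam.
  apply: (@le_trans _ _ (drift_x ^+ 2 + drift_y ^+ 2)).
    apply: lerD; rewrite -[leLHS]real_normK ?num_real// ler_sqr ?nnegrE//.
      exact: le_trans hA.
    exact: le_trans hB.
  rewrite [leRHS]mulrC -ler_pdivrMr// mulr_gt0// subr_gt0//.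
have := quad_ge0 p (sigma * q) w r1 AB => Q.
set X := (X in 0 <= X).
suff -> : X = z.2 * D * (p ^+ 2 + 2 * rho * p * (sigma * q) + (sigma * q) ^+ 2 +
    A * p * w + B * (sigma * q) * w + lam * w ^+ 2).
  by rewrite mulr_ge0// mulr_ge0// ltW.
by rewrite /X /A /B; field; rewrite gt_eqF.
Qed.

Lemma wderiv_scale (e : R * R) (f g : R * R -> R) k : is_wderiv e f g ->
  is_wderiv e (fun z => k * f z) (fun z => k * g z).
Proof.
move=> h; have := wderiv_lin (k - 1) h h.
rewrite (_ : (fun z => f z + _) = (fun z => k * f z)).
  by rewrite (_ : (fun z => g z + _) = (fun z => k * g z))//; apply/funext => z; ring.
by apply/funext => z; ring.
Qed.

Lemma ae_and (P Q : R -> Prop) : {ae leb1, forall t, P t} ->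
  {ae leb1, forall t, Q t} -> {ae leb1, forall t, P t /\ Q t}.
Proof. by apply: (@ae_imp2 _ (mR R) R leb1) => t p q. Qed.

Section integrability_of_forms.
Variables (f fx fy g gx gy : R * R -> R).
Hypothesis iF : m.-integrable halfplane (EFin \o (fun z => densV f fx fy z)).
Hypothesis iG : m.-integrable halfplane (EFin \o (fun z => densV g gx gy z)).

Lemma L1_principal_form : measurable_fun setT (fx : mR2 R -> mR R) ->
  measurable_fun setT (fy : mR2 R -> mR R) ->
  measurable_fun setT (gx : mR2 R -> mR R) ->
  measurable_fun setT (gy : mR2 R -> mR R) ->
  m.-integrable halfplane (EFin \o (fun z => pform fx fy gx gy z)).
Proof.
move=> m1 m2 m3 m4; have mh := @measurable_halfplane R.
apply: (@L1_le _ _ _ m _ _ (fun z => (1 + 2 * `|rho * sigma| + sigma ^+ 2) *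
    (densV f fx fy z + densV g gx gy z))) => //.
- by apply: measurable_principal_form => //; exact: measurable_funTS.
- by move=> z hz; exact: principal_form_le.
- by apply: L1Z => //; exact: L1D.
Qed.

Lemma L1_drift_form : measurable_fun setT (fx : mR2 R -> mR R) ->
  measurable_fun setT (fy : mR2 R -> mR R) ->
  measurable_fun setT (g : mR2 R -> mR R) ->
  m.-integrable halfplane (EFin \o (fun z => dform fx fy g z)).
Proof.
move=> m1 m2 m3; have mh := @measurable_halfplane R.
apply: (@L1_le _ _ _ m _ _ (fun z => ((1 + `|gamma| + `|mu * rho * sigma|) / 2 +
    (`|kappa| + `|gamma * rho * sigma / 2| + `|mu * sigma ^+ 2 / 2|)) *
    (densV f fx fy z + densV g gx gy z))) => //.
- by apply: measurable_drift_form => //; exact: measurable_funTS.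
- by move=> z hz; exact: drift_form_le.
- by apply: L1Z => //; exact: L1D.
Qed.

Lemma L1_pairing (h : R * R -> R) :
  m.-integrable halfplane (EFin \o (fun z => h z ^+ 2)) ->
  measurable_fun setT (h : mR2 R -> mR R) ->
  measurable_fun setT (g : mR2 R -> mR R) ->
  m.-integrable halfplane (EFin \o (fun z => h z * g z)).
Proof.
move=> ih mh' mg; have mh := @measurable_halfplane R.
apply: (@L1_le _ _ _ m _ _ (fun z => h z ^+ 2 + densV g gx gy z)) => //.
- by apply: measurable_funTS; exact: measurable_funM.
- move=> z hz; have y0 : 0 < z.2 by [].
  apply: (@le_trans _ _ (h z ^+ 2 + g z ^+ 2)).
    have h1 := sqr_ge0 (h z - g z); have h2 := sqr_ge0 (h z + g z).
    have h3 := sqr_ge0 (h z); have h4 := sqr_ge0 (g z).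
    by rewrite ler_norml; apply/andP; split; lra.
  rewrite lerD2l /densV.
  have g1 : 0 <= z.2 * (gx z ^+ 2 + gy z ^+ 2).
    by rewrite mulr_ge0 ?addr_ge0 ?sqr_ge0// ltW.
  have g2 : 0 <= z.2 * g z ^+ 2 by rewrite mulr_ge0 ?sqr_ge0// ltW.
  lra.
- exact: L1D.
Qed.

End integrability_of_forms.

(** The variational inequality tested with [u + k * W]: the sign of [k] is free,
    [k = -1] serving for the first solution and [k = 1] for the second. *)
Lemma test_inequality (T k : R) (psi u ux uy du W Wx Wy : R -> R * R -> R) :
  L2Vgrad kappa theta sigma gamma mu T u ux uy ->
  L2Vgrad kappa theta sigma gamma mu T W Wx Wy ->
  L2H T m du ->
  (forall v, L2V T m v -> ae_cyl T (fun t z => psi t z <= v t z) ->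
    {ae leb1, forall t, timeset T t ->
      0 <= - dotH m (du t) (v t \- u t)
           + aform kappa theta sigma rho gamma mu (u t) (v t \- u t)}) ->
  ae_cyl T (fun t z => psi t z <= u t z + k * W t z) ->
  {ae leb1, forall t, timeset T t ->
    0 <= k * (- (\int[m]_(z in halfplane) (du t z * W t z)) +
      2^-1 * \int[m]_(z in halfplane) pform (ux t) (uy t) (Wx t) (Wy t) z +
      \int[m]_(z in halfplane) dform (ux t) (uy t) (W t) z)}.
Proof.
move=> Lu LW Ldu VI adm.
have mh := @measurable_halfplane R.
have [[mu0 mux muy] Du iu] := Lu; have [[mW mWx mWy] DW iW] := LW.
have Lv : L2V T m (fun t z => u t z + k * W t z).
  apply/L2VgradP; eexists; eexists; exact: L2Vgrad_lin Lu LW.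
have V := VI _ Lv adm.
have iu' := ae_L1_slice iu; have iW' := ae_L1_slice iW.
have idu' := ae_L1_slice (L2H_L1 Ldu).
have all := ae_and (ae_and Du DW) (ae_and (ae_and iu' iW') (ae_and idu' V)).
apply: (@ae_imp _ (mR R) R leb1 _ _ _ all) => t.
move=> [[h1 h2] [[h3 h4] [h5 ineq]]] ht; have [Dx Dy] := h1 ht.
have [Wdx Wdy] := h2 ht; have {}ineq := ineq ht.
have iu0 := h3 ht; have iW0 := h4 ht; have idu0 := h5 ht.
have mWt := measurable_slice1 t mW.
have mf := measurable_slice1 t mux; have mf' := measurable_slice1 t muy.
have mg := measurable_slice1 t mWx; have mg' := measurable_slice1 t mWy.
have [mdu _] := Ldu; have mdut := measurable_slice1 t mdu.
have vE : (fun z => u t z + k * W t z) \- u t = (fun z => k * W t z).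
  by apply/funext => z /=; ring.
rewrite vE in ineq; move: ineq.
have mkW : measurable_fun setT (fun z : mR2 R => k * W t z : mR R).
  exact: measurable_funM.
rewrite (aformE kappa theta sigma rho gamma mu mkW Dx Dy (wderiv_scale k Wdx) (wderiv_scale k Wdy)).
have i2 := L1_principal_form iu0 iW0 mf mf' mg mg'.
have i1 := L1_drift_form iu0 iW0 mf mf' mWt.
have i0 := L1_pairing iW0 idu0 mdut mWt.
have -> : dotH m (du t) (fun z => k * W t z) =
    k * \int[m]_(z in halfplane) (du t z * W t z).
  by rewrite /dotH -RintegralZl//; apply: eq_Rintegral => z _; ring.
have -> : \int[m]_(z in halfplane) pform (ux t) (uy t) (fun z => k * Wx t z)
    (fun z => k * Wy t z) z =
    k * \int[m]_(z in halfplane) pform (ux t) (uy t) (Wx t) (Wy t) z.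
  by rewrite -RintegralZl//; apply: eq_Rintegral => z _; rewrite /principal_form; ring.
have -> : \int[m]_(z in halfplane) dform (ux t) (uy t) (fun z => k * W t z) z =
    k * \int[m]_(z in halfplane) dform (ux t) (uy t) (W t) z.
  by rewrite -RintegralZl//; apply: eq_Rintegral => z _; rewrite /drift_form; ring.
move=> h; apply: le_trans h _; rewrite le_eqVlt; apply/orP; left; apply/eqP.
by ring.
Qed.

End tested_inequality.

Section sign_of_the_rate.
Context {R : realType}.
Variables (kappa theta sigma rho gamma mu : R).
Local Notation m := (wmeas kappa theta sigma gamma mu).
Local Notation lm := (leb1 \x m)%E.
Local Notation pform := (principal_form sigma rho).
Local Notation dform := (drift_form kappa sigma rho gamma mu).
Local Notation L2Vgrad := (L2Vgrad kappa theta sigma gamma mu).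
Implicit Types (z : R * R).

(** Where [W > 0], [u1 - W >= u2 + c >= psi2 + c >= psi1], and elsewhere
    [u1 - W = u1 >= psi1]; so [u1 - W] is admissible for the first obstacle, as
    is [u2 + W] for the second.  The sum of the two inequalities bounds the
    pairing of [dd] with [W] from below by the form, and [form_ge0] compares the
    form with the term created by the damping. *)
Lemma rate_nonneg (T S lam c : R) (psi1 psi2 u1 u2 du1 du2 : R -> R * R -> R) :
  let VI psi u du := forall v, L2V T m v ->
    ae_cyl T (fun t z => psi t z <= v t z) ->
    {ae leb1, forall t, timeset T t ->
      0 <= - dotH m (du t) (v t \- u t)
           + aform kappa theta sigma rho gamma mu (u t) (v t \- u t)} in
  0 < sigma -> `|rho| < 1 -> damping_rate kappa sigma rho gamma mu <= lam ->
  0 <= lam -> 0 <= c -> 0 <= S <= T ->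
  L2V T m u1 -> L2V T m u2 -> L2H T m du1 -> L2H T m du2 ->
  VI psi1 u1 du1 -> VI psi2 u2 du2 ->
  ae_cyl T (fun t z => psi1 t z <= u1 t z) ->
  ae_cyl T (fun t z => psi2 t z <= u2 t z) ->
  ae_cyl T (fun t z => psi1 t z <= psi2 t z + c) ->
  {ae leb1, forall t, timeset T t -> lam * `|S - t| <= 1 ->
    0 <= \int[m]_(z in halfplane) energy_rate lam S c (fun t z => u1 t z - u2 t z)
      (fun t z => du1 t z - du2 t z) t z}.
Proof.
move=> VI s0 r1 lam1 l0 c0 ST L1 L2 Ld1 Ld2 V1 V2 p1 p2 p12.
have mh := @measurable_halfplane R.
have [u1x [u1y G1]] := (L2VgradP kappa theta sigma gamma mu T u1).1 L1.
have [u2x [u2y G2]] := (L2VgradP kappa theta sigma gamma mu T u2).1 L2.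
pose d t z := u1 t z - u2 t z; pose dd t z := du1 t z - du2 t z.
pose dx t z := u1x t z - u2x t z; pose dy t z := u1y t z - u2y t z.
have Gd : L2Vgrad T d dx dy.
  have := L2Vgrad_lin (-1) G1 G2.
  have e (a b : R -> R * R -> R) : (fun t z => a t z + -1 * b t z) =
      (fun t z => a t z - b t z).
    by apply/funext => t; apply/funext => z; ring.
  by rewrite !e.
pose W := wdamp lam S c d; pose Wx := wdamp_x lam S c d dx.
pose Wy := wdamp_y lam S c d dy.
have GW : L2Vgrad T W Wx Wy by exact: L2Vgrad_wdamp.
have Wb t z : halfplane z -> 0 <= W t z <= pos (d t z - c).
  move=> hz; have w0 := pos_ge0 (d t z - c).
  have D0 := damp_gt0 lam S t z; have D1 := damp_le1 S t l0 hz.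
  by rewrite /W /wdamp mulr_ge0 ?(ltW D0)//= ler_piMl.
have a1 : ae_cyl T (fun t z => psi1 t z <= u1 t z + (-1) * W t z).
  have h : {ae leb3, forall p, (cylinder T p -> psi1 p.1 p.2 <= u1 p.1 p.2) /\
      (cylinder T p -> psi2 p.1 p.2 <= u2 p.1 p.2)}.
    by apply: (@ae_imp2 _ (mR3 R) R leb3 _ _ _ _ p1 p2) => p ? ?; split.
  apply: (@ae_imp2 _ (mR3 R) R leb3 _ _ _ _ h p12) => p [h1 h2] h3 hp.
  have := h1 hp; have := h2 hp; have := h3 hp; have [_ hz] := hp.
  have /andP[] := Wb p.1 p.2 hz; rewrite /pos /d.
  by case: (leP (u1 p.1 p.2 - u2 p.1 p.2 - c) 0) => ? ? ? ? ? ?; lra.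
have a2 : ae_cyl T (fun t z => psi2 t z <= u2 t z + 1 * W t z).
  apply: (@ae_imp _ (mR3 R) R leb3 _ _ _ p2) => p h hp.
  by have [_ hz] := hp; have := h hp; have /andP[] := Wb p.1 p.2 hz; lra.
have T1 := test_inequality G1 GW Ld1 V1 a1.
have T2 := test_inequality G2 GW Ld2 V2 a2.
have [[mu1 mu1x mu1y] _ i1] := G1; have [[mu2 mu2x mu2y] _ i2] := G2.
have [[mW mWx mWy] _ iW] := GW; have [[md mdx mdy] _ id] := Gd.
have s1 := ae_L1_slice i1; have s2 := ae_L1_slice i2; have sW := ae_L1_slice iW.
have sd1 := ae_L1_slice (L2H_L1 Ld1); have sd2 := ae_L1_slice (L2H_L1 Ld2).
have sd := ae_L1_slice id.
have [mdu1 _] := Ld1; have [mdu2 _] := Ld2.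
have all := ae_and (ae_and (ae_and T1 T2) (ae_and s1 s2)) (ae_and (ae_and sW sd) (ae_and sd1 sd2)).
apply: (@ae_imp _ (mR R) R leb1 _ _ _ all) => t.
move=> [[[t1 t2] [n1 n2]] [[nW nd] [nd1 nd2]]] ht lS.
have {}t1 := t1 ht; have {}t2 := t2 ht; have {}n1 := n1 ht; have {}n2 := n2 ht.
have {}nW := nW ht; have {}nd := nd ht; have {}nd1 := nd1 ht; have {}nd2 := nd2 ht.
have q1x := measurable_slice1 t mu1x; have q1y := measurable_slice1 t mu1y.
have q2x := measurable_slice1 t mu2x; have q2y := measurable_slice1 t mu2y.
have qWx := measurable_slice1 t mWx; have qWy := measurable_slice1 t mWy.
have qW := measurable_slice1 t mW; have qd := measurable_slice1 t md.
have qdx := measurable_slice1 t mdx; have qdy := measurable_slice1 t mdy.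
have f21 := L1_principal_form rho n1 nW q1x q1y qWx qWy.
have f22 := L1_principal_form rho n2 nW q2x q2y qWx qWy.
have f2d := L1_principal_form rho nd nW qdx qdy qWx qWy.
have f11 := L1_drift_form rho n1 nW q1x q1y qW.
have f12 := L1_drift_form rho n2 nW q2x q2y qW.
have f1d := L1_drift_form rho nd nW qdx qdy qW.
have g1 := L1_pairing nW nd1 (measurable_slice1 t mdu1) qW.
have g2 := L1_pairing nW nd2 (measurable_slice1 t mdu2) qW.
move: t1 t2.
set A1 := \int[m]_(z in halfplane) (du1 t z * W t z).
set A2 := \int[m]_(z in halfplane) (du2 t z * W t z).
set B1 := \int[m]_(z in halfplane) pform (u1x t) (u1y t) _ _ z.
set B2 := \int[m]_(z in halfplane) pform (u2x t) (u2y t) _ _ z.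
set C1 := \int[m]_(z in halfplane) dform (u1x t) (u1y t) _ z.
set C2 := \int[m]_(z in halfplane) dform (u2x t) (u2y t) _ z.
move=> t1 t2.
have eA : \int[m]_(z in halfplane) (dd t z * W t z) = A1 - A2.
  rewrite -RintegralB//; apply: eq_Rintegral => z _; rewrite /dd; ring.
have eB : \int[m]_(z in halfplane) pform (dx t) (dy t) (Wx t) (Wy t) z = B1 - B2.
  rewrite -RintegralB//; apply: eq_Rintegral => z _; rewrite /principal_form /dx /dy; ring.
have eC : \int[m]_(z in halfplane) dform (dx t) (dy t) (W t) z = C1 - C2.
  rewrite -RintegralB//; apply: eq_Rintegral => z _; rewrite /drift_form /dx /dy; ring.
have iddW : m.-integrable halfplane (EFin \o (fun z => dd t z * W t z)).
  rewrite (_ : (fun z => _) = (fun z => du1 t z * W t z - du2 t z * W t z)).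
    exact: L1B.
  by apply/funext => z; rewrite /dd; ring.
pose E z := lam * z.2 * pos (d t z - c) * W t z.
have iE : m.-integrable halfplane (EFin \o E).
  apply: (@L1_le _ _ _ m _ _ (fun z => lam * densV (d t) (dx t) (dy t) z)) => //.
  - apply: measurable_funTS; rewrite /E.
    apply: (@measurable_funM _ (mR2 R) R _ (fun z => lam * z.2 * pos (d t z - c)) (W t)) => //.
    apply: (@measurable_funM _ (mR2 R) R _ (fun z => lam * z.2) (fun z => pos (d t z - c))).
      by apply: measurable_funM => //; exact: measurable_snd.
    exact: measurable_slice1 (measurable_wpos c md).
  - move=> z hz; have y0 : 0 < z.2 by []; have /andP[W0 W1] := Wb t z hz.
    have w0 := pos_ge0 (d t z - c).
    rewrite /E ger0_norm; last by apply: mulr_ge0 => //; apply: mulr_ge0 => //; apply: mulr_ge0 => //; exact: ltW.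
    rewrite -!mulrA ler_wpM2l// /densV.
    have wd := pos_sub_le (d t z) c0.
    have h1 : pos (d t z - c) * W t z <= d t z ^+ 2.
      rewrite -(real_normK (num_real (d t z))) expr2 ler_pM//.
      exact: le_trans wd.
    have h2 := ler_wpM2l (ltW y0) h1.
    have h3 : 0 <= z.2 * (dx t z ^+ 2 + dy t z ^+ 2).
      by rewrite mulr_ge0 ?addr_ge0 ?sqr_ge0// ltW.
    have h4 := sqr_ge0 (d t z).
    clear -h2 h3 h4; lra.
  - exact: L1Z.
have -> : \int[m]_(z in halfplane) energy_rate lam S c d dd t z =
    2 * \int[m]_(z in halfplane) (dd t z * W t z) + \int[m]_(z in halfplane) E z.
  rewrite -RintegralZl// -RintegralD//; last exact: L1Z.
  by apply: eq_Rintegral => z _; rewrite /energy_rate /E /W /wdamp; ring.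
have F0 : 0 <= \int[m]_(z in halfplane) (pform (dx t) (dy t) (Wx t) (Wy t) z +
    2 * dform (dx t) (dy t) (W t) z + E z).
  by apply: Rintegral_ge0 => z hz; exact: form_ge0.
move: F0; rewrite RintegralD//; last by apply: L1D => //; exact: L1Z.
rewrite RintegralD//; last exact: L1Z.
rewrite RintegralZl// eB eC eA => F0.
clear -t1 t2 F0; lra.
Qed.

End sign_of_the_rate.

(** * Backward propagation *)

Section almost_everywhere.
Context {R : realType}.

Lemma ae_itv_exists (P : R -> Prop) (a b : R) : a < b ->
  {ae leb1, forall t, P t} -> exists2 t, a < t < b & P t.
Proof.
move=> ab [N [mN N0 sN]]; apply: contrapT => h.
have : (leb1 (`]a, b[ : set (mR R)) <= leb1 N)%E.
  apply: le_measure; rewrite ?inE//.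
  move=> t /=; rewrite in_itv/= => tab; apply: sN => /= Pt.
  by apply: h; exists t.
rewrite N0 /leb1 lebesgue_measure_itv/= lte_fin ab -EFinD lee_fin.
by apply/negP; rewrite -ltNge subr_gt0.
Qed.

Lemma Rintegral_le0_ae d (T : measurableType d) (mu : {measure set T -> \bar R})
    (D : set T) (f : T -> R) : measurable D -> mu.-integrable D (EFin \o f) ->
  (forall x, D x -> 0 <= f x) -> \int[mu]_(x in D) f x <= 0 ->
  {ae mu, forall x, D x -> f x = 0}.
Proof.
move=> mD if_ f0 le0.
have E : (\int[mu]_(x in D) `|(EFin \o f) x| = 0)%E.
  have -> : (\int[mu]_(x in D) `|(EFin \o f) x| = \int[mu]_(x in D) (f x)%:E)%E.
    by apply: eq_integral => x /set_mem Dx; rewrite gee0_abs// lee_fin f0.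
  rewrite -[LHS]fineK ?integrable_fin_num//; congr EFin; apply/eqP.
  by rewrite eq_le le0/= Rintegral_ge0.
have := (ae_eq_integral_abs mu mD (measurable_int mu if_)).1 E.
by apply: ae_imp => x h Dx; have [] := h Dx.
Qed.

(** Steps of length [h / 2] are taken although a step covers a length [h]: each
    one starts strictly inside the interval already treated, where [P] is known
    almost everywhere up to the starting time. *)
Lemma backward_induction (T h : R) (P : R -> Prop) : 0 < h ->
  (forall S, 0 < S <= T ->
     S = T \/ (exists2 r, r < S & {ae leb1, forall t, r < t < T -> 0 < t -> P t}) ->
     {ae leb1, forall t, S - h < t < S -> 0 < t -> P t}) ->
  0 < T -> {ae leb1, forall t, 0 < t < T -> P t}.
Proof.
move=> h0 step T0.
have A k : {ae leb1, forall t, T - h - k%:R * (h / 2) < t < T -> 0 < t -> P t}.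
  elim: k => [|k IH].
    by rewrite mul0r subr0; apply: step; [rewrite T0 lexx|left].
  set r := T - h - k%:R * (h / 2) in IH.
  have rT : r < T.
    have : 0 <= k%:R * (h / 2) by rewrite mulr_ge0// divr_ge0// ltW.
    rewrite /r; lra.
  have eS : T - h - k.+1%:R * (h / 2) = r - h / 2 by rewrite /r -natr1; ring.
  rewrite eS; pose S := Num.min T (r + h / 2).
  have rS : r < S by rewrite /S lt_min rT/=; lra.
  have ST : S <= T by rewrite /S ge_min lexx.
  have Sr : S <= r + h / 2 by rewrite /S ge_min lexx orbT.
  have [S0|S0] := leP S 0.
    apply: (@ae_imp _ (mR R) R leb1 _ _ _ IH) => t ih /andP[_ tT] t0.
    by apply: ih => //; rewrite tT andbT; apply: lt_trans rS _; exact: le_lt_trans t0.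
  have := step S; rewrite S0 ST => /(_ isT) H.
  have {}H := H (or_intror (ex_intro2 _ _ r rS IH)).
  apply: (@ae_imp2 _ (mR R) R leb1 _ _ _ _ IH H) => t p q /andP[t1 t2] t0.
  have [tr|tr] := ltP r t; first by apply: p => //; rewrite tr t2.
  by apply: q => //; rewrite (le_lt_trans tr rS) andbT; lra.
have [k hk] : exists k : nat, T - h - k%:R * (h / 2) <= 0.
  exists (Num.bound `|(T - h) / (h / 2)|); rewrite subr_le0 -ler_pdivrMr ?divr_gt0//.
  apply: le_trans (ler_norm _) _; exact: ltW (archi_boundP (normr_ge0 _)).
apply: (@ae_imp _ (mR R) R leb1 _ _ _ (A k)) => t p /andP[t0 tT].
by apply: p => //; rewrite tT andbT; exact: le_lt_trans t0.
Qed.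

End almost_everywhere.

Section terminal_time.
Context {R : realType}.
Variables (m : {measure set (mR2 R) -> \bar R}).
Implicit Types (f g : R * R -> R) (z : R * R).

Lemma CH_sqr (T : R) u t : CH T m u -> timeset T t ->
  m.-integrable halfplane (EFin \o (fun z => u t z ^+ 2)).
Proof.
move=> [mu cu] ht; have [h _] := cu t ht.
exact: integrableS measurableT (@measurable_halfplane R) (@subsetT _ _) (Lfun2_integrable_sqr h).
Qed.

Lemma CH_cvg (T : R) u : 0 <= T -> CH T m u -> forall e, 0 < e ->
  exists2 n, 0 < n & forall s, 0 <= s <= T -> T - n < s ->
    m.-integrable halfplane (EFin \o (fun z => (u s z - u T z) ^+ 2)) /\
    \int[m]_(z in halfplane) (u s z - u T z) ^+ 2 <= e.
Proof.
move=> T0 [mu cu] e e0.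
have hT : timeset T T by rewrite /timeset/= in_itv/= T0 lexx.
have [_ c] := cu T hT.
move: c => /fine_cvgP[fin cv].
have de : 0 < Num.min e 1 by rewrite lt_min e0/=.
have [r /= r0 hr] := filterI (cvgr0_norm_le _ cv _ de) fin.
exists r => // s /andP[s0 sT] sr.
have hs : timeset T s by rewrite /timeset/= in_itv/= s0 sT.
have bs : ball T r s by rewrite /ball/= ger0_norm ?subr_ge0//; lra.
have [fs1 fs2] := hr s bs hs.
have mh := @measurable_halfplane R.
pose f z := (u s z - u T z) ^+ 2.
have mf : measurable_fun setT (f : mR2 R -> mR R).
  apply: measurable_funX; apply: measurable_funB; exact: (measurable_slice1 _ mu).
have f0 z : (0 <= (f z)%:E)%E by rewrite lee_fin sqr_ge0.
have I : (\int[m]_z (f z)%:E <= e%:E)%E.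
  rewrite -(Lnorm2_sq m (u s \- u T)) -(fineK fs2) -EFin_expe lee_fin.
  move: fs1; rewrite /= ger0_norm ?fine_ge0 ?Lnorm_ge0// le_min => /andP[h1 h2].
  have h0 : 0 <= fine ('N[m]_2%:E[EFin \o (u s \- u T)%R])%E by rewrite fine_ge0 ?Lnorm_ge0.
  by rewrite expr2; apply: le_trans h1; rewrite ler_piMr.
have iT : m.-integrable setT (EFin \o f).
  apply/integrableP; split; first exact/measurable_EFinP.
  have -> : (\int[m]_z `|(EFin \o f) z| = \int[m]_z (f z)%:E)%E.
    by apply: eq_integral => z _; rewrite gee0_abs//; exact: f0.
  exact: le_lt_trans I (ltry _).
have iH : m.-integrable halfplane (EFin \o f) by apply: integrableS iT.
split => //; rewrite -lee_fin /Rintegral fineK; last exact: integrable_fin_num.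
apply: le_trans I; apply: ge0_subset_integral => //.
  exact/measurable_EFinP.
by move=> z _; exact: f0.
Qed.

(** The integrand of the energy before damping; it vanishes exactly where
    [f1 <= f2 + c]. *)
Definition excess c f1 f2 z : R := pos (f1 z - f2 z - c) ^+ 2.

Lemma excess_le_sqr c f1 f2 z : 0 <= c ->
  excess c f1 f2 z <= 2 * f1 z ^+ 2 + 2 * f2 z ^+ 2.
Proof.
move=> c0; apply: le_trans (sqr_pos_sub_le _ c0) _.
by have := sqr_ge0 (f1 z + f2 z); lra.
Qed.

Lemma excess_ge0 c f1 f2 z : 0 <= excess c f1 f2 z.
Proof. exact: sqr_ge0. Qed.

(** If [g1 - g2 <= c], then [f1 - f2 - c] is at most the difference of [f1 - g1]
    and [f2 - g2]. *)
Lemma excess_le_diff c f1 f2 g1 g2 z : g1 z - g2 z <= c ->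
  excess c f1 f2 z <= 2 * (f1 z - g1 z) ^+ 2 + 2 * (f2 z - g2 z) ^+ 2.
Proof.
move=> gc; rewrite /excess /pos.
set a := f1 z - g1 z; set b := f2 z - g2 z.
have ab : f1 z - f2 z - c <= a - b by rewrite /a /b; lra.
have := sqr_ge0 (a + b); have := sqr_ge0 a; have := sqr_ge0 b.
case: (leP (f1 z - f2 z - c) 0) => h; first by rewrite expr0n/=; lra.
have h' : (f1 z - f2 z - c) ^+ 2 <= (a - b) ^+ 2 by nra.
by move: h'; nra.
Qed.

Lemma measurable_excess c f1 f2 : measurable_fun setT (f1 : mR2 R -> mR R) ->
  measurable_fun setT (f2 : mR2 R -> mR R) ->
  measurable_fun setT (excess c f1 f2 : mR2 R -> mR R).
Proof.
move=> m1 m2; apply: measurable_funX; apply: measurableT_comp measurable_pos _.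
by apply: measurable_funB => //; exact: measurable_funB.
Qed.

Lemma L1_excess c f1 f2 : 0 <= c ->
  measurable_fun setT (f1 : mR2 R -> mR R) ->
  measurable_fun setT (f2 : mR2 R -> mR R) ->
  m.-integrable halfplane (EFin \o (fun z => f1 z ^+ 2)) ->
  m.-integrable halfplane (EFin \o (fun z => f2 z ^+ 2)) ->
  m.-integrable halfplane (EFin \o excess c f1 f2).
Proof.
move=> c0 m1 m2 i1 i2; have mh := @measurable_halfplane R.
apply: (@L1_le _ _ _ m _ _ (fun z => 2 * f1 z ^+ 2 + 2 * f2 z ^+ 2)) => //.
- by apply: measurable_funTS; exact: measurable_excess.
- by move=> z _; rewrite ger0_norm ?excess_ge0//; exact: excess_le_sqr.
- by apply: L1D => //; exact: L1Z.
Qed.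

Lemma excess_Rintegral_le c f1 f2 g1 g2 : 
  measurable_fun setT (f1 : mR2 R -> mR R) ->
  measurable_fun setT (f2 : mR2 R -> mR R) ->
  m.-integrable halfplane (EFin \o excess c f1 f2) ->
  m.-integrable halfplane (EFin \o (fun z => (f1 z - g1 z) ^+ 2)) ->
  m.-integrable halfplane (EFin \o (fun z => (f2 z - g2 z) ^+ 2)) ->
  {ae m, forall z, halfplane z -> g1 z - g2 z <= c} ->
  \int[m]_(z in halfplane) excess c f1 f2 z <=
    2 * \int[m]_(z in halfplane) (f1 z - g1 z) ^+ 2 +
    2 * \int[m]_(z in halfplane) (f2 z - g2 z) ^+ 2.
Proof.
move=> m1 m2 iE i1 i2 gc; have mh := @measurable_halfplane R.
rewrite -!RintegralZl// -RintegralD//; [|exact: L1Z..].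
have iS := L1D mh (L1Z 2 mh i1) (L1Z 2 mh i2).
rewrite -subr_ge0 -RintegralB//.
apply: ae_Rintegral_ge0 => //; first exact: L1_meas (L1B mh iS iE).
by apply: ae_imp gc => z gc hz; rewrite subr_ge0 excess_le_diff// gc.
Qed.

End terminal_time.

(** * The order at the terminal time *)

Section order_at_terminal_time.
Context {R : realType}.
Variables (kappa theta sigma gamma mu : R).
Local Notation m := (wmeas kappa theta sigma gamma mu).
Implicit Types (u : R -> R * R -> R) (z : R * R).

Lemma ae_cyl_slice (T : R) (P : R -> R * R -> Prop) : ae_cyl T P ->
  {ae leb1, forall t, timeset T t -> {ae m, forall z, halfplane z -> P t z}}.
Proof.
move=> /ae_prod1; apply: (@ae_imp _ (mR R) R leb1) => t h ht.
by apply: ae_wmeas; apply: (@ae_imp _ (mR2 R) R leb2 _ _ _ h) => z hP hz; exact: hP.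
Qed.

(** [excess_le_diff] against the terminal values, which are ordered. *)
Lemma excess_near_terminal (T c : R) u1 u2 : 0 <= T -> 0 <= c ->
  CH T m u1 -> CH T m u2 ->
  {ae m, forall z, halfplane z -> u1 T z - u2 T z <= c} ->
  forall e, 0 < e -> exists2 n, 0 < n & forall s, 0 <= s <= T -> T - n < s ->
    \int[m]_(z in halfplane) excess c (u1 s) (u2 s) z <= e.
Proof.
move=> T0 c0 C1 C2 uc e e0; have e4 : 0 < e / 4 by rewrite divr_gt0.
have [n1 n10 h1] := CH_cvg T0 C1 e4; have [n2 n20 h2] := CH_cvg T0 C2 e4.
exists (Num.min n1 n2); first by rewrite lt_min n10.
move=> s hs; rewrite ltrBlDr -ltrBlDl lt_min => /andP[s1 s2].
have [i1 l1] : _ /\ _ := h1 s hs ltac:(clear -s1 s2; lra).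
have [i2 l2] : _ /\ _ := h2 s hs ltac:(clear -s1 s2; lra).
have [mu1 _] := C1; have [mu2 _] := C2.
have m1 := measurable_slice1 s mu1; have m2 := measurable_slice1 s mu2.
have ts : timeset T s by case/andP: hs => *; exact: in_timeset.
have iE := L1_excess c0 m1 m2 (CH_sqr C1 ts) (CH_sqr C2 ts).
apply: le_trans (excess_Rintegral_le m1 m2 iE i1 i2 uc) _; lra.
Qed.

(** The order is known only at almost every time; such times accumulate at [T],
    and [excess_le_diff], used from those times to [T], lets it pass to the
    limit. *)
Lemma order_terminal (T c : R) u1 u2 : 0 < T -> 0 <= c ->
  CH T m u1 -> CH T m u2 -> ae_cyl T (fun t z => u1 t z <= u2 t z + c) ->
  {ae m, forall z, halfplane z -> u1 T z - u2 T z <= c}.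
Proof.
move=> T0 c0 C1 C2 /ae_cyl_slice uc; have mh := @measurable_halfplane R.
have hT : timeset T T := in_timeset (ltW T0) (lexx T).
have [mu1 _] := C1; have [mu2 _] := C2.
have m1 := measurable_slice1 T mu1; have m2 := measurable_slice1 T mu2.
have iE := L1_excess c0 m1 m2 (CH_sqr C1 hT) (CH_sqr C2 hT).
have : \int[m]_(z in halfplane) excess c (u1 T) (u2 T) z <= 0.
  apply/ler_addgt0Pr => e e0; rewrite add0r.
  have e4 : 0 < e / 4 by rewrite divr_gt0.
  have [n1 n10 h1] := CH_cvg (ltW T0) C1 e4; have [n2 n20 h2] := CH_cvg (ltW T0) C2 e4.
  pose a := Num.max 0 (T - Num.min n1 n2).
  have aT : a < T by rewrite gt_max T0/= ltrBlDr -ltrBlDl subrr lt_min n10.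
  have [s /andP[sa sT] us] := ae_itv_exists aT uc.
  move: sa; rewrite gt_max => /andP[s0]; rewrite ltrBlDr -ltrBlDl lt_min => /andP[s1 s2].
  have hs : 0 <= s <= T by rewrite (ltW s0) (ltW sT).
  have ts : timeset T s by case/andP: hs => *; exact: in_timeset.
  have [i1 l1] : _ /\ _ := h1 s hs ltac:(clear -s1 s2; lra).
  have [i2 l2] : _ /\ _ := h2 s hs ltac:(clear -s1 s2; lra).
  have sw u z : (u T z - u s z) ^+ 2 = (u s z - u T z) ^+ 2 by ring.
  have := @excess_Rintegral_le _ m c (u1 T) (u2 T) (u1 s) (u2 s) m1 m2 iE.
  rewrite (_ : (fun z => (u1 T z - _) ^+ 2) = (fun z => (u1 s z - u1 T z) ^+ 2)); last first.
    by apply/funext => z; exact: sw.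
  rewrite (_ : (fun z => (u2 T z - _) ^+ 2) = (fun z => (u2 s z - u2 T z) ^+ 2)); last first.
    by apply/funext => z; exact: sw.
  move=> H; apply: le_trans (H i1 i2 _) _; last by clear -l1 l2; lra.
  by apply: ae_imp (us ts) => z h hz; rewrite lerBlDl; exact: h hz.
move=> le0; have := Rintegral_le0_ae mh iE (fun z _ => excess_ge0 c _ _ z) le0.
apply: ae_imp => z h hz; have /eqP := h hz.
rewrite /excess sqrf_eq0 /pos => /eqP h0; rewrite -subr_le0 -h0.
by rewrite le_max lexx.
Qed.

End order_at_terminal_time.

(** * One step backward in time *)

Section backward_step.
Context {R : realType}.
Variables (kappa theta sigma gamma mu : R).
Local Notation m := (wmeas kappa theta sigma gamma mu).
Local Notation lm := (leb1 \x m)%E.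
Implicit Types (u du : R -> R * R -> R) (z : R * R).

Lemma L1_weighted_sqrB (T : R) u1 u2 : L2V T m u1 -> L2V T m u2 ->
  lm.-integrable (cylinder T)
    (EFin \o (fun p => (1 + p.2.2) * (u1 p.1 p.2 - u2 p.1 p.2) ^+ 2)).
Proof.
move=> /L2VgradP[u1x [u1y G1]] /L2VgradP[u2x [u2y G2]].
have mC := @measurable_cylinder R T.
have [[md mdx mdy] _ id] := L2Vgrad_lin (-1) G1 G2.
apply: L1_le id => //.
  apply: measurable_funTS; apply: measurable_funM; first exact: measurable_funD _ measurable_y.
  apply: measurable_funX; apply: measurable_funB; [case: G1 => -[]//|case: G2 => -[]//].
move=> [t z] [_ hz] /=; have y0 : 0 < z.2 by [].
rewrite /densV !mulN1r ger0_norm /=; last first.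
  by rewrite mulr_ge0 ?sqr_ge0// addr_ge0// ltW.
by rewrite lerDr mulr_ge0 ?addr_ge0 ?sqr_ge0// ltW.
Qed.

Lemma L1_sqrB (T : R) u1 u2 : L2H T m u1 -> L2H T m u2 ->
  lm.-integrable (cylinder T) (EFin \o (fun p => (u1 p.1 p.2 - u2 p.1 p.2) ^+ 2)).
Proof.
move=> L1 L2; have mC := @measurable_cylinder R T.
have [mu1 _] := L1; have [mu2 _] := L2.
apply: (@L1_le _ _ _ lm _ _ (fun p => 2 * u1 p.1 p.2 ^+ 2 + 2 * u2 p.1 p.2 ^+ 2)) => //.
- by apply: measurable_funTS; apply: measurable_funX; exact: measurable_funB.
- move=> p _; rewrite ger0_norm ?sqr_ge0//.
  by have := sqr_ge0 (u1 p.1 p.2 + u2 p.1 p.2); lra.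
- by apply: L1D => //; apply: L1Z => //; exact: L2H_L1.
Qed.

Lemma L1_excess_slice (T c : R) u1 u2 : 0 <= c -> L2V T m u1 -> L2V T m u2 ->
  {ae leb1, forall t, timeset T t ->
    m.-integrable halfplane (EFin \o excess c (u1 t) (u2 t))}.
Proof.
move=> c0 L1 L2; have mh := @measurable_halfplane R.
have := ae_L1_slice (L1_weighted_sqrB L1 L2).
have [mu1 _] := L1; have [mu2 _] := L2.
apply: (@ae_imp _ (mR R) R leb1) => t h ht; have {}h := h ht.
apply: L1_le h => //.
  by apply: measurable_funTS; apply: measurable_excess; [exact: (measurable_slice1 _ mu1)|exact: (measurable_slice1 _ mu2)].
move=> z hz; have y0 : 0 < z.2 by [].
rewrite ger0_norm ?excess_ge0//=.
apply: le_trans (sqr_pos_sub_le _ c0) _.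
by rewrite ler_peMl ?sqr_ge0// lerDl ltW.
Qed.

(** The energy is nondecreasing and tends to 0 at [S], hence vanishes before [S].
    As [energy_mono] concerns intervals with closure inside ]0, S[, a sequence of
    intervals increasing to the whole one is used. *)
Lemma backward_step (T S lam c : R) u1 u2 du1 du2 :
  0 < S <= T -> 0 < lam -> 0 <= c ->
  L2V T m u1 -> L2V T m u2 -> L2H T m du1 -> L2H T m du2 ->
  is_wderiv_t T u1 du1 -> is_wderiv_t T u2 du2 ->
  {ae leb1, forall t, timeset T t -> lam * `|S - t| <= 1 ->
    0 <= \int[m]_(z in halfplane) energy_rate lam S c (fun t z => u1 t z - u2 t z)
      (fun t z => du1 t z - du2 t z) t z} ->
  (forall e, 0 < e -> exists2 n, 0 < n & {ae leb1, forall s, S - n < s < S -> 0 < s ->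
    \int[m]_(z in halfplane) excess c (u1 s) (u2 s) z <= e}) ->
  {ae leb1, forall t, S - lam^-1 < t < S -> 0 < t ->
    {ae m, forall z, halfplane z -> excess c (u1 t) (u2 t) z = 0}}.
Proof.
move=> /andP[S0 ST] l0 c0 L1 L2 Ld1 Ld2 D1 D2 rate small.
have mh := @measurable_halfplane R.
have [mu1 _] := L1; have [mu2 _] := L2; have [mdu1 _] := Ld1; have [mdu2 _] := Ld2.
pose r0 := Num.max 0 (S - lam^-1).
have li : 0 < lam^-1 by rewrite invr_gt0.
have r0S : r0 < S by rewrite gt_max S0/=; lra.
have r00 : 0 <= r0 by rewrite le_max lexx.
have r0h : S - lam^-1 <= r0 by rewrite le_max lexx orbT.
(* Exhaustion of ]r0, S[ by the intervals ]a n, b n[; the shift by 3 ensures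
   that [a n < b n] for all [n]. *)
pose q (n : nat) : R := (S - r0) / n.+3%:R.
pose a n := r0 + q n; pose b n := S - q n.
have q0 n : 0 < q n by rewrite divr_gt0// subr_gt0.
have q3 n : 3 * q n <= S - r0.
  rewrite /q mulrCA ler_piMr//; first by rewrite subr_ge0 ltW.
  by rewrite ler_pdivrMr// mul1r ler_nat.
have H n : exists G : R -> Prop, {ae leb1, forall t, a n < t < b n -> G t} /\
   forall t s, G t -> G s -> a n < t -> t < s -> s < b n ->
    \int[m]_(z in halfplane) (pos (u1 t z - u2 t z - c) ^+ 2 * damp lam S t z) <=
    \int[m]_(z in halfplane) (pos (u1 s z - u2 s z - c) ^+ 2 * damp lam S s z).
  have hq := q0 n; have hq3 := q3 n.
  apply: (@energy_mono R kappa theta sigma gamma mu T (a n) (b n) S lam c u1 u2 du1 du2) => //.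
  - by rewrite /a ltr_wpDl.
  - by rewrite /a /b; clear -hq hq3; lra.
  - by rewrite /b; clear -hq ST; lra.
  - by rewrite /b gerBl ltW.
  - exact: ltW.
  - exact: (L1_weighted_sqrB L1 L2).
  - exact: (L1_sqrB Ld1 Ld2).
  - apply: (@ae_imp _ (mR R) R leb1 _ _ _ rate) => t h /andP[at_ tb]; apply: h.
      by apply: in_timeset; rewrite /a /b in at_ tb; clear -at_ tb hq r00 ST; lra.
    rewrite -[leRHS](mulfV (lt0r_neq0 l0)) ler_pM2l// ger0_norm;
      by rewrite /a /b in at_ tb; clear -at_ tb hq r0h; lra.
have [G /all_and2[aeG mono]] := choice H.
have aeG' := ae_foralln aeG.
have ex := L1_excess_slice c0 L1 L2.
apply: (@ae_imp2 _ (mR R) R leb1 _ _ _ _ aeG' ex) => t Gt iE /andP[tl tS] t0.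
have {}tr : r0 < t by rewrite gt_max t0.
have tT : timeset T t := in_timeset (ltW t0) (le_trans (ltW tS) ST).
have {}iE := iE tT.
pose e s z := excess c (u1 s) (u2 s) z * damp lam S s z.
have ee s z : halfplane z -> 0 <= e s z <= excess c (u1 s) (u2 s) z.
  move=> hz; have p0 := damp_gt0 lam S s z; have p1 := damp_le1 S s (ltW l0) hz.
  by rewrite /e mulr_ge0 ?excess_ge0 ?(ltW p0)//= ler_piMr ?excess_ge0.
have ie s : m.-integrable halfplane (EFin \o excess c (u1 s) (u2 s)) ->
    m.-integrable halfplane (EFin \o e s).
  move=> i; apply: L1_le i => //.
    apply: measurable_funTS; apply: measurable_funM.
      by apply: measurable_excess; [exact: (measurable_slice1 _ mu1)|exact: (measurable_slice1 _ mu2)].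
    exact: (measurable_slice1 s (measurable_damp lam S)).
  by move=> z hz; have /andP[h1 h2] := ee s z hz; rewrite ger0_norm.
have le0 : \int[m]_(z in halfplane) e t z <= 0.
  apply/ler_addgt0Pr => eps eps0; rewrite add0r.
  have [n n0 hn] := small _ eps0.
  pose x := Num.min (Num.min (t - r0) (S - t)) n.
  have x0 : 0 < x by rewrite !lt_min !subr_gt0 tr tS.
  have [k qx] : exists k, q k < x.
    exists (Num.bound `|(S - r0) / x|); rewrite /q ltr_pdivrMr// mulrC -ltr_pdivrMr//.
    apply: le_lt_trans (ler_norm _) _.
    by apply: lt_le_trans (archi_boundP (normr_ge0 _)) _; rewrite ler_nat -addn3 leq_addr.
  move: qx; rewrite !lt_min => /andP[/andP[x1 x2] x3].
  have hq := q0 k.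
  have tab : a k < t < b k.
    by apply/andP; split; rewrite /a /b; clear -x1 x2; lra.
  pose l := Num.max t (S - n).
  have lb : l < b k by rewrite gt_max; apply/andP; split; rewrite /b; clear -x2 x3; lra.
  have good := ae_and (ae_and aeG' ex) hn.
  (* A time [s] after [t] at which the energy is below [eps]. *)
  have [s /andP[ls sb] [[Gs iEs] sm]] := ae_itv_exists lb good.
  move: ls; rewrite gt_max => /andP[ts ns].
  have sS : s < S by apply: lt_trans sb _; rewrite /b gtrBl.
  have sT : timeset T s.
    exact: in_timeset (ltW (lt_trans t0 ts)) (le_trans (ltW sS) ST).
  have /andP[ta _] := tab.
  have sab : a k < s < b k by rewrite sb andbT; exact: lt_trans ts.
  apply: le_trans (mono k t s (Gt k tab) (Gs k sab) ta ts sb) _.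
  apply: (@le_trans _ _ (\int[m]_(z in halfplane) excess c (u1 s) (u2 s) z)); last first.
    by apply: sm; [rewrite ns sS|exact: lt_trans ts].
  have iEs' := iEs sT.
  rewrite -subr_ge0 -RintegralB//; last exact: ie.
  by apply: Rintegral_ge0 => z hz; rewrite subr_ge0; have /andP[] := ee s z hz.
have e0 z : halfplane z -> 0 <= e t z by move=> hz; have /andP[] := ee t z hz.
have := Rintegral_le0_ae mh (ie t iE) e0 le0; apply: ae_imp => z h hz.
have /eqP := h hz; rewrite /e mulf_eq0 => /orP[/eqP//|/eqP D].
by have := damp_gt0 lam S t z; rewrite D ltxx.
Qed.

End backward_step.

(** * The comparison principle *)

Section comparison_principle.
Context {R : realType}.
Variables (T kappa theta sigma rho gamma mu : R).
Local Notation m := (wmeas kappa theta sigma gamma mu).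
Implicit Types (u : R -> R * R -> R) (z : R * R).

Lemma excess_eq0 c (f1 f2 : R * R -> R) z :
  excess c f1 f2 z = 0 <-> f1 z <= f2 z + c.
Proof.
rewrite /excess /pos; split=> [/eqP|h].
  rewrite sqrf_eq0; case: (leP (f1 z - f2 z - c) 0) => h; first by lra.
  by rewrite gt_eqF.
by rewrite max_r ?expr0n//; lra.
Qed.

(** The solutions are ordered at [T] as the obstacles are, so the excess is small
    near [T]; [backward_step] then propagates its vanishing, with a step that
    does not depend on [S]. *)
Lemma comparison (c : R) (Phi psi1 psi2 u1 u2 : R -> R * R -> R) :
  0 < T -> 0 < sigma -> `|rho| < 1 -> 0 <= c ->
  CH T m psi1 -> CH T m psi2 ->
  is_solution T kappa theta sigma rho gamma mu Phi psi1 u1 ->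
  is_solution T kappa theta sigma rho gamma mu Phi psi2 u2 ->
  ae_cyl T (fun t z => psi1 t z <= psi2 t z + c) ->
  ae_cyl T (fun t z => u1 t z <= u2 t z + c).
Proof.
move=> T0 s0 r1 c0 P1 P2 [[C1 L1 [du1 [D1 Ld1 VI1]]] [p1 T1 _]].
move=> [[C2 L2 [du2 [D2 Ld2 VI2]]] [p2 T2 _]] p12.
have [mu1 _] := L1; have [mu2 _] := L2.
pose lam := Num.max (damping_rate kappa sigma rho gamma mu) 1.
have l0 : 0 < lam by rewrite lt_max ltr01 orbT.
have lr : damping_rate kappa sigma rho gamma mu <= lam by rewrite le_max lexx.
have uT : {ae m, forall z, halfplane z -> u1 T z - u2 T z <= c}.
  have := order_terminal T0 c0 P1 P2 p12.
  have T12 : {ae m, forall z, halfplane z -> u1 T z = psi1 T z /\ u2 T z = psi2 T z}.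
    apply: ae_wmeas; apply: (@ae_imp2 _ (mR2 R) R leb2 _ _ _ _ T1 T2) => z h1 h2 hz.
    by split; [exact: h1|exact: h2].
  apply: (@ae_imp2 _ (mR2 R) R m _ _ _ _ T12) => z h12 h hz.
  by have [-> ->] := h12 hz; exact: h.
have zero : {ae leb1, forall t, 0 < t < T ->
    {ae m, forall z, halfplane z -> excess c (u1 t) (u2 t) z = 0}}.
  have li : 0 < lam^-1 by rewrite invr_gt0.
  apply: (backward_induction li _ T0) => S /andP[S0 ST] ST'.
  have ST0 : 0 <= S <= T by rewrite (ltW S0).
  have rate := rate_nonneg s0 r1 lr (ltW l0) c0 ST0 L1 L2 Ld1 Ld2 VI1 VI2 p1 p2 p12.
  have SST : 0 < S <= T by rewrite S0.
  apply: (backward_step SST l0 c0 L1 L2 Ld1 Ld2 D1 D2 rate) => e e0.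
  case: ST' => [->|[r rS hr]].
    have [n n0 hn] := excess_near_terminal (ltW T0) c0 C1 C2 uT e0.
    exists n => //; apply: (@aeW _ (mR R) R leb1) => s /andP[ns sT] s0'.
    by apply: hn => //; rewrite (ltW s0') ltW.
  exists (S - r); first by rewrite subr_gt0.
  apply: (@ae_imp _ (mR R) R leb1 _ _ _ hr) => s hs /andP[ns sS] s0'.
  have rs : r < s by move: ns; rewrite subKr.
  have {}hs : {ae m, forall z, halfplane z -> excess c (u1 s) (u2 s) z = 0}.
    by apply: hs => //; rewrite rs (lt_le_trans sS ST).
  rewrite (_ : \int[m]_(z in halfplane) _ = \int[m]_(z in halfplane) (0 : R)).
    by rewrite Rintegral0// ltW.
  apply: ae_eq_Rintegral => //; first exact: measurable_halfplane.
  by apply: measurable_funTS; apply: measurable_excess;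
    [exact: (measurable_slice1 _ mu1)|exact: (measurable_slice1 _ mu2)].
apply: prod_ae1.
  rewrite (_ : [set p | _] = cylinder T `&` [set p | u2 p.1 p.2 + c < u1 p.1 p.2]).
    have mC := @measurable_cylinder R T.
    have mlt : measurable_fun (cylinder T) (fun p : mR3 R => u2 p.1 p.2 + c < u1 p.1 p.2).
      by apply: measurable_fun_ltr; apply: measurable_funTS => //; exact: measurable_funD.
    exact: (mlt mC [set true]).
  apply/seteqP; split => p /=.
    by move=> /not_implyP[h /negP]; rewrite -ltNge.
  by move=> [h1 h2] /(_ h1); rewrite leNgt h2.
have pt (x : R) : leb1 ([set x] : set (mR R)) = 0%E := lebesgue_measure_set1 x.
(* [zero] concerns times strictly between 0 and [T]. *)
have ends : {ae leb1, forall t : R, t <> 0 /\ t <> T}.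
  exists ([set 0] `|` [set T]); split.
  - by apply: measurableU; exact: measurable_set1.
  - apply/eqP; rewrite -measure_le0; apply: le_trans (measureU2 _ _ _) _.
    + exact: measurable_set1.
    + exact: measurable_set1.
    + by rewrite -[leRHS]adde0; apply: leeD; rewrite le_eqVlt;
      apply/orP; left; apply/eqP; exact: pt.
  - by move=> t /= /not_andP[/contrapT|/contrapT]; [left|right].
apply: (@ae_imp2 _ (mR R) R leb1 _ _ _ _ ends zero) => t [t0 tT] h.
have [tin|tout] := boolP (0 < t < T); last first.
  apply: aeW => z [/= ht _]; case/negP: tout; move: ht.
  rewrite /timeset/= in_itv/= !lt_neqAle => /andP[-> ->].
  by rewrite !andbT; apply/andP; split; apply/eqP => // /esym.
apply: (@ae_imp _ (mR2 R) R leb2 _ _ _ (wmeas_ae (h tin))) => z hz [_ /= hzz].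
by apply/excess_eq0; exact: hz.
Qed.

End comparison_principle.

Section essential_bound.
Context {R : realType}.
Variable T : R.

Lemma ae_leb_cyl (P : R -> R * R -> Prop) :
  {ae leb_cyl T, forall p, P p.1 p.2} <-> ae_cyl T P.
Proof.
have mC := @measurable_cylinder R T.
split=> -[N [mN N0 sN]].
  exists (N `&` cylinder T); split => //; first exact: measurableI.
  by move=> p /= /not_implyP[hp nP]; split => //; exact: sN.
exists (N `|` ~` cylinder T); split.
- by apply: measurableU => //; exact: measurableC.
- rewrite /leb_cyl /mrestr setIUl setICl setU0.
  apply/eqP; rewrite -measure_le0 -N0; apply: le_measure; rewrite ?inE//.
  exact: measurableI.
- move=> p /= nP; have [hp|hp] := pselect (cylinder T p); last by right.
  by left; apply: sN => /= h; apply: nP; exact: h.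
Qed.

(** The norm is 0 by convention when the cylinder is a null set; then every
    property holds almost everywhere. *)
Lemma normoo_leP u (c : R) : 0 <= c ->
  (normoo T u <= c%:E)%E <-> ae_cyl T (fun t z => `|u t z| <= c).
Proof.
move=> c0; rewrite /normoo unlock; case: ifPn => h.
  split=> H.
    apply/(ae_leb_cyl (fun t z => `|u t z| <= c)).
    have := elimT ess_supP H.
    by apply: (@ae_imp _ (mR3 R) R (leb_cyl T)) => p /=; rewrite lee_fin.
  apply: (introT ess_supP).
  have := (ae_leb_cyl (fun t z => `|u t z| <= c)).2 H.
  by apply: (@ae_imp _ (mR3 R) R (leb_cyl T)) => p /=; rewrite lee_fin.
split=> // _; apply/(ae_leb_cyl (fun t z => `|u t z| <= c)); exists setT; split => //.
by apply/eqP; rewrite -measure_le0 leNgt.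
Qed.

End essential_bound.

Lemma ae_cyl_abs_leP (R : realType) (T c : R) (f g : R -> R * R -> R) :
  ae_cyl T (fun t z => `|f t z - g t z| <= c) <->
  ae_cyl T (fun t z => f t z <= g t z + c) /\ ae_cyl T (fun t z => g t z <= f t z + c).
Proof.
split=> [h|[h1 h2]].
  split; apply: (@ae_imp _ (mR3 R) R leb3 _ _ _ h) => p hp cp;
    by have := hp cp; rewrite ler_norml => /andP[]; lra.
apply: (@ae_imp2 _ (mR3 R) R leb3 _ _ _ _ h1 h2) => p p1 p2 cp.
by have := p1 cp; have := p2 cp; rewrite ler_norml => *; apply/andP; split; lra.
Qed.

Theorem proposition1p3p17 (R : realType)
    (T kappa theta sigma rho gamma mu : R)
    (T_gt0 : 0 < T) (kappa_gt0 : 0 < kappa) (theta_gt0 : 0 < theta)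
    (sigma_gt0 : 0 < sigma) (rho_gtN1 : -1 < rho) (rho_lt1 : rho < 1)
    (gamma_gt0 : 0 < gamma) (mu_gt0 : 0 < mu)
    (Phi psi1 psi2 u1 u2 : R -> R * R -> R)
    (Phi_H2 : assumptionH2 T kappa theta sigma rho gamma mu Phi)
    (psi1_H1 : assumptionH1 T kappa theta sigma gamma mu psi1)
    (psi2_H1 : assumptionH1 T kappa theta sigma gamma mu psi2)
    (psi1_bnd : ae_cyl T (fun t z => 0 <= psi1 t z <= Phi t z))
    (psi2_bnd : ae_cyl T (fun t z => 0 <= psi2 t z <= Phi t z))
    (u1_sol : is_solution T kappa theta sigma rho gamma mu Phi psi1 u1)
    (u2_sol : is_solution T kappa theta sigma rho gamma mu Phi psi2 u2) :
  (ae_cyl T (fun t z => psi1 t z <= psi2 t z) ->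
   ae_cyl T (fun t z => u1 t z <= u2 t z)) /\
  (Loo T (fun t => psi1 t \- psi2 t) ->
   Loo T (fun t => u1 t \- u2 t) /\
   (normoo T (fun t => u1 t \- u2 t)%R
      <= normoo T (fun t => psi1 t \- psi2 t)%R)%E).
Proof.
have r1 : `|rho| < 1 by rewrite ltr_norml rho_gtN1.
have [C1 _ _ _] := psi1_H1; have [C2 _ _ _] := psi2_H1.
have cmp12 (c : R) (c0 : 0 <= c) := comparison T_gt0 sigma_gt0 r1 c0 C1 C2 u1_sol u2_sol.
have cmp21 (c : R) (c0 : 0 <= c) := comparison T_gt0 sigma_gt0 r1 c0 C2 C1 u2_sol u1_sol.
split=> [p12|].
  have h12 : ae_cyl T (fun t z => psi1 t z <= psi2 t z + 0).
    by apply: (@ae_imp _ (mR3 R) R leb3 _ _ _ p12) => p; rewrite addr0.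
  have := cmp12 0 (lexx 0) h12.
  by apply: (@ae_imp _ (mR3 R) R leb3) => p; rewrite addr0.
rewrite /Loo inE => /andP[_]; rewrite inE/= => fin.
have [c c0 cE] : exists2 c : R, 0 <= c & normoo T (fun t => psi1 t \- psi2 t)%R = c%:E.
  exists (fine (normoo T (fun t => psi1 t \- psi2 t)%R)); first by rewrite fine_ge0 ?Lnorm_ge0.
  by rewrite fineK// ge0_fin_numE// Lnorm_ge0.
have : (normoo T (fun t => psi1 t \- psi2 t)%R <= c%:E)%E by rewrite cE.
move=> /(normoo_leP _ _ c0).1 /ae_cyl_abs_leP[p12 p21].
have bound : (normoo T (fun t => u1 t \- u2 t)%R <= c%:E)%E.
  apply/(normoo_leP _ _ c0)/ae_cyl_abs_leP; split; [exact: cmp12|exact: cmp21].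
split; last by rewrite cE.
have [[[[mu1 _] _ _] _] [[[mu2 _] _ _] _]] := (u1_sol, u2_sol).
rewrite inE; apply/andP; split; rewrite inE/=.
  by apply: measurable_funB.
exact: le_lt_trans bound (ltry _).
Qed.
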